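(* Let $D$ be a subordinator with infinite Lévy measure $\nu$, let $E$ be the inverse of $D$, and let $W$ be a one-dimensional standard Brownian motion such that $E$ is independent of $W$. Then for all $T>0$ at which $\nu$ has no mass (i.e. $\nu(\{T\})=0$), $$\mathbb{P}\Bigl(\sup_{0\le t\le T} |W(E(t))|\le \epsilon \Bigr)\sim\frac{32}{\pi^3}\, \nu(T,\infty) \sum_{k=1}^\infty \frac{(-1)^{k-1}}{(2k-1)^3}\,\epsilon^2 \quad \text{as } \epsilon\downarrow 0.$$ This is interpreted as $\mathbb{P}(\sup_{0\le t\le T} |W(E(t))|\le \epsilon)=o(\epsilon^2)$ as $\epsilon\downarrow 0$ if $\nu(T,\infty)=0$.
   Context: A subordinator $D=(D(t))_{t\ge 0}$ is a one-dimensional nondecreasing Lévy process with càdlàg paths starting at $0$. Its Laplace exponent $\psi$ and Lévy measure $\nu$ are given by $$\mathbb{E}[e^{-sD(t)}]=e^{-t\psi(s)},\qquad \psi(s)=bs+\int_0^\infty (1-e^{-sx})\,\nu(\mathrm{d}x),\quad s>0,$$ where $b\ge 0$ and $\nu$ is a measure on $(0,\infty)$ with $\int_0^\infty (x\wedge 1)\,\nu(\mathrm{d}x)<\infty$. The Lévy measure is called infinite if $\nu(0,\infty)=\infty$. The inverse (first hitting time process) of $D$ is $E(t):=\inf\{u>0: D(u)>t\}$, $t\ge 0$; when $\nu$ is infinite it has continuous, nondecreasing paths starting at $0$. For two positive functions $f,g$, the notation $f(\epsilon)\sim g(\epsilon)$ as $\epsilon\downarrow 0$ means $\lim_{\epsilon\downarrow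 0} f(\epsilon)/g(\epsilon)=1$. *)

(* Defs.v *)
From HB Require Import structures.
From mathcomp Require Import all_boot all_order all_algebra.
From mathcomp Require Import all_classical all_reals all_analysis.

Set Implicit Arguments.
Unset Strict Implicit.
Unset Printing Implicit Defensive.
Import Order.TTheory GRing.Theory Num.Theory.
Import numFieldNormedType.Exports.

Local Open Scope classical_set_scope.
Local Open Scope ring_scope.

(* Processes indexed by [0, +oo[ are represented by families indexed by the
   whole of R; the values at negative times are irrelevant everywhere. *)

Section independence.
Context d (Omega : measurableType d) (R : realType) (P : probability Omega R).

(* The sets B i may be the whole line, so the product rule for the full family
   contains the product rule for every subfamily. *)
Definition mutually_independent n (X : 'I_n -> Omega -> R) : Prop :=
  forall B : 'I_n -> set (measurableTypeR R), (forall i, measurable (B i)) ->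
    P (\bigcap_(i in [set: 'I_n]) X i @^-1` B i) =
    (\prod_(i < n) P (X i @^-1` B i))%E.

Definition process_sigma_algebra (X : R -> Omega -> R) : set (set Omega) :=
  <<s \bigcup_(t in `[0, +oo[)
        preimage_set_system [set: Omega] (X t)
          (@measurable _ (measurableTypeR R)) >>.

Definition independent_processes (X Y : R -> Omega -> R) : Prop :=
  forall A B : set Omega,
    process_sigma_algebra X A -> process_sigma_algebra Y B ->
    P (A `&` B) = (P A * P B)%E.

Definition independent_increments (X : R -> {RV P >-> R}) : Prop :=
  forall (n : nat) (t : nat -> R),
    0 <= t 0%N -> (forall i, t i <= t i.+1) ->
    mutually_independent (fun (i : 'I_n) w => X (t i.+1) w - X (t i) w).

End independence.

Section processes.
Context d (Omega : measurableType d) (R : realType) (P : probability Omega R).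

Definition cadlag (f : R -> R) : Prop :=
  (forall t : R, 0 <= t -> f x @[x --> t^'+] --> f t) /\
  (forall t : R, 0 < t -> cvg (f x @[x --> t^'-])).

(* Continuity in probability is not listed: it follows from the regularity of
   the paths and the stationarity of the increments. *)
Record levy_process (X : R -> {RV P >-> R}) : Prop := {
  levy_start : forall w, X 0 w = 0 ;
  levy_cadlag : forall w, cadlag (fun t => X t w) ;
  levy_independent : independent_increments X ;
  levy_stationary : forall (s h : R) (B : set (measurableTypeR R)),
    0 <= s -> 0 <= h -> measurable B ->
    P ((fun w => X (s + h) w - X s w) @^-1` B) = P (X h @^-1` B)
}.

(* A measure on ]0, +oo[ is encoded as a Borel measure on R that does not charge
   ]-oo, 0]. *)
Record levy_measure (nu : {measure set (measurableTypeR R) -> \bar R})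
    : Prop := {
  levy_measure_pos : nu `]-oo, 0%R]%classic = 0%E ;
  levy_measure_integrable :
    (\int[nu]_(x in `]0%R, +oo[) (Num.min x 1)%:E < +oo)%E
}.

Definition laplace_exponent (b : R)
    (nu : {measure set (measurableTypeR R) -> \bar R}) (s : R) : R :=
  b * s + \int[nu]_(x in `]0, +oo[) (1 - expR (- (s * x))).

Record subordinator (b : R)
    (nu : {measure set (measurableTypeR R) -> \bar R})
    (D : R -> {RV P >-> R}) : Prop := {
  subordinator_levy : levy_process D ;
  subordinator_nondecreasing :
    forall w (s t : R), 0 <= s -> s <= t -> D s w <= D t w ;
  subordinator_drift : 0 <= b ;
  subordinator_measure : levy_measure nu ;
  subordinator_laplace : forall t s : R, 0 <= t -> 0 < s ->
    ('E_P[fun w => expR (- (s * D t w))] =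
      (expR (- (t * laplace_exponent b nu s)))%:E)%E
}.

(* Real infimum, with the convention inf set0 = 0. When the Levy measure is
   infinite, D is almost surely unbounded, so the set is empty only on a
   negligible event. *)
Definition inverse_process (D : R -> Omega -> R) (t : R) (w : Omega) : R :=
  inf [set u | 0 < u /\ t < D u w].

Record standard_brownian_motion (W : R -> {RV P >-> R}) : Prop := {
  brownian_start : forall w, W 0 w = 0 ;
  brownian_continuous :
    forall w, {within `[0, +oo[, continuous (fun t : R => W t w)} ;
  brownian_independent : independent_increments W ;
  (* the second parameter of normal_prob is the standard deviation *)
  brownian_normal : forall (s t : R) (B : set (measurableTypeR R)),
    0 <= s -> s < t -> measurable B ->
    P ((fun w => W t w - W s w) @^-1` B) = normal_prob 0 (Num.sqrt (t - s)) B
}.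

Definition time_change (W E : R -> Omega -> R) (t : R) (w : Omega) : R :=
  W (E t w) w.

(* The supremum is taken in the extended reals, since the real sup of an
   unbounded set is 0 by convention. *)
Definition small_ball_probability (X : R -> Omega -> R) (T e : R) : R :=
  fine (P [set w | (ereal_sup [set `|X t w|%:E | t in `[0%R, T]] <= e%:E)%E]).

End processes.

Definition equiv_at_right0 (R : realType) (f g : R -> R) : Prop :=
  f e / g e @[e --> 0^'+] --> (1 : R).

(* Main.v *)
(* Let tau be the exit time of W from [-e, e] and F(x) = P(E(T) < x). Since E is
   independent of W and its paths fill [0, E(T)], the small ball probability is
   the mean of F(tau). Up to a null set {E(T) < x} is {D(x) > T}, and comparing
   Laplace transforms at small times gives F(x) = nu(T, oo) x + o(x) as x -> 0.
   As E[tau] = e^2 and E[tau^2] = O(e^4), the probability is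
   nu(T, oo) e^2 + o(e^2); the constant 32 / pi^3 cancels the alternating sum,
   which equals pi^3 / 32.
   Stopping times are avoided by observing W on a mesh: with A_n the event that
   |W| <= e at the first n mesh points, the identity
   dl P(A_n) = E[1_{A_n} (w_{n+1}^2 - w_n^2)] replaces E[tau] = E[W(tau)^2], and
   the exact event is the decreasing limit along dyadic meshes. *)
Require Import Defs.
From HB Require Import structures.
From mathcomp Require Import all_boot all_order all_algebra.
From mathcomp Require Import all_classical all_reals all_analysis.
From mathcomp Require Import measurable_realfun ring lra.
Import Order.TTheory GRing.Theory Num.Theory.
Import numFieldNormedType.Exports.
Local Open Scope classical_set_scope.
Local Open Scope ring_scope.
Set Implicit Arguments.
Unset Strict Implicit.
Unset Printing Implicit Defensive.

(** * The alternating sum of the odd inverse cubes *)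

Section cubic_beta_series.
Context {R : realType}.
Implicit Types (x t : R) (n k : nat).

(** The Laplace exponent knows [D] only through exponentials, whereas the tail of [D x] at [T] is
    the mean of an indicator. The bridge is the variable z = e^-y: the weight 1 - z tames small
    jumps, the functions z^j (1 - z) have means given by the exponent at j and j + 1, and Bernstein
    polynomials carry their limits over to Lipschitz test functions squeezed between two indicators.
    The drift sits at z = 1, where these test functions vanish, and nu {T} = 0 closes the squeeze. A
    walk on a mesh overshoots the interval when it leaves it. This is harmless for the lower bound
    of the mean exit time; for the upper bound it costs fourth moments of the steps, a cost that
    vanishes with the mesh. Averaging over the exit time needs the small-time estimate at every x,
    hence its form c x up to k x + K x^2, and a second moment, which the geometric decay of the
    confinement probabilities provides. The paths of [D] are strictly increasing and unbounded only
    almost surely. Measurability is therefore proved on every path, and the comparison with meshes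
    up to a null set. *)

Lemma is_derive_bigsum (n : nat) (f : nat -> R -> R) (df : nat -> R) x :
  (forall k, is_derive x 1 (f k) (df k)) ->
  is_derive x 1 (fun t => \sum_(k < n) f k t) (\sum_(k < n) df k).
Proof.
move=> fdf; elim: n => [|n IH].
  rewrite big_ord0 (_ : (fun _ => _) = cst 0); first exact: is_derive_cst.
  by apply/funext => t; rewrite big_ord0.
rewrite big_ord_recr (_ : (fun _ => _) =
  (fun t => \sum_(k < n) f k t) + f n); first exact: is_deriveD.
by apply/funext => t; rewrite big_ord_recr.
Qed.

Lemma is_derive_continuous_within (f df : R -> R) (a b : R) :
  (forall x, x \in `[a, b] -> is_derive x 1 f (df x)) ->
  {within `[a, b], continuous f}.
Proof.
move=> fdf; apply: derivable_within_continuous => x xab.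
by have := fdf x xab; case.
Qed.

Lemma le_MVT (f df : R -> R) (a b C : R) : a <= b ->
  (forall x, x \in `[a, b] -> is_derive x 1 f (df x)) ->
  (forall x, x \in `[a, b] -> `|df x| <= C) ->
  `|f b - f a| <= C * (b - a).
Proof.
move=> ab fdf dfC.
have fdf' x : x \in `]a, b[ -> is_derive x 1 f (df x).
  by rewrite in_itv/= => /andP[ax xb]; apply: fdf; rewrite in_itv/= !ltW.
have [c cab e] := MVT_segment ab fdf' (is_derive_continuous_within fdf).
by rewrite e normrM (ger0_norm (_ : 0 <= b - a)) ?subr_ge0// ler_wpM2r ?subr_ge0 ?dfC.
Qed.

Lemma is_derive_monomial (c x : R) n :
  is_derive x 1 (fun t => c * t ^+ n.+1) (c * (n.+1%:R * x ^+ n)).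
Proof.
have -> : (fun t => c * t ^+ n.+1) = c *: (@id R^o) ^+ n.+1.
  by apply/funext => t; rewrite fctE.
by apply: is_derive_eq; rewrite /GRing.scale/= mulr1.
Qed.

Lemma is_derive_comp_scale (f df : R -> R) (c x : R) :
  (forall y : R, is_derive y 1 f (df y)) ->
  is_derive x 1 (fun t => f (c * t)) (c * df (c * x)).
Proof.
move=> fdf; have dc : is_derive x 1 (c *: (@id R^o)) c.
  by apply: is_derive_eq; rewrite /GRing.scale/= mulr1.
rewrite mulrC; exact: (is_derive1_comp (fdf (c * x)) dc).
Qed.

(** The geometric sum turns the derivative of [g] into a remainder of size at most t^(2n), which is
    the derivative of [e]. The mean value theorem for [g + e] and [g - e] on [0, 1] then bounds
    [g 1] by [e 1]. *)
Lemma atan_partial_sum n :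
  `|\sum_(k < n) (-1) ^+ k / (2 * k%:R + 1) - pi / 4| <= (2 * n%:R + 1)^-1 :> R.
Proof.
pose g : R -> R :=
  (fun t => \sum_(k < n) (-1) ^+ k / (2 * k%:R + 1) * t ^+ (2 * k).+1) - atan.
pose e t := (2 * n%:R + 1)^-1 * t ^+ (2 * n).+1.
have e0 k : 2 * k%:R + 1 != 0 :> R.
  by rewrite gt_eqF// ltr_wpDl// mulr_ge0.
have gd t : is_derive t 1 g
    (\sum_(k < n) (-1) ^+ k * t ^+ (2 * k) - (1 + t ^+ 2)^-1).
  apply: is_deriveB.
  apply: (@is_derive_bigsum n
    (fun k t => (-1) ^+ k / (2 * k%:R + 1) * t ^+ (2 * k).+1)
    (fun k => (-1) ^+ k * t ^+ (2 * k))) => k.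
  apply: (is_derive_eq (is_derive_monomial _ _ _)).
  by rewrite -[(2 * k).+1%:R]natr1 natrM; field.
have ed t : is_derive t 1 e (t ^+ (2 * n)).
  apply: (is_derive_eq (is_derive_monomial _ _ _)).
  by rewrite -[(2 * n).+1%:R]natr1 natrM; field.
have geo t : \sum_(k < n) (-1) ^+ k * t ^+ (2 * k) - (1 + t ^+ 2)^-1 =
    - (-1) ^+ n * t ^+ (2 * n) / (1 + t ^+ 2).
  have t0 : 1 + t ^+ 2 != 0 by rewrite gt_eqF// ltr_pwDl// sqr_ge0.
  under eq_bigr do rewrite exprM -exprMn mulN1r.
  have := subrX1 (- t ^+ 2) n => h.
  rewrite mulNr exprM -exprMn mulN1r.
  have -> : (- t ^+ 2) ^+ n =
    (- t ^+ 2 - 1) * \sum_(i < n) (- t ^+ 2) ^+ i + 1 by rewrite -h; ring.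
  by field.
have g0 : g 0 = 0.
  rewrite /g !fctE atan0 subr0 big1// => k _; by rewrite expr0n mulr0.
have h0 : e 0 = 0 by rewrite /e expr0n mulr0.
have g1 : g 1 = \sum_(k < n) (-1) ^+ k / (2 * k%:R + 1) - pi / 4.
  by rewrite /g !fctE atan1; under eq_bigr do rewrite expr1n mulr1.
have e1 : e 1 = (2 * n%:R + 1)^-1 by rewrite /e expr1n mulr1.
have bnd t : `|- (-1) ^+ n * t ^+ (2 * n) / (1 + t ^+ 2)| <= t ^+ (2 * n).
  have t2 : 0 < 1 + t ^+ 2 by rewrite ltr_pwDl// sqr_ge0.
  rewrite mulNr normrM normrN normrM normrX normrN1 expr1n mul1r.
  rewrite (ger0_norm (exprn_even_ge0 _ _))// ?oddM// normfV gtr0_norm//.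
  by rewrite ler_pdivrMr// ler_peMr ?exprn_even_ge0 ?oddM// lerDl sqr_ge0.
rewrite -g1 -e1 ler_norml; apply/andP; split.
- have dge t : is_derive t 1 (g + e)
      (- (-1) ^+ n * t ^+ (2 * n) / (1 + t ^+ 2) + t ^+ (2 * n)).
    by rewrite -geo; exact: is_deriveD.
  have [c _] := MVT ltr01 (fun t _ => dge t)
    (is_derive_continuous_within (fun t _ => dge t)).
  rewrite !fctE g0 h0 addr0 !subr0 mulr1 => h.
  have := bnd c; rewrite ler_norml => /andP[b1 _]; lra.
- have dge t : is_derive t 1 (g - e)
      (- (-1) ^+ n * t ^+ (2 * n) / (1 + t ^+ 2) - t ^+ (2 * n)).
    by rewrite -geo; exact: is_deriveB.
  have [c _] := MVT ltr01 (fun t _ => dge t)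
    (is_derive_continuous_within (fun t _ => dge t)).
  rewrite !fctE g0 h0 subrr !subr0 mulr1 => h.
  have := bnd c; rewrite ler_norml => /andP[_ b1]; lra.
Qed.

(** Duplication formula at y = x / 2: sin y >= y cos (pi / 4) and cos y >= cos (pi / 4), whose
    square is 1 / 2. Any positive constant would do, the aim being that x / sin x stays bounded. *)
Lemma sin_ge_half x : 0 <= x -> x <= pi / 2 -> x / 2 <= sin x.
Proof.
move=> x0 xpi; have pi0 := @pi_gt0 R.
pose y := x / 2.
have y0 : 0 <= y by rewrite /y; lra.
have cosle (u : R) : 0 <= u -> u <= pi / 4 -> cos (pi / 4) <= cos u.
  move=> u0 upi; rewrite leNgt; apply/negP.
  rewrite ltr_cos ?in_itv/=; first by rewrite ltNge upi.
  - by apply/andP; split; lra.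
  - by apply/andP; split; lra.
have c4 : 0 < cos (pi / 4) :> R by apply: cos_gt0_pihalf; apply/andP; split; lra.
have c42 : cos (pi / 4) ^+ 2 = 1 / 2 :> R.
  have := cos_mulr2n (pi / 4 : R).
  have -> : pi / 4 *+ 2 = pi / 2 :> R by rewrite -mulr_natr; field.
  rewrite cos_pihalf -mulr_natr => h; lra.
have siny : y * cos (pi / 4) <= sin y.
  have [c cy] := MVT_segment y0 (fun u _ => is_derive_sin u)
    (is_derive_continuous_within (fun u _ => is_derive_sin u)).
  rewrite sin0 !subr0 => ->; rewrite mulrC ler_wpM2r//.
  by move: cy; rewrite in_itv/= => /andP[c0 cy]; apply: cosle => //; rewrite (le_trans cy)// /y; lra.
have -> : x = y *+ 2 by rewrite /y -mulr_natr; field.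
rewrite sin_mulr2n -mulr_natr.
have := cosle y y0 => /(_ ltac:(rewrite /y; lra)) cy.
have : y * cos (pi / 4) * cos (pi / 4) <= sin y * cos y.
  by apply: ler_pM => //; rewrite ?mulr_ge0// ltW.
rewrite -mulrA -expr2 c42 -mulr_natr; lra.
Qed.

(** Telescoping of 2 sin x cos ((2k + 1) x) = sin ((2k + 2) x) - sin (2k x). *)
Lemma sum_cos_odd n x :
  2 * sin x * (\sum_(k < n) cos ((2 * k%:R + 1) * x)) = sin (2 * n%:R * x).
Proof.
elim: n => [|n IH]; first by rewrite big_ord0 !mulr0 mul0r sin0.
rewrite big_ord_recr/= mulrDr IH.
have -> : 2 * n.+1%:R * x = (2 * n%:R + 1) * x + x by rewrite -natr1; ring.
have -> : 2 * n%:R * x = (2 * n%:R + 1) * x - x by ring.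
rewrite sinB sinD; ring.
Qed.

(** Two integrations by parts of x^2 cos (m x); [S] and [C] stand for the sine and cosine of
    frequency [m]. *)
Lemma is_derive_sqr_antiderivative (S C : R -> R) (m x : R) : m != 0 ->
  is_derive x 1 S (m * C x) -> is_derive x 1 C (m * - S x) ->
  is_derive x 1 (fun t => t ^+ 2 * S t / m + 2 * t * C t / m ^+ 2
    - 2 * S t / m ^+ 3) (x ^+ 2 * C x).
Proof.
move=> m0 dS dC.
rewrite (_ : (fun _ => _) = m^-1 *: ((@id R^o) ^+ 2 * S)
    + (2 / m ^+ 2) *: ((@id R^o) * C) - (2 / m ^+ 3) *: S); last first.
  apply/funext => t; rewrite !fctE /GRing.scale/= /GRing.scale/=; ring.
apply: (is_derive_eq (is_deriveB (is_deriveD (is_deriveZ m^-1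
  (is_deriveM (is_deriveX 2 (is_derive_id x 1)) dS))
  (is_deriveZ (2 / m ^+ 2) (is_deriveM (is_derive_id x 1) dC)))
  (is_deriveZ (2 / m ^+ 3) dS))).
rewrite !fctE /GRing.scale/= /GRing.scale/=.
by field.
Qed.

(* Phi n is a primitive of x^2 sin (2 n x) / (2 sin x), so that Phi n (pi / 2)
   tends to 0 as in the Riemann-Lebesgue lemma, whereas its explicit value there
   combines the Leibniz series for pi / 4 with the sum of inverse cubes. *)
Let Phi n x : R := \sum_(k < n) (x ^+ 2 * sin ((2 * k%:R + 1) * x) / (2 * k%:R + 1)
  + 2 * x * cos ((2 * k%:R + 1) * x) / (2 * k%:R + 1) ^+ 2
  - 2 * sin ((2 * k%:R + 1) * x) / (2 * k%:R + 1) ^+ 3).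

Let is_derive_Phi n x : is_derive x 1 (Phi n)
  (x ^+ 2 * \sum_(k < n) cos ((2 * k%:R + 1) * x)).
Proof.
rewrite mulr_sumr; apply: (@is_derive_bigsum n (fun k x => x ^+ 2 * sin ((2 * k%:R + 1) * x) / (2 * k%:R + 1)
  + 2 * x * cos ((2 * k%:R + 1) * x) / (2 * k%:R + 1) ^+ 2
  - 2 * sin ((2 * k%:R + 1) * x) / (2 * k%:R + 1) ^+ 3)
  (fun k => x ^+ 2 * cos ((2 * k%:R + 1) * x))) => k.
have e0 : 2 * k%:R + 1 != 0 :> R by rewrite gt_eqF// ltr_wpDl// mulr_ge0.
exact: (is_derive_sqr_antiderivative e0
  (is_derive_comp_scale (2 * k%:R + 1) x (@is_derive_sin R))
  (is_derive_comp_scale (2 * k%:R + 1) x (@is_derive_cos R))).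
Qed.

Let Phi_pihalf n : Phi n (pi / 2) = pi ^+ 2 / 4 * (\sum_(k < n) (-1) ^+ k / (2 * k%:R + 1))
  - 2 * \sum_(k < n) (-1) ^+ k / (2 * k%:R + 1) ^+ 3.
Proof.
rewrite !mulr_sumr -sumrB; apply: eq_bigr => k _.
have e0 : 2 * k%:R + 1 != 0 :> R by rewrite gt_eqF// ltr_wpDl// mulr_ge0.
have -> : (2 * k%:R + 1) * (pi / 2) = pi / 2 + pi *+ k :> R.
  by rewrite -mulr_natr; field.
rewrite (alternatingn (@sinDpi R)) (alternatingn (@cosDpi R)).
rewrite sin_pihalf cos_pihalf; by field.
Qed.

(** The derivative g(x) sin (2 n x) is integrated by parts once, which gains 1 / n. As [g] is 0 / 0
    at the origin, this is done on [1 / n, pi / 2] only; on [0, 1 / n] the sum of n cosines is at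
    most n, which makes that part at most 1 / n^2. The constant 10 is generous. *)
Lemma Phi_pihalf_le n : (2 <= n)%N -> `|Phi n (pi / 2)| <= 10 / n%:R.
Proof.
move=> n2; have pi2 := @pi_ge2 R; have pi4 := @pihalf_lt2 R.
have n0 : 0 < n%:R :> R by rewrite ltr0n (leq_trans _ n2).
have nn : 2 <= n%:R :> R by rewrite ler_nat.
pose al : R := n%:R^-1.
have al0 : 0 < al by rewrite invr_gt0.
have al1 : al <= 1 / 2 by rewrite /al -div1r ler_pdivrMr//; lra.
pose g (x : R) := x ^+ 2 / (2 * sin x).
pose dg (x : R) := x / sin x - x ^+ 2 * cos x / (2 * sin x ^+ 2).
have sinx (x : R) : 0 < x -> x <= pi / 2 -> 0 < sin x /\ x <= 2 * sin x.
  move=> x0 xp; have := sin_ge_half (ltW x0) xp; split; lra.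
have gle (x : R) : 0 < x -> x <= pi / 2 -> `|g x| <= x.
  move=> x0 xp; have [s0 sx] := sinx _ x0 xp.
  rewrite /g ger0_norm; last by rewrite divr_ge0 ?sqr_ge0//; lra.
  by rewrite ler_pdivrMr ?mulr_gt0// expr2 ler_wpM2l// ltW.
have dgle (x : R) : 0 < x -> x <= pi / 2 -> `|dg x| <= 4.
  move=> x0 xp; have [s0 sx] := sinx _ x0 xp.
  rewrite (le_trans (ler_normB _ _))//.
  have h1 : `|x / sin x| <= 2.
    rewrite ger0_norm ?divr_ge0 ?(ltW x0) ?(ltW s0)//.
    by rewrite ler_pdivrMr.
  have h2 : `|x ^+ 2 * cos x / (2 * sin x ^+ 2)| <= 2.
    rewrite normrM normrM normfV (ger0_norm (sqr_ge0 x)).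
    have s2 : 0 < 2 * sin x ^+ 2 by rewrite mulr_gt0 ?exprn_gt0.
    rewrite (gtr0_norm s2) ler_pdivrMr//.
    have := cos_max x => c1.
    have : x ^+ 2 * `|cos x| <= x ^+ 2 by rewrite ler_piMr ?sqr_ge0.
    have : x ^+ 2 <= (2 * sin x) ^+ 2.
      by rewrite lerXn2r // nnegrE ?mulr_ge0 // ltW.
    rewrite exprMn; lra.
  by rewrite (le_trans (lerD h1 h2))//; lra.
(* The boundary term of the integration by parts is added, so that the derivative only involves g'
   divided by 2 n. *)
pose Psi (x : R) := Phi n x + cos (2 * n%:R * x) / (2 * n%:R) * g x.
have dPsi (x : R) : 0 < x -> x <= pi / 2 ->
    is_derive x 1 Psi (cos (2 * n%:R * x) / (2 * n%:R) * dg x).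
  move=> x0 xp; have [s0 sx] := sinx _ x0 xp.
  pose C t : R := cos (2 * n%:R * t).
  have dC : is_derive x 1 C (2 * n%:R * - sin (2 * n%:R * x)) :=
    is_derive_comp_scale (2 * n%:R) x (@is_derive_cos R).
  have s0' : sin x != 0 by rewrite gt_eqF.
  have dsi := is_deriveV s0' (is_derive_sin x).
  have dPhi := is_derive_Phi n x.
  rewrite (_ : Psi = Phi n + (2 * n%:R)^-1 *: (C *
     (2^-1 *: ((@id R^o) ^+ 2 * (fun t => (sin t)^-1))))); last first.
    apply/funext => t; rewrite !fctE /Psi /g /C /GRing.scale/= /GRing.scale/=.
    rewrite !invfM; congr (_ + _); set u := (sin t)^-1; set v := n%:R^-1; set w := cos _; ring.
  apply: (is_derive_eq (is_deriveD dPhi (is_deriveZ (2 * n%:R)^-1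
    (is_deriveM dC (is_deriveZ 2^-1 (is_deriveM (is_deriveX 2 (is_derive_id x 1)) dsi)))))).
  rewrite -[X in _ * X](@mulKf _ (2 * sin x)) ?mulf_neq0// sum_cos_odd.
  rewrite !fctE /dg /C /GRing.scale/= /GRing.scale/= /GRing.scale/=.
  by field; rewrite s0' gt_eqF// (lt_le_trans _ nn).
have h1 : `|Psi (pi / 2) - Psi al| <= 2 / n%:R * (pi / 2 - al).
  apply: (@le_MVT Psi (fun x => cos (2 * n%:R * x) / (2 * n%:R) * dg x)); first lra.
  - move=> x; rewrite in_itv/= => /andP[x0 x1].
    by apply: dPsi => //; rewrite (lt_le_trans al0).
  - move=> x; rewrite in_itv/= => /andP[x0 x1].
    have dgx := dgle x (lt_le_trans al0 x0) x1.
    rewrite normrM normrM normfV (@ger0_norm _ (2 * _)) ?mulr_ge0//.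
    have -> : 2 / n%:R = 1 / (2 * n%:R) * 4 :> R by field; rewrite gt_eqF.
    rewrite ler_pM// ?divr_ge0 ?mulr_ge0//.
    by rewrite ler_wpM2r ?invr_ge0 ?mulr_ge0// cos_max.
have h2 : `|Phi n al - Phi n 0| <= n%:R * al ^+ 2 * (al - 0).
  apply: (@le_MVT _ _ _ _ _ _ (fun x hx => is_derive_Phi n x)); first exact: ltW.
  move=> x; rewrite in_itv/= => /andP[x0 x1].
  rewrite normrM ger0_norm ?sqr_ge0// mulrC ler_pM ?sqr_ge0//; last first.
    by rewrite lerXn2r ?nnegrE// ltW.
  rewrite (le_trans (ler_norm_sum _ _ _))//.
  rewrite (@le_trans _ _ (\sum_(k < n) (1 : R)))//; last by rewrite sumr_const card_ord.
  by apply: ler_sum => k _; exact: cos_max.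
have Phi0 : Phi n 0 = 0.
  rewrite /Phi big1// => k _.
  by rewrite !(mulr0, sin0, mul0r, expr0n, addr0, subr0).
move: h2; rewrite Phi0 !subr0 => h2.
have cg (x : R) : 0 < x -> x <= pi / 2 -> `|cos (2 * n%:R * x) / (2 * n%:R) * g x| <= x * (n%:R^-1 / 2).
  move=> x0 xp; rewrite mulrC normrM ler_pM ?gle//.
  rewrite normrM normfV (@ger0_norm _ (2 * _)) ?mulr_ge0//.
  rewrite [leRHS](_ : _ = (2 * n%:R)^-1); last by rewrite invfM mulrC.
  by rewrite ler_piMl ?invr_ge0 ?mulr_ge0// cos_max.
have c1 := cg (pi / 2) ltac:(lra) ltac:(lra).
have c2 := cg al al0 ltac:(lra).
have e1 : n%:R * al ^+ 2 * al = al ^+ 2.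
  by rewrite /al; field; rewrite gt_eqF.
rewrite e1 in h2.
rewrite /Psi -/al in h1; move: h1 c1 c2 h2.
set u := (X in `|X| <= pi / 2 * _).
set v := (X in `|X| <= al * _).
rewrite -/al !ler_norml => /andP[z1 z2] /andP[u1 u2] /andP[v1 v2] /andP[w1 w2].
have alal : al ^+ 2 <= al by rewrite expr2 ler_piMl//; lra.
have alpi : 0 <= al * (pi / 2) <= 2 * al.
  apply/andP; split; first by rewrite mulr_ge0; lra.
  by rewrite mulrC ler_wpM2r//; lra.
move/andP: alpi => [alpi0 alpi].
have := sqr_ge0 al => al2.
rewrite -/u -/v in z1 z2.
by apply/andP; split; lra.
Qed.

(** In [Phi_pihalf] the left side tends to 0 and the Leibniz sum to pi / 4, so twice the cubic sum
    tends to pi^3 / 16. *)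
Lemma sum_alternating_odd_cubes :
  \big[+%R/0]_(1 <= k <oo) ((-1) ^+ k.-1 / (2 * k%:R - 1) ^+ 3 : R) = pi ^+ 3 / 32.
Proof.
apply/cvg_lim => //.
rewrite -(@cvg_shiftS _ _ (nbhs (pi ^+ 3 / 32))).
have -> : (fun n => \sum_(1 <= k < n.+1) ((-1) ^+ k.-1 / (2 * k%:R - 1) ^+ 3 : R)) =
    (fun n => \sum_(k < n) (-1) ^+ k / (2 * k%:R + 1) ^+ 3).
  apply/funext => n; rewrite big_add1/= big_mkord; apply: eq_bigr => k _.
  by congr (_ / _ ^+ _); rewrite -natr1; ring.
(* The errors of the Leibniz sum and of [Phi_pihalf_le] add up to at most K / n. *)
pose K : R := pi ^+ 2 + 10.
apply/cvgrPdist_le => e e0.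
near=> n.
have n2 : (2 <= n)%N by near: n; exact: nbhs_infty_ge.
have n0 : 0 < n%:R :> R by rewrite ltr0n (leq_trans _ n2).
have hP := Phi_pihalf_le n2; rewrite Phi_pihalf in hP.
have hA := atan_partial_sum n.
have pi0 := @pi_gt0 R.
have hA' : `|(pi : R) ^+ 2 / 4 * (\sum_(k < n) (-1) ^+ k / (2 * k%:R + 1)) - pi ^+ 3 / 16|
     <= pi ^+ 2 * n%:R^-1.
  rewrite (_ : _ - _ = pi ^+ 2 / 4 *
    (\sum_(k < n) (-1) ^+ k / (2 * k%:R + 1) - pi / 4)); last by field.
  rewrite normrM ger0_norm; last by rewrite divr_ge0 ?sqr_ge0.
  apply: ler_pM => //; first by rewrite divr_ge0 ?sqr_ge0.
    by have := sqr_ge0 (pi : R); lra.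
  rewrite (le_trans hA)// lef_pV2 ?posrE; lra.
have : `|(pi : R) ^+ 3 / 32 - \sum_(k < n) (-1) ^+ k / (2 * k%:R + 1) ^+ 3| <= K * n%:R^-1.
  rewrite /K; move: hP hA'; set a := pi ^+ 2 / 4 * _; set b := \sum_(k < n) _.
  rewrite (_ : pi ^+ 3 / 16 = 2 * (pi ^+ 3 / 32)); last by field.
  have inv0 : 0 < n%:R^-1 :> R by rewrite invr_gt0.
  have := sqr_ge0 (pi : R).
  set p2 := pi ^+ 2; set p3 := pi ^+ 3 / 32.
  rewrite !ler_norml => p0 /andP[? ?] /andP[? ?]; apply/andP; split; nra.
move/le_trans; apply.
rewrite ler_pdivrMr// mulrC -ler_pdivrMr//.
near: n; exact: nbhs_infty_ger.
Unshelve. all: by end_near. Qed.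

End cubic_beta_series.

(** * Moments of the normal law *)

Section real_expectation.
Context d (T : measurableType d) (R : realType).
Implicit Types (mu : {measure set T -> \bar R}) (f g : T -> R).

Lemma integrable_le_norm mu f g : measurable_fun setT f ->
  mu.-integrable setT (EFin \o g) -> (forall x, `|f x| <= g x) ->
  mu.-integrable setT (EFin \o f).
Proof.
move=> mf ig fg; apply: (le_integrable measurableT _ _ ig).
  exact/measurable_EFinP.
by move=> x _; rewrite /= lee_fin (le_trans (fg x))// ler_norm.
Qed.

Lemma integrable_addR mu f g : mu.-integrable setT (EFin \o f) ->
  mu.-integrable setT (EFin \o g) ->
  mu.-integrable setT (EFin \o (fun x => f x + g x)).
Proof. by move=> fi gi; exact: (integrableD measurableT fi gi). Qed.

Lemma integrable_subR mu f g : mu.-integrable setT (EFin \o f) ->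
  mu.-integrable setT (EFin \o g) ->
  mu.-integrable setT (EFin \o (fun x => f x - g x)).
Proof. by move=> fi gi; exact: (integrableB measurableT fi gi). Qed.

Lemma integrable_scaleR mu (k : R) f : mu.-integrable setT (EFin \o f) ->
  mu.-integrable setT (EFin \o (fun x => k * f x)).
Proof.
move=> fi; rewrite (_ : EFin \o _ = (fun x => k%:E * (EFin \o f) x)%E).
  exact: integrableZl.
by apply/funext => x /=; rewrite EFinM.
Qed.

Lemma integrable_cstR (P : probability T R) (k : R) :
  P.-integrable setT (EFin \o (fun=> k)).
Proof. exact: finite_measure_integrable_cst. Qed.

Lemma Rintegral_cstT (P : probability T R) (k : R) : \int[P]_x k = k.
Proof.
by rewrite Rintegral_cst// [X in fine X]probability_setT mulr1.
Qed.

End real_expectation.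

Section standard_normal_moments.
Context d (T : measurableType d) (R : realType) (P : probability T R).
Variable Z : T -> R.
Hypothesis mZ : measurable_fun setT Z.
(** The moments below are extracted from this single identity by comparing exp with polynomials, so
    that the density enters them only through [normal_mgf]. *)
Hypothesis mgf : forall m : R,
  (\int[P]_x (expR (m * Z x))%:E)%E = (expR (m ^+ 2 / 2))%:E.

Let mexp (m : R) : measurable_fun setT (fun x => expR (m * Z x)).
Proof. by apply: measurableT_comp => //; exact: measurable_funM. Qed.

Let iexp (m : R) : P.-integrable setT (EFin \o (fun x => expR (m * Z x))).
Proof.
apply/integrableP; split; first exact/measurable_EFinP.
under eq_integral do rewrite /= ger0_norm ?expR_ge0//.
by rewrite mgf ltry.
Qed.

Let Eexp (m : R) : \int[P]_x (expR (m * Z x)) = expR (m ^+ 2 / 2).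
Proof. by rewrite /Rintegral mgf. Qed.

Let expnorm_le (m x : R) : 0 <= m -> expR (m * `|x|) <= expR (m * x) + expR (- m * x).
Proof.
move=> m0; have [x0|x0] := leP 0 x.
  by rewrite (ger0_norm x0) lerDl expR_ge0.
by rewrite (ltr0_norm x0) mulrN mulNr lerDr expR_ge0.
Qed.

Let g (m : R) x := expR (m * Z x) + expR (- m * Z x).

Let ig m : P.-integrable setT (EFin \o g m).
Proof. by apply: integrable_addR. Qed.

Let Eg m : \int[P]_x (g m x) = 2 * expR (m ^+ 2 / 2).
Proof. by rewrite RintegralD// !Eexp sqrrN; ring. Qed.

Let power_le (n : nat) (x : R) : `|x| ^+ n.+1 <= n.+1`!%:R * expR `|x|.
Proof.
have f0 : 0 < n.+1`!%:R :> R by rewrite ltr0n fact_gt0.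
have := expR_ge1Dxn n (normr_ge0 x).
rewrite -ler_pdivrMl// mulrC => h; rewrite (le_trans _ h)// lerDr; exact: ler01.
Qed.

Lemma normal_integrable_power n :
  P.-integrable setT (EFin \o (fun x => Z x ^+ n.+1)).
Proof.
apply: (integrable_le_norm _ (integrable_scaleR (n.+1`!%:R) (ig 1))).
  exact: measurable_funX.
move=> x; rewrite normrX (le_trans (power_le n _))//.
by rewrite ler_wpM2l ?ler0n// -[`|Z x|]mul1r expnorm_le.
Qed.

Let i1 : P.-integrable setT (EFin \o Z) := normal_integrable_power 0.

(** Integrating 1 + m Z <= e^(m Z) gives m E[Z] <= e^(m^2 / 2) - 1 = O(m^2) for small [m] of both
    signs, which forces E[Z] = 0. *)
Lemma normal_mean : \int[P]_x Z x = 0.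
Proof.
set e := \int[P]_x _.
have key (m : R) : m * e <= expR (m ^+ 2 / 2) - 1.
  rewrite lerBrDl -Eexp -(Rintegral_cstT P 1) /e -RintegralZl//.
  rewrite -RintegralD//; last first.
  - exact: integrable_scaleR.
  - exact: integrable_cstR.
  apply: le_Rintegral => //.
  - by apply: integrable_addR; [exact: integrable_cstR|exact: integrable_scaleR].
  - by move=> x _; exact: expR_ge1Dx.
have small (m : R) : `|m| <= 1 -> expR (m ^+ 2 / 2) - 1 <= m ^+ 2.
  move=> m1; have m2 : m ^+ 2 <= 1.
    by rewrite -real_normK ?num_real// exprn_ile1.
  have := expR_ge1Dx (- (m ^+ 2 / 2)); rewrite expRN => h.
  have m20 := sqr_ge0 m.
  have e0 := expR_gt0 (m ^+ 2 / 2).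
  have : (1 - m ^+ 2 / 2) * expR (m ^+ 2 / 2) <= 1.
    by rewrite -ler_pdivlMr// div1r.
  set E := expR _; nra.
apply/eqP; rewrite -normr_le0 leNgt; apply/negP => e0.
(* For this [m], the inequality m |e| <= m^2 would give |e| <= |e| / 2. *)
pose m : R := Num.min 1 (`|e| / 2).
have m0 : 0 < m by rewrite lt_min ltr01 divr_gt0.
have m1 : m <= 1 by rewrite ge_min lexx.
have me : m <= `|e| / 2 by rewrite ge_min lexx orbT.
have hm : m * `|e| <= m ^+ 2.
  have [e1|e1] := ltP 0 e.
    rewrite (gtr0_norm e1) (le_trans (key m))// small//.
    by rewrite gtr0_norm.
  rewrite (ler0_norm e1) mulrN -mulNr (le_trans (key (- m)))//.
  by rewrite sqrrN small// gtr0_norm.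
rewrite expr2 ler_pM2l// in hm; lra.
Qed.

Let e2 := \int[P]_x (Z x ^+ 2).

Let i2 : P.-integrable setT (EFin \o (fun x => Z x ^+ 2)) := normal_integrable_power 1.

Let sinh_ge (x : R) : 0 <= x -> 2 * x <= expR x - expR (- x).
Proof.
move=> x0.
have dh (y : R) : is_derive y 1 (expR - (fun t => expR (- t)) - (2 *: (@id R^o)))
   (expR y + expR (- y) - 2).
  have dN : is_derive y 1 (fun t : R => expR (- t)) (expR (- y) * -1).
    exact: (is_derive1_comp (is_derive_expR _) (is_deriveNid _ _)).
  apply: (is_derive_eq (is_deriveB (is_deriveB (is_derive_expR y) dN)
    (is_deriveZ 2 (is_derive_id y 1)))).
  by rewrite /GRing.scale/=; ring.
have [c _] := MVT_segment x0 (fun t _ => dh t)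
  (is_derive_continuous_within (fun t _ => dh t)).
rewrite !fctE /GRing.scale/= oppr0 mulr0 subrr !subr0 => h.
suff : 0 <= expR c + expR (- c) - 2 by nra.
have c0 := expR_gt0 c.
have : expR c * expR (- c) = 1 by rewrite expRxMexpNx_1.
have := expR_gt0 (- c); set u := expR c; set v := expR (- c) => v0 uv.
have : 0 <= (u - v) ^+ 2 by exact: sqr_ge0.
nra.
Qed.

Let expRsqr (x : R) : expR (x / 2) ^+ 2 = expR x.
Proof. by rewrite expr2 -expRD; congr expR; field. Qed.

(** The right side is the square of e^(x/2) - e^(-x/2), which [sinh_ge] bounds below by x when x >=
    0. *)
Let cosh_ge (x : R) : x ^+ 2 <= expR x + expR (- x) - 2.
Proof.
wlog x0 : x / 0 <= x.
  move=> H; have [/H//|/ltW x0] := leP 0 x.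
  by have := H (- x); rewrite oppr_ge0 sqrrN opprK addrC [expR (- x) + _]addrC addrC; apply.
have := @sinh_ge (x / 2); rewrite divr_ge0// => /(_ isT).
rewrite -(expRsqr x) -(expRsqr (- x)) mulNr.
have : expR (x / 2) * expR (- (x / 2)) = 1 by rewrite expRxMexpNx_1.
have := expR_gt0 (x / 2); have := expR_gt0 (- (x / 2)).
set u := expR (x / 2); set v := expR (- (x / 2)) => v0 u0 uv h.
have {}h : x <= u - v by lra.
have -> : u ^+ 2 + v ^+ 2 - 2 = (u - v) ^+ 2 by lra.
by rewrite lerXn2r// nnegrE// (le_trans x0).
Qed.

(** The same square, with e^(x/2) - e^(-x/2) <= x e^(x/2) for x >= 0; then e^x <= 1 + x e^x produces
    the cubic remainder. *)
Let cosh_le (x : R) : expR x + expR (- x) - 2 <= x ^+ 2 + `|x| ^+ 3 * expR `|x|.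
Proof.
wlog x0 : x / 0 <= x.
  move=> H; have [/H//|/ltW x0] := leP 0 x.
  by have := H (- x); rewrite oppr_ge0 sqrrN opprK normrN [expR (- x) + _]addrC; apply.
rewrite (ger0_norm x0).
have h1 : 0 <= expR (x / 2) - expR (- (x / 2)) <= x * expR (x / 2).
  apply/andP; split.
    by rewrite subr_ge0 ler_expR; lra.
  have := expR_ge1Dx (- x).
  have -> : expR (- x) = expR (- (x / 2)) * expR (- (x / 2)).
    by rewrite -expRD; congr expR; field.
  have : expR (x / 2) * expR (- (x / 2)) = 1 by rewrite expRxMexpNx_1.
  have := expR_gt0 (x / 2); have := expR_gt0 (- (x / 2)).
  set u := expR (x / 2); set v := expR (- (x / 2)) => v0 u0 uv h.
  have : (1 - x) * u <= v * v * u by rewrite ler_pM2r//; lra.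
  rewrite -mulrA [v * u]mulrC uv; nra.
have h2 : expR x - 1 <= x * expR x.
  have := expR_ge1Dx (- x); rewrite expRN => h.
  have e0 := expR_gt0 x.
  have : (1 - x) * expR x <= 1 by rewrite -ler_pdivlMr// div1r; lra.
  lra.
rewrite -(expRsqr (- x)) mulNr -{1}(expRsqr x).
have : expR (x / 2) * expR (- (x / 2)) = 1 by rewrite expRxMexpNx_1.
have := expRsqr x; move: h1.
set u := expR (x / 2); set v := expR (- (x / 2)) => /andP[h0 h1] ux uv.
have -> : u ^+ 2 + v ^+ 2 - 2 = (u - v) ^+ 2 by lra.
have : (u - v) ^+ 2 <= (x * u) ^+ 2.
  by rewrite lerXn2r// nnegrE// (le_trans h0).
move/le_trans; apply; rewrite exprMn ux.
have : x ^+ 2 * (expR x - 1) <= x ^+ 2 * (x * expR x) by rewrite ler_wpM2l// sqr_ge0.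
rewrite -/u; set E := expR x; rewrite [x ^+ 3]exprSr; nra.
Qed.

Let cosh_bounds (t : R) : 0 < t -> t <= 1 ->
  t ^+ 2 * e2 <= 2 * (expR (t ^+ 2 / 2) - 1) /\
  2 * (expR (t ^+ 2 / 2) - 1) <= t ^+ 2 * e2 + 12 * expR 2 * t ^+ 3.
Proof.
move=> t0 t1.
have E1 : \int[P]_x (g t x - 2) = 2 * (expR (t ^+ 2 / 2) - 1).
  rewrite RintegralB//; last exact: integrable_cstR.
  by rewrite Eg Rintegral_cstT; ring.
have ig2 : P.-integrable setT (EFin \o (fun x => g t x - 2)).
  by apply: integrable_subR => //; exact: integrable_cstR.
have i2t : P.-integrable setT (EFin \o (fun x => t ^+ 2 * Z x ^+ 2)).
  exact: integrable_scaleR.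
rewrite -E1 /e2 -RintegralZl//; split.
  apply: le_Rintegral => // x _.
  by rewrite -exprMn (le_trans (cosh_ge _))// /g mulNr.
(* For t <= 1, |t Z|^3 e^|t Z| <= 6 t^3 e^(2 |Z|) because |Z|^3 <= 3! e^|Z|, and the mean of [g 2]
   is 2 e^2. *)
have -> : 12 * expR 2 * t ^+ 3 = \int[P]_x (6 * t ^+ 3 * g 2 x).
  rewrite RintegralZl// Eg (_ : 2 ^+ 2 / 2 = 2 :> R); first by ring.
  by field.
rewrite -RintegralD//; last exact: integrable_scaleR.
apply: le_Rintegral => //.
  by apply: integrable_addR => //; exact: integrable_scaleR.
move=> x _; rewrite -exprMn /g mulNr (le_trans (cosh_le _))// lerD2l.
rewrite normrM (gtr0_norm t0) exprMn.
have t3 : 0 < t ^+ 3 by rewrite exprn_gt0.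
rewrite [6 * _]mulrC -[_ * expR (_ * `|_|)]mulrA -[_ * (_ + _)]mulrA ler_pM2l//.
have a1 : `|Z x| ^+ 3 <= 6 * expR `|Z x| := power_le 2 (Z x).
have a2 : expR (t * `|Z x|) <= expR `|Z x|.
  by rewrite ler_expR ler_piMl.
have a3 := @expnorm_le 2 (Z x) ltac:(lra).
have a4 : expR (2 * `|Z x|) = expR `|Z x| * expR `|Z x|.
  by rewrite -expRD; congr expR; ring.
rewrite a4 in a3; rewrite -[expR (2 * Z x) + _]/(g 2 x).
have e0 := expR_gt0 `|Z x|; have p0 : 0 <= `|Z x| ^+ 3 by rewrite exprn_ge0.
have := expR_gt0 (t * `|Z x|).
set a := expR `|Z x| in a1 a2 a3 e0 *; set b := expR _ in a2 * => b0.
have : `|Z x| ^+ 3 * b <= 6 * a * a.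
  by apply: ler_pM => //; [exact: ltW].
rewrite /g; lra.
Qed.

(** Both bounds of [cosh_bounds] are divided by t^2; the quotient 2 (e^(t^2 / 2) - 1) / t^2 tends to
    1 as t tends to 0. *)
Lemma normal_second_moment : \int[P]_x (Z x ^+ 2) = 1.
Proof.
rewrite -/e2; apply/eqP; rewrite eq_le; apply/andP; split.
- apply/ler_addgt0Pr => e e0.
  pose t : R := Num.min 1 e.
  have t0 : 0 < t by rewrite lt_min ltr01.
  have t1 : t <= 1 by rewrite ge_min lexx.
  have te : t <= e by rewrite ge_min lexx orbT.
  have [h _] := cosh_bounds t0 t1.
  have t2 : 0 < t ^+ 2 by rewrite exprn_gt0.
  have t21 : t ^+ 2 <= t by rewrite expr2 ler_piMl// ltW.
  have := expR_ge1Dx (- (t ^+ 2 / 2)); rewrite expRN => h'.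
  have e0' := expR_gt0 (t ^+ 2 / 2).
  have h2 : (1 - t ^+ 2 / 2) * expR (t ^+ 2 / 2) <= 1.
    by rewrite -ler_pdivlMr// div1r.
  have h3 : expR (t ^+ 2 / 2) - 1 <= t ^+ 2 / 2 * (1 + t ^+ 2).
    move: h2; set E := expR _; nra.
  have h4 : t ^+ 2 * e2 <= t ^+ 2 * (1 + t ^+ 2) by lra.
  rewrite ler_pM2l// in h4; lra.
- apply/ler_addgt0Pr => e e0.
  pose c : R := 12 * expR 2.
  have c0 : 0 < c by rewrite mulr_gt0// expR_gt0.
  pose t : R := Num.min 1 (e / c).
  have t0 : 0 < t by rewrite lt_min ltr01 divr_gt0.
  have t1 : t <= 1 by rewrite ge_min lexx.
  have te : t <= e / c by rewrite ge_min lexx orbT.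
  have [_ h] := cosh_bounds t0 t1.
  have t2 : 0 < t ^+ 2 by rewrite exprn_gt0.
  have := expR_ge1Dx (t ^+ 2 / 2) => h'.
  have h4 : t ^+ 2 * 1 <= t ^+ 2 * (e2 + c * t).
    rewrite -/c in h; rewrite [t ^+ 3]exprSr in h; lra.
  rewrite ler_pM2l// in h4; rewrite (le_trans h4)// lerD2l.
  by rewrite mulrC -ler_pdivlMr.
Qed.

(** The exact value is 3, but the overshoot bound only asks for a constant. Here 24 is 4! and the
    rest is the mean of e^Z + e^-Z, with e^(1/2) enlarged to e. *)
Lemma normal_fourth_moment : \int[P]_x (Z x ^+ 4) <= 48 * expR 1.
Proof.
have -> : 48 * expR 1 = 24 * (2 * expR 1) :> R by ring.
rewrite (@le_trans _ _ (24 * \int[P]_x (g 1 x)))//; last first.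
  rewrite Eg expr1n ler_pM2l// ler_pM2l// ler_expR; lra.
rewrite -RintegralZl//; apply: le_Rintegral => //.
- exact: normal_integrable_power.
- exact: integrable_scaleR.
move=> x _; rewrite -[Z x ^+ 4]ger0_norm ?exprn_even_ge0// normrX.
have h : `|Z x| ^+ 4 <= 24 * expR `|Z x| := power_le 3 (Z x).
rewrite (le_trans h)//.
by rewrite ler_pM2l// -[`|Z x|]mul1r expnorm_le.
Qed.

End standard_normal_moments.

(** * Density, exponential moments and small intervals of the normal law *)

Section normal_law.
Context (R : realType).
Local Notation mu := (@lebesgue_measure R).

(** Uniqueness of densities: the Radon-Nikodym derivative of the normal law and [normal_pdf] have
    equal integrals over every measurable set, hence agree almost everywhere. *)
Lemma ge0_integral_normal_prob (m s : R) (f : R -> \bar R) :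
  measurable_fun setT f -> (forall x, 0 <= f x)%E ->
  (\int[normal_prob m s]_x f x = \int[mu]_x (f x * (normal_pdf m s x)%:E))%E.
Proof.
move=> mf f0; have dom := normal_prob_dominates m s.
rewrite -(@Radon_Nikodym_SigmaFinite.change_of_variables _ _ _ _ _ dom)//.
have mpdf : measurable_fun setT (EFin \o normal_pdf m s).
  by apply/measurable_EFinP; exact: measurable_normal_pdf.
have iRN := Radon_Nikodym_SigmaFinite.f_integrable dom.
have mRN : measurable_fun setT (Radon_Nikodym_SigmaFinite.f (normal_prob m s) mu).
  by case/integrableP : iRN.
apply: ge0_ae_eq_integral => //.
- exact: emeasurable_funM.
- exact: emeasurable_funM.
- by move=> x _; rewrite mule_ge0// Radon_Nikodym_SigmaFinite.f_ge0.
- by move=> x _; rewrite mule_ge0// lee_fin normal_pdf_ge0.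
apply: ae_eqe_mul2l.
apply: integral_ae_eq => // E _ mE.
by rewrite -Radon_Nikodym_SigmaFinite.f_integral.
Qed.

(** Completing the square: the tilt e^(m x) moves the centre of the density to m s^2 and leaves the
    constant e^((m s)^2 / 2). *)
Lemma normal_mgf (s m : R) : 0 < s ->
  (\int[normal_prob 0 s]_x (expR (m * x))%:E = (expR ((m * s) ^+ 2 / 2))%:E)%E.
Proof.
move=> s0; have s0' : s != 0 by rewrite gt_eqF.
have mexp : measurable_fun setT (fun x : R => expR (m * x)).
  by apply: measurableT_comp => //; exact: measurable_funM.
rewrite ge0_integral_normal_prob; last 2 first.
- exact/measurable_EFinP.
- by move=> x; rewrite lee_fin expR_ge0.
transitivity (\int[mu]_x ((expR ((m * s) ^+ 2 / 2))%:E *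
    (normal_pdf (m * s ^+ 2) s x)%:E))%E.
  apply: eq_integral => x _; rewrite -!EFinM; congr EFin.
  rewrite !normal_pdfE// /normal_fun mulrCA [RHS]mulrCA -!expRD; congr (_ * expR _).
  by rewrite -mulr_natr; field.
rewrite ge0_integralZl//.
- by rewrite integral_normal_pdf mule1.
- by apply/measurable_EFinP; exact: measurable_normal_pdf.
- by move=> x _; rewrite lee_fin normal_pdf_ge0.
Qed.

Lemma normal_prob_small_ball (s a : R) : 0 < s -> 0 <= a ->
  (normal_prob 0 s `[(- a)%R, a]%classic <= (a / s)%:E)%E.
Proof.
move=> s0 a0; have s0' : s != 0 by rewrite gt_eqF.
rewrite /normal_prob.
apply: (@le_trans _ _ (\int[mu]_(x in `[(- a)%R, a]) (normal_peak s)%:E)%E).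
  apply: ge0_le_integral => //.
  - by move=> x _; rewrite lee_fin normal_pdf_ge0.
  - by apply: measurable_funTS; apply: measurableT_comp => //; exact: measurable_normal_pdf.
  - by move=> x _; rewrite lee_fin normal_pdf_ub.
rewrite integral_cst// [X in (_ * X)%E]lebesgue_measure_itv/= lte_fin.
case: ifPn => [aa|_]; last by rewrite mule0 lee_fin divr_ge0// ltW.
rewrite -EFinB -EFinM lee_fin opprK /normal_peak.
(* As pi >= 2, the peak of the density is at most 1 / (2 s), against an interval of length 2 a. *)
have h : 2 * s <= Num.sqrt (s ^+ 2 * pi *+ 2).
  rewrite -[leLHS](ger0_norm (_ : 0 <= 2 * s)); last by rewrite mulr_ge0// ltW.
  rewrite -sqrtr_sqr ler_wsqrtr// exprMn -mulr_natr.
  have := sqr_ge0 s; have := @pi_ge2 R; nra.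
have s2 : 0 < 2 * s by rewrite mulr_gt0.
rewrite ler_pdivlMr// -mulrA ler_pdivrMl ?(lt_le_trans s2)//.
have -> : (a + a) * s = 2 * s * a by ring.
by rewrite ler_wpM2r.
Qed.

End normal_law.

(** * Expectation of a product of independent variables *)

Section independence.
Context d (Omega : measurableType d) (R : realType) (P : probability Omega R).

(** The product rule on rectangles makes the law of (X, Y) the product of its marginals; Fubini then
    separates the integral. *)
Lemma expectation_indep_mul (X Y : {mfun Omega >-> R}) :
  (forall A B : set R, measurable A -> measurable B ->
    P (X @^-1` A `&` Y @^-1` B) = P (X @^-1` A) * P (Y @^-1` B))%E ->
  P.-integrable setT (EFin \o Y) ->
  P.-integrable setT (EFin \o X) ->
  P.-integrable setT (EFin \o (fun w => X w * Y w)) ->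
  \int[P]_w (X w * Y w) = \int[P]_w X w * \int[P]_w Y w.
Proof.
move=> XY iY iX iXY.
pose Z w := (X w, Y w).
have mZ : measurable_fun setT Z by apply: measurable_fun_pair.
pose Zm : {mfun Omega >-> (R * R)%type} := HB.pack Z (isMeasurableFun.Build _ _ _ _ Z mZ).
pose f (z : R * R) := (z.1 * z.2)%:E.
have mf : measurable_fun setT f.
  by apply/measurable_EFinP; exact: measurable_funM.
have e1 : (\int[P]_w (X w * Y w)%:E = \int[pushforward P Zm]_z f z)%E.
  by rewrite integral_pushforward.
have prodE A : measurable A ->
    (distribution P X \x distribution P Y)%E A = pushforward P Zm A.
  apply: product_measure_unique => A' B' mA' mB'.
  rewrite /pushforward /= -XY//; congr (P _).
have if' : (distribution P X \x distribution P Y)%E.-integrable setT f.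
  have /integrableP[_ lty] : (pushforward P Zm).-integrable setT f.
    exact: integrable_pushforward.
  apply/integrableP; split => //.
  by rewrite (@eq_measure_integral _ _ _ _ (pushforward P Zm))// => A mA _; exact: prodE.
have e2 : (\int[pushforward P Zm]_z f z =
    \int[distribution P X]_x \int[distribution P Y]_y f (x, y))%E.
  rewrite -[RHS]/(\int[_]_x (fubini_F _ f x))%E integral12_prod_meas1//.
  by apply: eq_measure_integral => A mA _; apply/esym; exact: prodE.
set r := \int[P]_w Y w.
have eY (x : R) : (\int[distribution P Y]_y f (x, y) = (x * r)%:E)%E.
  have ixY : P.-integrable setT (EFin \o (fun w => x * Y w)).
    exact: integrable_scaleR.
  rewrite integral_pushforward//; last first.
    by rewrite /f/=; apply/measurable_EFinP; exact: measurable_funM.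
  rewrite /r -RintegralZl// fineK//; exact: integrable_fin_num.
rewrite {1}/Rintegral e1 e2 -RintegralZr//; congr fine.
transitivity (\int[distribution P X]_x (x * r)%:E)%E.
  by apply: eq_integral => x _; exact: eY.
rewrite integral_pushforward//.
  by apply/measurable_EFinP; exact: measurable_funM.
rewrite (_ : _ \o _ = EFin \o (fun w => r * X w)); first exact: integrable_scaleR.
by apply/funext => w /=; rewrite mulrC.
Qed.
End independence.

(** * Exit of a Gaussian walk from an interval *)

Section gaussian_walk.
Context d (Omega : measurableType d) (R : realType) (P : probability Omega R).
Variables (w : nat -> {mfun Omega >-> R}) (dl : R).

Definition increment i x : R := w i.+1 x - w i x.

Hypothesis dl0 : 0 < dl.
Hypothesis w0 : forall x, w 0 x = 0.
Hypothesis increments_indep : forall n (B : 'I_n -> set R),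
  (forall i, measurable (B i)) ->
  P (\bigcap_(i in [set: 'I_n]) increment i @^-1` B i) =
  (\prod_(i < n) P (increment i @^-1` B i))%E.
Hypothesis increment_law : forall i (B : set R), measurable B ->
  P (increment i @^-1` B) = normal_prob 0 (Num.sqrt dl) B.

Let measurable_increment i : measurable_fun setT (increment i).
Proof. exact: measurable_funB. Qed.

(** A pi-system, so that a finite measure on the sigma-algebra it generates is determined by these
    sets. That sigma-algebra serves as the filtration at index [n]. *)
Definition past_cylinder n : set (set Omega) :=
  [set A | exists2 B : 'I_n -> set R, forall i, measurable (B i) &
    A = \bigcap_(i in [set: 'I_n]) increment i @^-1` B i].

Let past n := <<s past_cylinder n >>.

Let measurable_past_cylinder n : past_cylinder n `<=` measurable.
Proof.
move=> _ [B mB ->]; apply: fin_bigcap_measurable => // i _.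
by rewrite -[_ @^-1` _]setTI; exact: measurable_increment.
Qed.

Let measurable_past n : past n `<=` measurable.
Proof.
apply: smallest_sub; last exact: measurable_past_cylinder.
exact: sigma_algebra_measurable.
Qed.

(** With C the event on the increment, A -> P(A and C) and A -> P(C) P(A) are finite measures that
    agree on cylinders, hence on the sigma-algebra they generate. *)
Lemma past_indep n A (B : set R) : past n A -> measurable B ->
  P (A `&` increment n @^-1` B) = (P A * P (increment n @^-1` B))%E.
Proof.
move=> pA mB.
have mC : measurable (increment n @^-1` B).
  by rewrite -[_ @^-1` _]setTI; exact: measurable_increment.
have fC : P (increment n @^-1` B) \is a fin_num by exact: fin_num_measure.
pose r : {nonneg R} := NngNum (fine_ge0 (measure_ge0 P (increment n @^-1` B))).
have := @g_sigma_algebra_measure_unique _ R Omega (past_cylinder n)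
  (@measurable_past_cylinder n) (fun=> setT) _ _
  (mrestr P mC) (mscale r P) _ _ _ A pA.
rewrite /mrestr /= /mscale /= fineK// muleC; apply.
- move=> _; exists (fun=> setT) => //.
  by apply/seteqP; split.
- by rewrite bigcup_const//; exists 0%N.
- move=> _ _ [B1 mB1 ->] [B2 mB2 ->]; exists (fun i => B1 i `&` B2 i).
    by move=> i; exact: measurableI.
  apply/seteqP; split=> [x [h1 h2] i _|x h]; first by split; [exact: h1|exact: h2].
  by split=> i _; have [] := h i I.
- move=> _ [B' mB' ->].
  (* A cylinder of length n followed by [B] is a cylinder of length n + 1, to which the product rule
     applies. *)
  pose B2 (i : 'I_n.+1) := if unlift ord_max i is Some j then B' j else B.
  have B2r (i : 'I_n) : B2 (widen_ord (leqnSn n) i) = B' i.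
    rewrite /B2 (_ : widen_ord _ i = lift ord_max i) ?liftK//.
    by apply: val_inj; rewrite /= /bump leqNgt ltn_ord.
  have B2max : B2 ord_max = B by rewrite /B2 unlift_none.
  have mB2 i : measurable (B2 i) by rewrite /B2; case: unlift.
  have := increments_indep mB2; rewrite big_ord_recr/= B2max.
  under eq_bigr do rewrite B2r.
  rewrite -(increments_indep mB') /mrestr /mscale /= => indepE.
  rewrite muleC -indepE; congr (P _).
  apply/seteqP; split=> [x [h1 h2] i _|x h].
  + have [j ->|->] := unliftP ord_max i; last by rewrite B2max.
    have -> : lift ord_max j = widen_ord (leqnSn n) j.
      by apply: val_inj; rewrite /= /bump leqNgt ltn_ord.
    by rewrite B2r; exact: h1.
  + split; last by have := h ord_max I; rewrite B2max.
    by move=> i _; have := h (widen_ord (leqnSn n) i) I; rewrite B2r.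
- by move=> _; rewrite /mrestr setTI ltey_eq fC.
Qed.

(** The same space with a coarser structure: measurability on this type is adaptedness at index
    [n]. *)
Let pastT n := g_sigma_algebraType (past_cylinder n).

Let past_measurable_increment n i : (i < n)%N ->
  measurable_fun (setT : set (pastT n)) (increment i).
Proof.
move=> ilt _ B mB; rewrite setTI; apply: sub_sigma_algebra.
exists (fun j : 'I_n => if j == Ordinal ilt then B else setT).
  by move=> j; case: ifP.
apply/seteqP; split=> [x xB j _|x h] /=; first by case: eqP => [->|].
by have := h (Ordinal ilt) I; rewrite eqxx.
Qed.

Let past_measurable_w n j : (j <= n)%N -> measurable_fun (setT : set (pastT n)) (w j).
Proof.
elim: j => [|j IH] jn.
  rewrite (_ : (w 0 : Omega -> R) = cst 0); first exact: measurable_cst.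
  by apply/funext => x; rewrite w0.
rewrite (_ : (w j.+1 : Omega -> R) = (w j : pastT n -> R) \+ (increment j : pastT n -> R)).
  by apply: measurable_funD; [exact: IH (ltnW jn)|exact: past_measurable_increment].
by apply/funext => x; rewrite /increment/= subrKC.
Qed.

Let past_measurable_fun n (f : Omega -> R) :
  measurable_fun (setT : set (pastT n)) f -> measurable_fun setT f.
Proof.
move=> mf _ B mB; apply: (@measurable_past n); exact: mf.
Qed.

Lemma past_expectation_mul n (X : Omega -> R) (f : R -> R) (M : R) :
  measurable_fun (setT : set (pastT n)) X -> (forall x, `|X x| <= M) ->
  measurable_fun setT f ->
  P.-integrable setT (EFin \o (f \o increment n)) ->
  \int[P]_x (X x * f (increment n x)) = \int[P]_x X x * \int[P]_x f (increment n x).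
Proof.
move=> mX XM mf fi.
have mX' := past_measurable_fun mX.
have mY : measurable_fun setT (f \o increment n) by exact: measurableT_comp.
pose Xm : {mfun Omega >-> R} := HB.pack X (isMeasurableFun.Build _ _ _ _ X mX').
pose Ym : {mfun Omega >-> R} := HB.pack (f \o increment n)
  (isMeasurableFun.Build _ _ _ _ _ mY).
have iX : P.-integrable setT (EFin \o X).
  by apply: (integrable_le_norm _ (integrable_cstR P M)).
apply: (@expectation_indep_mul _ Omega R P Xm Ym) => //.
- move=> A B mA mB; rewrite /= comp_preimage past_indep//.
  + by have := mX measurableT A mA; rewrite setTI.
  + by rewrite -[_ @^-1` _]setTI; exact: mf.
- apply: (integrable_le_norm _ (integrable_scaleR M (integrable_norm fi))).
    exact: measurable_funM.
  by move=> x /=; rewrite normrM ler_wpM2r.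
Qed.

Let sdl0 : 0 < Num.sqrt dl. Proof. by rewrite sqrtr_gt0. Qed.

Let Z i x := (Num.sqrt dl)^-1 * increment i x.

Let measurable_Z i : measurable_fun setT (Z i).
Proof. exact: measurable_funM. Qed.

Let incrE i : increment i = (fun x => Num.sqrt dl * Z i x).
Proof. by apply/funext => x; rewrite /Z mulrA divff ?mul1r// gt_eqF. Qed.

Let Z_mgf i (m : R) : (\int[P]_x (expR (m * Z i x))%:E)%E = (expR (m ^+ 2 / 2))%:E.
Proof.
have mi : @measurable_fun _ _ Omega (measurableTypeR R) setT (increment i).
  exact: measurable_increment.
pose im : {mfun Omega >-> measurableTypeR R} := HB.pack (increment i)
  (isMeasurableFun.Build _ _ _ (measurableTypeR R) _ mi).
pose f (y : measurableTypeR R) := (expR ((m / Num.sqrt dl) * y))%:E.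
have mf : measurable_fun setT f.
  by apply/measurable_EFinP; apply: measurableT_comp => //; exact: measurable_funM.
transitivity (\int[distribution P im]_y f y)%E.
  rewrite ge0_integral_pushforward//.
    by apply: eq_integral => x _; rewrite /f /Z/= mulrA.
  by move=> y _; rewrite lee_fin expR_ge0.
transitivity (\int[normal_prob 0 (Num.sqrt dl)]_y f y)%E.
  by apply: eq_measure_integral => A mA _; exact: increment_law.
by rewrite normal_mgf// divfK// gt_eqF.
Qed.

Let increment_integrable_power i n :
  P.-integrable setT (EFin \o ((fun y => y ^+ n.+1) \o increment i)).
Proof.
have := integrable_scaleR (Num.sqrt dl ^+ n.+1)
  (normal_integrable_power (measurable_Z i) (Z_mgf i) n).
apply: eq_integrable => // x _.
by rewrite incrE/= [in RHS]exprMn.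
Qed.

Let increment_mean i : \int[P]_x increment i x = 0.
Proof.
rewrite incrE RintegralZl//; last exact: (normal_integrable_power (measurable_Z i) (Z_mgf i) 0).
by rewrite (normal_mean (measurable_Z i) (Z_mgf i)) mulr0.
Qed.

Let increment_second_moment i : \int[P]_x (increment i x ^+ 2) = dl.
Proof.
rewrite incrE; under eq_Rintegral do rewrite exprMn.
rewrite RintegralZl//; last exact: (normal_integrable_power (measurable_Z i) (Z_mgf i) 1).
by rewrite (normal_second_moment (measurable_Z i) (Z_mgf i)) mulr1 sqr_sqrtr// ltW.
Qed.

Let increment_fourth_moment i : \int[P]_x (increment i x ^+ 4) <= 48 * expR 1 * dl ^+ 2.
Proof.
rewrite incrE; under eq_Rintegral do rewrite exprMn.
rewrite RintegralZl//; last exact: (normal_integrable_power (measurable_Z i) (Z_mgf i) 3).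
have -> : Num.sqrt dl ^+ 4 = dl ^+ 2 by rewrite (exprM _ 2 2) sqr_sqrtr// ltW.
rewrite [leLHS]mulrC ler_wpM2r ?sqr_ge0//.
exact: (normal_fourth_moment (measurable_Z i) (Z_mgf i)).
Qed.

Variable e : R.
Hypothesis e0 : 0 < e.

Definition confined n : set Omega := [set x | forall j, (j <= n)%N -> `|w j x| <= e].

Lemma confinedE n : confined n = \bigcap_(j in `I_n.+1) (w j @^-1` `[- e, e]).
Proof.
apply/seteqP; split=> x h j /=.
  by rewrite in_itv/= -ler_norml => jn; exact: h.
by move=> jn; have := h j jn; rewrite /= in_itv/= -ler_norml.
Qed.

Lemma confined0 : confined 0 = setT.
Proof.
apply/seteqP; split=> // x _ j; rewrite leqn0 => /eqP ->.
by rewrite w0 normr0 ltW.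
Qed.

Lemma confinedS n : confined n.+1 = confined n `&` [set x | `|w n.+1 x| <= e].
Proof.
apply/seteqP; split=> [x h|x [h1 h2] j].
  by split=> [j jn|]; apply: h => //; exact: leqW.
by rewrite leq_eqVlt => /predU1P[->//|]; exact: h1.
Qed.

Let past_confined n : past n (confined n).
Proof.
suff : measurable (confined n : set (pastT n)) by [].
rewrite confinedE; apply: (@fin_bigcap_measurable _ (pastT n)); first exact: finite_II.
move=> j jn; rewrite -[_ @^-1` _]setTI.
exact: (past_measurable_w (jn : (j <= n)%N) measurableT (measurable_itv `[- e, e])).
Qed.

Lemma measurable_confined n : measurable (confined n).
Proof.
rewrite confinedE; apply: bigcap_measurable; first by exists 0%N.
move=> j _; rewrite -[_ @^-1` _]setTI.
by apply: measurable_funPT.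
Qed.

Let a n := fine (P (confined n)).

Lemma confined_prob_ge0 n : 0 <= a n. Proof. exact: fine_ge0. Qed.

Let aE n : \int[P]_x (\1_(confined n) x) = a n.
Proof.
by rewrite /Rintegral integral_indic//= ?setIT//; exact: measurable_confined.
Qed.

Lemma confined_prob0 : a 0 = 1.
Proof. by rewrite /a confined0 [X in fine X]probability_setT. Qed.

(** [x_] collects the squared position of the paths still confined at index n, and [y_] below that
    of the paths leaving at index n + 1. *)
Let x_ n := \int[P]_x (\1_(confined n) x * w n x ^+ 2).

Let measurable_ind n : measurable_fun setT (\1_(confined n) : Omega -> R).
Proof. exact/measurable_indic/measurable_confined. Qed.

Let ind_in n x : confined n x -> \1_(confined n) x = 1 :> R.
Proof. by move=> h; rewrite indicE mem_set. Qed.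

Let ind_out n x : ~ confined n x -> \1_(confined n) x = 0 :> R.
Proof. by move=> h; rewrite indicE memNset. Qed.

Let integrable_ind n : P.-integrable setT (EFin \o (\1_(confined n) : Omega -> R)).
Proof. exact: integrable_indic (measurable_confined n). Qed.

Let integrable_x n : P.-integrable setT (EFin \o (fun x => \1_(confined n) x * w n x ^+ 2)).
Proof.
apply: (integrable_le_norm _ (integrable_cstR P (e ^+ 2))).
  by apply: measurable_funM; [exact: measurable_ind|exact: measurable_funX].
move=> x; have [h|h] := pselect (confined n x); last first.
  by rewrite ind_out// mul0r normr0 sqr_ge0.
rewrite ind_in// mul1r normrX lerXn2r ?nnegrE ?(ltW e0)//; exact: h.
Qed.

Let integrable_indX n (k : nat) :
  P.-integrable setT (EFin \o (fun x => \1_(confined n) x * increment n x ^+ k.+1)).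
Proof.
apply: (integrable_le_norm _ (integrable_norm (increment_integrable_power n k))).
  by apply: measurable_funM; [exact: measurable_ind|exact: measurable_funX].
move=> x; have [h|h] := pselect (confined n x); last first.
  by rewrite ind_out// mul0r normr0 /=.
by rewrite ind_in// mul1r.
Qed.

Let past_measurable_ind n : measurable_fun (setT : set (pastT n)) (\1_(confined n) : Omega -> R).
Proof. by apply: measurable_indic; exact: past_confined. Qed.

Let ind_moment n (k : nat) : \int[P]_x (\1_(confined n) x * increment n x ^+ k.+1) =
  a n * \int[P]_x (increment n x ^+ k.+1).
Proof.
rewrite (@past_expectation_mul n (\1_(confined n)) (fun y => y ^+ k.+1) 1) ?aE//.
by move=> x; rewrite ger0_norm// indicE lern1 leq_b1.
Qed.

Let integrable_cross n :
  P.-integrable setT (EFin \o (fun x => \1_(confined n) x * w n x * increment n x)).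
Proof.
apply: (integrable_le_norm _ (integrable_scaleR e (integrable_norm (increment_integrable_power n 0)))).
  by apply: measurable_funM => //; exact: measurable_funM.
move=> x; have [h|h] := pselect (confined n x); last first.
  by rewrite ind_out// !mul0r normr0 mulr_ge0 ?(ltW e0) /=.
by rewrite ind_in// mul1r normrM ler_wpM2r//; exact: h.
Qed.

(* The martingale property of w_n^2 - n dl stopped at the exit. *)
Lemma confined_square_step n :
  \int[P]_x (\1_(confined n) x * w n.+1 x ^+ 2) = x_ n + dl * a n.
Proof.
have E x : \1_(confined n) x * w n.+1 x ^+ 2 =
    (\1_(confined n) x * w n x ^+ 2 + 2 * (\1_(confined n) x * w n x * increment n x))
    + \1_(confined n) x * increment n x ^+ 2.
  by rewrite /increment; ring.
under eq_Rintegral do rewrite E.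
have i2 : P.-integrable setT (EFin \o (fun x => 2 * (\1_(confined n) x * w n x * increment n x))).
  exact: integrable_scaleR.
have i12 := integrable_addR (integrable_x n) i2.
have i3 := integrable_indX n 1.
rewrite (RintegralD measurableT i12 i3) (RintegralD measurableT (integrable_x n) i2).
rewrite RintegralZl//.
rewrite (@past_expectation_mul n (fun x => \1_(confined n) x * w n x) id e)//; last 3 first.
- by apply: measurable_funM => //; exact: past_measurable_w.
- move=> x; have [h|h] := pselect (confined n x); last first.
    by rewrite ind_out// mul0r normr0 ltW.
  by rewrite ind_in// mul1r; exact: h.
- exact: (increment_integrable_power n 0).
by rewrite increment_mean mulr0 mulr0 addr0 (ind_moment n 1) increment_second_moment mulrC.
Qed.

Let y_ n := \int[P]_x ((\1_(confined n) x - \1_(confined n.+1) x) * w n.+1 x ^+ 2).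

Let integrable_step n :
  P.-integrable setT (EFin \o (fun x => \1_(confined n) x * w n.+1 x ^+ 2)).
Proof.
have := integrable_addR (integrable_addR (integrable_x n)
  (integrable_scaleR 2 (integrable_cross n))) (integrable_indX n 1).
by apply: eq_integrable => // x _ /=; congr EFin; rewrite /increment; ring.
Qed.

Let y_E n : y_ n = x_ n + dl * a n - x_ n.+1.
Proof.
rewrite -confined_square_step /x_ -RintegralB//.
by apply: eq_Rintegral => x _; rewrite mulrBl.
Qed.

(** Let sigma be the first index at which |w| exceeds [e]. Then [a i] is P(sigma > i), and this is
    the mean of dl min(sigma, n). *)
Let S n := dl * \sum_(i < n) a i.

(** Optional stopping: the mean elapsed time equals the mean squared position at min(sigma, n),
    split according to the exit index. *)
Let S_E n : S n = x_ n + \sum_(i < n) y_ i.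
Proof.
elim: n => [|n IH].
  rewrite /S !big_ord0 mulr0 addr0 /x_.
  under eq_Rintegral do rewrite w0 expr0n mulr0.
  by rewrite Rintegral_cstT.
rewrite /S !big_ord_recr/= mulrDr -/(S n) IH y_E; ring.
Qed.

Let integrable_y n : P.-integrable setT
  (EFin \o (fun x => (\1_(confined n) x - \1_(confined n.+1) x) * w n.+1 x ^+ 2)).
Proof.
have := integrable_subR (integrable_step n) (integrable_x n.+1).
by apply: eq_integrable => // x _ /=; congr EFin; rewrite mulrBl.
Qed.

Let diffE n : \int[P]_x (\1_(confined n) x - \1_(confined n.+1) x) = a n - a n.+1.
Proof. by rewrite RintegralB// !aE. Qed.

Let integrable_diff n : P.-integrable setT
  (EFin \o (fun x => \1_(confined n) x - \1_(confined n.+1) x)).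
Proof. exact: integrable_subR. Qed.

Let diff_case n x :
  (\1_(confined n) x - \1_(confined n.+1) x = 0 :> R) \/
  [/\ \1_(confined n) x - \1_(confined n.+1) x = 1 :> R,
      \1_(confined n) x = 1 :> R, `|w n x| <= e & e < `|w n.+1 x| ].
Proof.
have [h1|h1] := pselect (confined n x); last first.
  left; rewrite !ind_out ?subrr//; rewrite confinedS => -[//].
have [h2|h2] := pselect (confined n.+1 x).
  by left; rewrite !ind_in ?subrr.
right; rewrite (ind_in h1) (ind_out h2) subr0; split => //; first exact: h1.
by rewrite ltNge; apply/negP => h; apply: h2; rewrite confinedS.
Qed.

Let sum_diff n : \sum_(i < n) (a i - a i.+1) = 1 - a n.
Proof.
elim: n => [|n IH]; first by rewrite big_ord0 confined_prob0 subrr.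
by rewrite big_ord_recr/= IH; ring.
Qed.

Let x_ge0 n : 0 <= x_ n.
Proof. by apply: Rintegral_ge0 => x _; rewrite mulr_ge0 ?sqr_ge0. Qed.

(** At the exit |w| exceeds [e], so the paths out by index n already contribute e^2 times their
    probability. *)
Lemma confined_sum_ge n : e ^+ 2 * (1 - a n) <= S n.
Proof.
rewrite S_E -sum_diff mulr_sumr -[leLHS]add0r lerD//; apply: ler_sum => i _.
rewrite -diffE -RintegralZl//; apply: le_Rintegral => //.
  exact: integrable_scaleR.
move=> x _; have [->|[-> _ _ ew]] := diff_case i x; first by rewrite mul0r mulr0.
rewrite mulr1 mul1r -(real_normK (num_real (w i.+1 x))).
by rewrite lerXn2r ?nnegrE// ltW.
Qed.

(* An overshoot beyond e + h forces a step larger than h, which the fourth moment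
   makes O(dl^2) per step. *)
Lemma confined_sum_le n (h : R) : 0 < h ->
  S n <= (e + h) ^+ 2 + (2 * e / h ^+ 3 + 1 / h ^+ 2) * (48 * expR 1) * dl * S n.
Proof.
(* With D the size of the last step, D <= h + D^4 / h^3 and D^2 <= h^2 + D^4 / h^2 turn (e + D)^2
   into at most (e + h)^2 + K D^4. *)
move=> h0; pose K := 2 * e / h ^+ 3 + 1 / h ^+ 2.
have K0 : 0 <= K by rewrite addr_ge0// divr_ge0 ?exprn_ge0 ?mulr_ge0// ltW.
have xle : x_ n <= (e + h) ^+ 2 * a n.
  rewrite -aE -RintegralZl//; apply: le_Rintegral => //.
    exact: integrable_scaleR.
  move=> x _; rewrite mulrC; have [hx|hx] := pselect (confined n x); last first.
    by rewrite ind_out// !mulr0.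
  rewrite ind_in// !mulr1 -(real_normK (num_real (w n x))).
  have hw : `|w n x| <= e by exact: hx.
  rewrite lerXn2r ?nnegrE//; first by rewrite addr_ge0// ltW.
  by rewrite (le_trans hw)// lerDl ltW.
have yle i : y_ i <= (e + h) ^+ 2 * (a i - a i.+1) + K * (48 * expR 1) * dl ^+ 2 * a i.
  apply: (@le_trans _ _ (\int[P]_x ((e + h) ^+ 2 * (\1_(confined i) x - \1_(confined i.+1) x)
      + K * (\1_(confined i) x * increment i x ^+ 4)))).
    apply: le_Rintegral => //.
      by apply: integrable_addR; apply: integrable_scaleR => //; exact: integrable_indX.
    move=> x _; have [->|[-> -> we ew]] := diff_case i x.
      by rewrite mul0r mulr0 add0r mulr_ge0// mulr_ge0// exprn_even_ge0.
    rewrite mulr1 !mul1r -(real_normK (num_real (w i.+1 x))).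
    have tri : `|w i.+1 x| <= e + `|increment i x|.
      have -> : w i.+1 x = w i x + increment i x by rewrite /increment subrKC.
      by rewrite (le_trans (ler_normD _ _))// lerD2r.
    rewrite -[increment i x ^+ 4]ger0_norm ?exprn_even_ge0// normrX.
    move: tri; set D := `|increment i x| => tri.
    have D0 : 0 <= D by rewrite /D.
    have D1 : D <= h + D ^+ 4 / h ^+ 3.
      have [Dh|Dh] := leP D h.
        by rewrite (le_trans Dh)// lerDl divr_ge0// exprn_ge0// ltW.
      rewrite -[leLHS]add0r lerD ?(ltW h0)// ler_pdivlMr ?exprn_gt0//.
      by rewrite [D ^+ 4]exprS ler_wpM2l// lerXn2r ?nnegrE ?(ltW h0) ?(ltW Dh).
    have D2 : D ^+ 2 <= h ^+ 2 + D ^+ 4 / h ^+ 2.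
      have [Dh|Dh] := leP D h.
        rewrite (@le_trans _ _ (h ^+ 2))//.
          by rewrite lerXn2r ?nnegrE ?(ltW h0).
        by rewrite lerDl divr_ge0 ?exprn_ge0// ltW.
      rewrite -[leLHS]add0r lerD ?sqr_ge0// ler_pdivlMr ?exprn_gt0//.
      rewrite (exprM D 2 2) [X in _ <= X]expr2 ler_wpM2l ?sqr_ge0//.
      by rewrite lerXn2r ?nnegrE ?(ltW h0) ?(ltW Dh).
    apply: (@le_trans _ _ ((e + D) ^+ 2)).
      by rewrite lerXn2r ?nnegrE// addr_ge0// ltW.
    have : 2 * e * D <= 2 * e * (h + D ^+ 4 / h ^+ 3).
      by rewrite ler_wpM2l// mulr_ge0// ltW.
    have -> : (e + D) ^+ 2 = e ^+ 2 + 2 * e * D + D ^+ 2 by ring.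
    have -> : (e + h) ^+ 2 = e ^+ 2 + 2 * e * h + h ^+ 2 by ring.
    rewrite /K; set D4 := D ^+ 4; rewrite [X in _ <= _ + X]mulrDl.
    have -> : 2 * e / h ^+ 3 * D4 = 2 * e * (D4 / h ^+ 3) by ring.
    have -> : 1 / h ^+ 2 * D4 = D4 / h ^+ 2 by ring.
    move: D2; rewrite -/D4; set u := D4 / h ^+ 2; set v := D4 / h ^+ 3.
    lra.
  rewrite (RintegralD measurableT (integrable_scaleR _ (integrable_diff i))
    (integrable_scaleR K (integrable_indX i 3))).
  rewrite (RintegralZl _ measurableT (integrable_diff i)).
  rewrite (RintegralZl _ measurableT (integrable_indX i 3)).
  rewrite diffE lerD2l (ind_moment i 3) -!mulrA ler_wpM2l//.
  rewrite mulrC [leRHS](_ : _ = 48 * expR 1 * dl ^+ 2 * a i); last by ring.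
  by rewrite ler_wpM2r ?confined_prob_ge0.
rewrite {1}S_E.
apply: (@le_trans _ _ ((e + h) ^+ 2 * a n + \sum_(i < n)
   ((e + h) ^+ 2 * (a i - a i.+1) + K * (48 * expR 1) * dl ^+ 2 * a i))).
  by rewrite lerD// ler_sum.
rewrite big_split/= -mulr_sumr sum_diff -mulr_sumr /S -/K.
rewrite le_eqVlt; apply/orP; left; apply/eqP; ring.
Qed.

End gaussian_walk.

(** * Summation by parts and geometric decay *)

Section decreasing_sums.
Context {R : realType}.
Implicit Types (a : nat -> R) (n : nat).

(** When [a i] is the probability that an integer time sigma exceeds i, the left side is the mean of
    sigma on the event sigma <= n. [abel_sum_second] does the same for sigma^2. *)
Lemma abel_sum_first a n :
  \sum_(i < n) (i.+1%:R * (a i - a i.+1)) = \sum_(i < n) a i - n%:R * a n.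
Proof.
elim: n => [|n IH]; first by rewrite !big_ord0 mul0r subrr.
rewrite !big_ord_recr/= IH -(natr1 n); ring.
Qed.

Lemma abel_sum_second a n :
  \sum_(i < n) (i.+1%:R ^+ 2 * (a i - a i.+1)) =
  \sum_(i < n) ((2 * i%:R + 1) * a i) - n%:R ^+ 2 * a n.
Proof.
elim: n => [|n IH]; first by rewrite !big_ord0 expr0n/= mul0r subrr.
rewrite !big_ord_recr/= IH -(natr1 n); ring.
Qed.

(** This bounds the second moment of a time whose tail halves every [k] steps: in block m each term
    is at most 2 (m + 1) k 2^-m. *)
Lemma geometric_decay_sum a k N : (0 < k)%N ->
  (forall i, 0 <= a i) -> (forall i j, (i <= j)%N -> a j <= a i) ->
  (forall n, a (n * k)%N <= 2^-1 ^+ n) ->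
  \sum_(i < N * k) ((2 * i%:R + 1) * a i) <= 8 * k%:R ^+ 2.
Proof.
move=> k0 a0 adec ak.
have k1 : 1 <= k%:R :> R by rewrite ler1n.
(* The bracket is the sum over m < N of 2 (m + 1) 2^-m, the bound on block m divided by k^2; with it
   the induction closes. *)
suff : \sum_(i < N * k) ((2 * i%:R + 1) * a i) <=
    (8 - (4 * N%:R + 8) * 2^-1 ^+ N) * k%:R ^+ 2.
  move/le_trans; apply; rewrite ler_wpM2r ?sqr_ge0// gerBl.
  by rewrite mulr_ge0// exprn_ge0.
elim: N => [|N IH].
  by rewrite mul0n big_ord0 expr0 mulr0 add0r mulr1 subrr mul0r.
rewrite mulSn addnC big_split_ord/=.
have step : \sum_(i < k) ((2 * (N * k + i)%:R + 1) * a (N * k + i)%N) <=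
    2 * N.+1%:R * k%:R ^+ 2 * 2^-1 ^+ N.
  have -> : 2 * N.+1%:R * k%:R ^+ 2 * 2^-1 ^+ N =
      \sum_(i < k) (2 * N.+1%:R * k%:R * 2^-1 ^+ N) :> R.
    by rewrite sumr_const card_ord -mulr_natr; ring.
  apply: ler_sum => i _; apply: ler_pM => //.
  - have ik : i%:R + 1 <= k%:R :> R by rewrite natr1 ler_nat.
    rewrite natrD natrM -[N.+1%:R]natr1; nra.
  - by rewrite (le_trans _ (ak N))// adec// leq_addr.
apply: (le_trans (lerD IH step)); rewrite le_eqVlt; apply/orP; left; apply/eqP.
by rewrite [2^-1 ^+ N.+1]exprS -[N.+1%:R]natr1; field.
Qed.

(** Half of the decay absorbs the linear factor, since n <= 2^n; the number of blocks is later
    written m + m for this purpose. *)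
Lemma natr_half_exp n : (n + n)%:R * 2^-1 ^+ (n + n) <= 2 * 2^-1 ^+ n :> R.
Proof.
have h : n%:R * 2^-1 ^+ n <= 1 :> R.
  rewrite exprVn ler_pdivrMr ?exprn_gt0// mul1r -natrX ler_nat ltnW// ltn_expl//.
rewrite exprD natrD -[leRHS]mulr1.
have : 0 <= 2^-1 ^+ n :> R by rewrite exprn_ge0.
set q := 2^-1 ^+ n in h *; nra.
Qed.

End decreasing_sums.

(** * A walk observed up to an independent random time *)

Section stopped_walk.
Context d (Omega : measurableType d) (R : realType) (P : probability Omega R).
Variables (w : nat -> {mfun Omega >-> R}) (E : {mfun Omega >-> R}) (dl e : R).
Hypothesis dl0 : 0 < dl.
Hypothesis e0 : 0 < e.
Hypothesis w0 : forall x, w 0 x = 0.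
Hypothesis indep : forall n (r : R),
  (P ([set x | (E x < r)%R] `&` confined w e n) =
   P [set x | (E x < r)%R] * P (confined w e n))%E.

Definition confined_until : set Omega :=
  [set x | forall j, j%:R * dl <= E x -> `|w j x| <= e].

Let a n := fine (P (confined w e n)).
Let F (r : R) := fine (P [set x | E x < r]).

Let mE (r : R) : measurable [set x | E x < r].
Proof.
rewrite (_ : [set _ | _] = E @^-1` `]-oo, r[).
  by rewrite -[_ @^-1` _]setTI; exact: measurable_funPT.
by apply/seteqP; split=> x; rewrite /= in_itv.
Qed.

Let mw j (D : set R) : measurable D -> measurable (w j @^-1` D).
Proof. by move=> mD; rewrite -[_ @^-1` _]setTI; exact: measurable_funPT. Qed.

Let mconf n : measurable (confined w e n) := measurable_confined w e n.

Lemma measurable_confined_until : measurable confined_until.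
Proof.
rewrite (_ : confined_until = \bigcap_j
   ([set x | E x < j%:R * dl] `|` w j @^-1` `[- e, e])).
  apply: bigcapT_measurable => j; apply: measurableU => //.
  by apply: mw; exact: measurable_itv.
apply/seteqP; split=> x h j.
- move=> _; have [h1|h1] := ltP (E x) (j%:R * dl); first by left.
  by right; rewrite /= in_itv/= -ler_norml; exact: h.
- by move=> h1; case: (h j I) => /=; rewrite ?ltNge ?h1// in_itv/= -ler_norml.
Qed.

Let B := confined_until.
Let mB := measurable_confined_until.

Let finP (X : set Omega) : measurable X -> P X \is a fin_num.
Proof. by move=> mX; exact: fin_num_measure. Qed.

Let split_prob (X Y : set Omega) : measurable X -> measurable Y ->
  fine (P X) = fine (P (X `\` Y)) + fine (P (X `&` Y)).
Proof.
move=> mX mY; rewrite (measureDI P mX mY) fineD//; apply: finP.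
- exact: measurableD.
- exact: measurableI.
Qed.

Let C n := confined w e n `\` confined w e n.+1.

Let mC n : measurable (C n).
Proof. exact: measurableD. Qed.

Let confS n : confined w e n.+1 `<=` confined w e n.
Proof. by rewrite confinedS => x []. Qed.

Let prCE n (r : R) : fine (P ([set x | E x < r] `&` C n)) = F r * (a n - a n.+1).
Proof.
have ind m : fine (P ([set x | E x < r] `&` confined w e m)) = F r * a m.
  by rewrite indep fineM//; exact: finP.
rewrite mulrBr -!ind.
rewrite (split_prob (measurableI _ _ (mE r) (mconf n)) (mconf n.+1)).
rewrite -setIA (setIidr (@confS n)) setIDA; ring.
Qed.

(** On [C n] the first point outside sits at time (n + 1) dl, so confinement until [E] says exactly
    that [E] comes strictly before it. *)
Let BC n : B `&` C n = [set x | E x < n.+1%:R * dl] `&` C n.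
Proof.
apply/seteqP; split=> x [h [c1 c2]]; split => //.
- rewrite /= ltNge; apply/negP => nE; apply: c2; rewrite confinedS; split => //.
  exact: h.
- move=> j jE; apply: c1; rewrite -ltnS -(ltr_nat R) -(ltr_pM2r dl0).
  exact: le_lt_trans h.
Qed.

(** Decomposition over the exit index: the sum is the mean of [F] at the exit time over exits by
    index n, by independence, and the last term collects the paths still inside. *)
Lemma confined_until_sum n : fine (P B) =
  \sum_(i < n) (F (i.+1%:R * dl) * (a i - a i.+1)) + fine (P (B `&` confined w e n)).
Proof.
elim: n => [|n IH]; first by rewrite big_ord0 add0r confined0// setIT.
rewrite big_ord_recr/= {1}IH -addrA; congr (_ + _).
rewrite (split_prob (measurableI _ _ mB (mconf n)) (mconf n.+1)).
by rewrite -setIA (setIidr (@confS n)) -prCE -BC setIDA.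
Qed.

Let S n := dl * \sum_(i < n) a i.

Let a_ge0 n : 0 <= a n. Proof. exact: fine_ge0. Qed.

Let a_decS n : a n.+1 <= a n.
Proof.
by rewrite fine_le ?finP//; apply: le_measure; rewrite ?inE//; exact: confS.
Qed.

Let a_dec i j : (i <= j)%N -> a j <= a i.
Proof.
move=> /subnK <-; elim: (j - i)%N => [|m IH]; first by rewrite add0n.
by rewrite addSn (le_trans (a_decS _)).
Qed.

(** [F r] is replaced by c r in this decomposition. The first Abel sum evaluates the linear terms;
    the second one, with geometric decay, bounds the quadratic error. The factor 2^-N pays for the
    paths still inside after N blocks and for the boundary term of the first Abel sum. *)
Lemma confined_until_estimate (c eta K : R) (k N : nat) : (0 < k)%N ->
  0 <= c -> 0 <= eta -> 0 <= K ->
  (forall m, a (m * k)%N <= 2^-1 ^+ m) ->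
  (forall r, 0 < r -> `|F r - c * r| <= eta * r + K * r ^+ 2) ->
  `|fine (P B) - c * S (N * k)| <= eta * S (N * k) + 8 * K * (k%:R * dl) ^+ 2
     + (1 + c * N%:R * (k%:R * dl)) * 2^-1 ^+ N.
Proof.
move=> k0 c0 eta0 K0 ak hF.
set n := (N * k)%N.
have pos i : 0 < i.+1%:R * dl by rewrite mulr_gt0.
have S1 : \sum_(i < n) (i.+1%:R * dl * (a i - a i.+1)) = S n - n%:R * dl * a n.
  under eq_bigr do rewrite mulrAC [_ * dl]mulrC.
  by rewrite -mulr_sumr abel_sum_first /S; ring.
have S2 : \sum_(i < n) ((i.+1%:R * dl) ^+ 2 * (a i - a i.+1)) <= 8 * (k%:R * dl) ^+ 2.
  under eq_bigr do rewrite exprMn mulrAC [_ * dl ^+ 2]mulrC.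
  rewrite -mulr_sumr abel_sum_second.
  have := geometric_decay_sum N k0 a_ge0 a_dec ak.
  rewrite -/n; set s := \sum_(i < n) _ => hs.
  have -> : 8 * (k%:R * dl) ^+ 2 = dl ^+ 2 * (8 * k%:R ^+ 2) by ring.
  rewrite ler_wpM2l ?sqr_ge0// (le_trans _ hs)// gerBl.
  by rewrite mulr_ge0 ?sqr_ge0.
have an : a n <= 2^-1 ^+ N by exact: ak.
have PB : 0 <= fine (P (B `&` confined w e n)) <= 2^-1 ^+ N.
  rewrite fine_ge0//= (le_trans _ an)// fine_le ?finP//.
    exact: measurableI.
  apply: le_measure; rewrite ?inE//; first exact: measurableI.
have D0 i : 0 <= a i - a i.+1 by rewrite subr_ge0.
have main : `|\sum_(i < n) (F (i.+1%:R * dl) * (a i - a i.+1)) - c * (S n - n%:R * dl * a n)|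
   <= eta * (S n - n%:R * dl * a n) + K * (8 * (k%:R * dl) ^+ 2).
  rewrite -S1 mulr_sumr -sumrB (le_trans (ler_norm_sum _ _ _))//.
  rewrite (@le_trans _ _ (\sum_(i < n) (eta * (i.+1%:R * dl * (a i - a i.+1)) +
     K * ((i.+1%:R * dl) ^+ 2 * (a i - a i.+1)))))//.
    apply: ler_sum => i _; have := hF _ (pos i); have := D0 i.
    set r := i.+1%:R * dl; set D := a i - a i.+1 => D0' h.
    have -> : F r * D - c * (r * D) = (F r - c * r) * D by ring.
    have -> : eta * (r * D) + K * (r ^+ 2 * D) = (eta * r + K * r ^+ 2) * D by ring.
    by rewrite normrM (ger0_norm D0') ler_wpM2r.
  by rewrite big_split/= -!mulr_sumr lerD2l ler_wpM2l.
have Sn : 0 <= n%:R * dl * a n by rewrite !mulr_ge0// ltW.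
have Sn2 : n%:R * dl * a n <= N%:R * (k%:R * dl) * 2^-1 ^+ N.
  rewrite /n natrM -[_ * dl]mulrA ler_wpM2l// ?mulr_ge0 ?(ltW dl0)//.
move: main PB; rewrite (confined_until_sum n).
set s := \sum_(i < n) _; set y := fine _; set q := n%:R * dl * a n in Sn Sn2 *.
move=> main /andP[y0 y1].
have cq : 0 <= c * q by rewrite mulr_ge0.
have cq2 : c * q <= c * (N%:R * (k%:R * dl) * 2^-1 ^+ N) by rewrite ler_wpM2l.
have eq : 0 <= eta * q by rewrite mulr_ge0.
move: main; rewrite !ler_norml => /andP[m1 m2].
have -> : (1 + c * N%:R * (k%:R * dl)) * 2^-1 ^+ N =
    2^-1 ^+ N + c * (N%:R * (k%:R * dl) * 2^-1 ^+ N) by ring.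
move: cq2 y1; set t := 2^-1 ^+ N; set u := c * (_ * t) => cq2 y1.
apply/andP; split; lra.
Qed.

End stopped_walk.

(** * Brownian motion on a mesh *)

Section brownian_confinement.
Context d (Omega : measurableType d) (R : realType) (P : probability Omega R).
Variable W : R -> {RV P >-> R}.
Hypothesis hW : standard_brownian_motion W.

Definition sampled (dl : R) (i : nat) : {RV P >-> R} := W (i%:R * dl).

Lemma sampled0 dl x : sampled dl 0 x = 0.
Proof. by rewrite /sampled mul0r (brownian_start hW). Qed.

Lemma sampled_increments_indep dl : 0 <= dl -> forall n (B : 'I_n -> set R),
  (forall i, measurable (B i)) ->
  P (\bigcap_(i in [set: 'I_n]) increment (sampled dl) i @^-1` B i) =
  (\prod_(i < n) P (increment (sampled dl) i @^-1` B i))%E.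
Proof.
move=> dl0 n B mB.
apply: (@brownian_independent _ _ _ _ _ hW n (fun i => i%:R * dl)) => //.
- by rewrite mul0r.
- by move=> i; rewrite ler_wpM2r// ler_nat.
Qed.

Lemma sampled_increment_law dl : 0 < dl -> forall i (B : set R), measurable B ->
  P (increment (sampled dl) i @^-1` B) = normal_prob 0 (Num.sqrt dl) B.
Proof.
move=> dl0 i B mB.
have := @brownian_normal _ _ _ _ _ hW (i%:R * dl) (i.+1%:R * dl) B.
rewrite [X in normal_prob _ (Num.sqrt X)](_ : _ = dl); last first.
  by rewrite -(natr1 i); ring.
apply => //; first by rewrite mulr_ge0// ltW.
by rewrite ltr_pM2r// ltr_nat.
Qed.

Lemma prode_le_expr n (f : 'I_n -> \bar R) (q : R) :
  (forall i, 0 <= f i <= q%:E)%E -> (\prod_(i < n) f i <= (q ^+ n)%:E)%E.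
Proof.
move=> fq.
suff : (0 <= \prod_(i < n) f i <= (\prod_(i < n) q)%:E)%E.
  by move=> /andP[_]; rewrite prodr_const card_ord.
elim/big_ind2 : _ => //; first by rewrite lee01 lexx.
move=> x1 x2 y1 y2 /andP[x10 x12] /andP[y10 y12].
by rewrite mule_ge0//= EFinM lee_pmul.
Qed.

(* Over a time 16 e^2 the increment of W has standard deviation 4 e, hence stays
   in [-2 e, 2 e] with probability at most 1 / 2. *)
Lemma sampled_confined_decay dl e k m : 0 < dl -> 0 < e ->
  16 * e ^+ 2 <= k%:R * dl ->
  fine (P (confined (sampled dl) e (m * k))) <= 2^-1 ^+ m.
Proof.
move=> dl0 e0 hk.
have kdl0 : 0 < k%:R * dl by rewrite (lt_le_trans _ hk)// mulr_gt0 ?exprn_gt0.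
have s0 : 4 * e <= Num.sqrt (k%:R * dl).
  rewrite -[leLHS]ger0_norm ?mulr_ge0 ?(ltW e0)// -sqrtr_sqr ler_wsqrtr//.
  by rewrite exprMn (_ : 4 ^+ 2 = 16)//; ring.
have s1 : 0 < Num.sqrt (k%:R * dl) by rewrite sqrtr_gt0.
rewrite -lee_fin fineK; last first.
  by apply: fin_num_measure; exact: measurable_confined.
have mI : measurable (`[- (2 * e), 2 * e] : set R) by exact: measurable_itv.
(* Only every k-th mesh point is kept: two positions inside differ by at most 2 e, and the
   increments over the coarse mesh are independent. *)
have h1 : (P (confined (sampled dl) e (m * k)) <= \prod_(i < m)
   P (increment (sampled (k%:R * dl)) i @^-1` `[(- (2 * e))%R, (2 * e)%R]))%E.
  rewrite -(sampled_increments_indep (ltW kdl0) (fun=> mI)).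
  apply: le_measure; rewrite ?inE.
  - exact: measurable_confined.
  - apply: fin_bigcap_measurable => // i _.
    have mi : measurable_fun setT (increment (sampled (k%:R * dl)) i).
      exact: measurable_funB.
    by rewrite -[_ @^-1` _]setTI; exact: mi.
  - move=> x h i _; rewrite /= in_itv/= -ler_norml /increment /sampled !mulrA -!natrM.
    have hi j : (j <= m)%N -> `|W ((j * k)%:R * dl) x| <= e.
      by move=> jm; apply: h; rewrite leq_mul2r jm orbT.
    rewrite (le_trans (ler_normB _ _))// mulr2n mulrDl !mul1r lerD// hi//.
    exact: ltnW.
apply: (le_trans h1); apply: prode_le_expr => i; rewrite measure_ge0/= sampled_increment_law//.
apply: (le_trans (normal_prob_small_ball s1 _)); first by rewrite mulr_ge0// ltW.
rewrite lee_fin ler_pdivrMr//; lra.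
Qed.

Variable E : {mfun Omega >-> R}.

(** [rho] absorbs whatever vanishes with the mesh or as the number of blocks grows. The constant
    8192 is 8 times 32^2, since a block lasts at most 32 e^2. *)
Lemma brownian_confined_until_estimate (c eta K e rho : R) :
  0 <= c -> 0 <= eta -> 0 <= K -> 0 < e -> 0 < rho ->
  (forall dl n (r : R), 0 < dl ->
    (P ([set x | (E x < r)%R] `&` confined (sampled dl) e n) =
     P [set x | (E x < r)%R] * P (confined (sampled dl) e n))%E) ->
  (forall r, 0 < r -> `|fine (P [set x | E x < r]) - c * r| <= eta * r + K * r ^+ 2) ->
  exists2 dl0, 0 < dl0 & forall dl, 0 < dl -> dl <= dl0 ->
    `|fine (P (confined_until (sampled dl) E dl e)) - c * e ^+ 2| <=
    eta * e ^+ 2 + 8192 * K * e ^+ 4 + rho.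
Proof.
move=> c0 eta0 K0 e0 rho0 indep hF.
have e20 : 0 < e ^+ 2 by rewrite exprn_gt0.
(* The mean exit time will exceed e^2 by at most 2 r1, at a cost 2 r1 (c + eta) <= 2 rho / 3; the
   remaining third of [rho] is for the terms in 2^-m. *)
pose r1 := rho / (3 * (1 + c + eta)).
have ce0 : 0 < 1 + c + eta by lra.
have r10 : 0 < r1 by rewrite divr_gt0// mulr_gt0.
pose h := Num.min 1 (r1 / (2 * e + 1)).
have h0 : 0 < h by rewrite lt_min ltr01 divr_gt0//; lra.
have h1 : h <= 1 by rewrite ge_min lexx.
have he : (e + h) ^+ 2 <= e ^+ 2 + r1.
  have : h * (2 * e + 1) <= r1.
    by rewrite -ler_pdivlMr ?ge_min ?lexx ?orbT//; lra.
  have : h ^+ 2 <= h by rewrite expr2 ler_piMl// ltW.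
  have -> : (e + h) ^+ 2 = e ^+ 2 + 2 * e * h + h ^+ 2 by ring.
  lra.
pose M := (2 * e / h ^+ 3 + 1 / h ^+ 2) * (48 * expR 1).
have M0 : 0 < M.
  rewrite mulr_gt0 ?mulr_gt0 ?expR_gt0// addr_gt0// divr_gt0 ?exprn_gt0 ?mulr_gt0//.
(* The first bound keeps blocks below 32 e^2. The second makes M dl (e^2 + 2 r1) <= r1, so that the
   right-hand [S n] of [confined_sum_le] is absorbed by the left side. *)
pose dl0 := Num.min (16 * e ^+ 2) (r1 / (e ^+ 2 + 2 * r1) / M).
have er0 : 0 < e ^+ 2 + 2 * r1 by lra.
have dl00 : 0 < dl0.
  by rewrite lt_min mulr_gt0// divr_gt0// divr_gt0.
exists dl0 => // dl dlp dlle.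
have dl1 : dl <= 16 * e ^+ 2 by rewrite (le_trans dlle)// ge_min lexx.
have dl2 : M * dl * (e ^+ 2 + 2 * r1) <= r1.
  rewrite -ler_pdivlMr// mulrC -ler_pdivlMr//.
  by rewrite (le_trans dlle)// ge_min lexx orbT.
(* A block of k steps lasts at least 16 e^2, as the decay requires, and at most 32 e^2. *)
pose k := (Num.truncn (16 * e ^+ 2 / dl)).+1.
have k_ge : 16 * e ^+ 2 <= k%:R * dl.
  by rewrite -ler_pdivrMr// ltW// /k; exact: truncnS_gt.
have k_le : k%:R * dl <= 32 * e ^+ 2.
  have : (Num.truncn (16 * e ^+ 2 / dl))%:R <= 16 * e ^+ 2 / dl.
    by rewrite Num.Theory.truncn_le// divr_ge0 ?mulr_ge0 ?ltW.
  rewrite ler_pdivlMr// /k -natr1 mulrDl mul1r; lra.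
have ak m := sampled_confined_decay m dlp e0 k_ge.
pose a n := fine (P (confined (sampled dl) e n)).
pose S n := dl * \sum_(i < n) a i.
have w0 := sampled0 dl.
have Sle n : S n <= e ^+ 2 + 2 * r1.
  have := confined_sum_le dlp w0 (sampled_increments_indep (ltW dlp))
    (sampled_increment_law dlp) e0 n h0.
  rewrite -/M -/(a _) -/(S n) => hS; rewrite leNgt; apply/negP => hn.
  have : (1 - M * dl) * (e ^+ 2 + 2 * r1) < (1 - M * dl) * S n.
    rewrite ltr_pM2l// subr_gt0.
    have : M * dl * (e ^+ 2 + 2 * r1) < 1 * (e ^+ 2 + 2 * r1) by lra.
    by rewrite ltr_pM2r.
  lra.
(* 64 c e^2 comes from c (m + m) (k dl) 2^-(m + m) with k dl <= 32 e^2, and one more c e^2 from the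
   defect e^2 a_n in the lower bound of the mean exit time. *)
pose L := 1 + 65 * (c * e ^+ 2).
have ce2 : 0 <= c * e ^+ 2 by rewrite mulr_ge0// ltW.
have L0 : 0 < L by rewrite /L; lra.
pose m := (Num.truncn (3 * L / rho)).+1.
have hm : L * 2^-1 ^+ m <= rho / 3.
  have mL : 3 * L / rho < m%:R by exact: truncnS_gt.
  have m2 : m%:R <= 2 ^+ m :> R by rewrite -natrX ler_nat ltnW// ltn_expl.
  rewrite exprVn ler_pdivrMr ?exprn_gt0//.
  move: mL; rewrite ltr_pdivrMr// => mL.
  have : m%:R * rho <= 2 ^+ m * rho by rewrite ler_wpM2r// ltW.
  lra.
have sN := natr_half_exp m (R := R).
have sN1 : 2^-1 ^+ (m + m) <= 2^-1 ^+ m :> R.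
  by rewrite exprD ler_piMl ?exprn_ge0// exprn_ile1//; lra.
pose n := ((m + m) * k)%N.
have an : a n <= 2^-1 ^+ (m + m) by exact: ak.
have := confined_sum_ge dlp w0 (sampled_increments_indep (ltW dlp))
    (sampled_increment_law dlp) e0 n.
rewrite -/(a _) -/(S n) => Sge.
have := @confined_until_estimate _ Omega R P (sampled dl) E dl e dlp e0 w0
  (fun n r => indep dl n r dlp) c eta K k (m + m) (ltn0Sn _) c0 eta0 K0 ak hF.
rewrite -/(S n).
set p := fine _; have := Sle n; move: Sge.
set s := S n; set t := 2^-1 ^+ (m + m) in sN sN1 an *; set u := 2^-1 ^+ m in hm sN sN1.
move=> Sge Sup main.
have kd : (k%:R * dl) ^+ 2 <= 1024 * e ^+ 4.
  have -> : 1024 * e ^+ 4 = (32 * e ^+ 2) ^+ 2 by ring.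
  by rewrite lerXn2r// nnegrE ?mulr_ge0// ltW.
have h3 : 8 * K * (k%:R * dl) ^+ 2 <= 8192 * K * e ^+ 4.
  have -> : 8192 * K * e ^+ 4 = 8 * K * (1024 * e ^+ 4) by ring.
  by rewrite ler_wpM2l// mulr_ge0.
have t0 : 0 <= t by rewrite exprn_ge0.
have h4 : (1 + c * (m + m)%:R * (k%:R * dl)) * t <= u + 64 * (c * e ^+ 2) * u.
  have -> : (1 + c * (m + m)%:R * (k%:R * dl)) * t =
      t + c * (((m + m)%:R * t) * (k%:R * dl)) by ring.
  have -> : 64 * (c * e ^+ 2) * u = c * (2 * u * (32 * e ^+ 2)) by ring.
  rewrite lerD// ler_wpM2l// ler_pM// ?mulr_ge0// ltW//.
have h5 : eta * s <= eta * e ^+ 2 + 2 * r1 * eta.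
  have -> : eta * e ^+ 2 + 2 * r1 * eta = eta * (e ^+ 2 + 2 * r1) by ring.
  by rewrite ler_wpM2l.
have h6 : c * s <= c * e ^+ 2 + 2 * r1 * c.
  have -> : c * e ^+ 2 + 2 * r1 * c = c * (e ^+ 2 + 2 * r1) by ring.
  by rewrite ler_wpM2l.
have h7 : c * e ^+ 2 - c * e ^+ 2 * u <= c * s.
  have -> : c * e ^+ 2 - c * e ^+ 2 * u = c * (e ^+ 2 * (1 - u)) by ring.
  rewrite ler_wpM2l// (le_trans _ Sge)// ler_wpM2l ?(ltW e20)//.
  by rewrite lerD2l lerN2 (le_trans an).
have h8 : 2 * r1 * (c + eta) <= 2 / 3 * rho.
  have -> : 2 / 3 * rho = 2 * r1 * (1 + c + eta).
    by rewrite /r1; field; rewrite gt_eqF.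
  have hc : c + eta <= 1 + c + eta by rewrite -addrA lerDr.
  have r2 : 0 <= 2 * r1 by rewrite mulr_ge0// ltW.
  exact: ler_wpM2l r2 _ _ hc.
have h9 : u + 65 * (c * e ^+ 2) * u <= rho / 3.
  by move: hm; rewrite /L mulrDl mul1r.
have cu : 0 <= c * e ^+ 2 * u by rewrite mulr_ge0// exprn_ge0.
have r1c : 0 <= r1 * c by rewrite mulr_ge0// ltW.
have r1e : 0 <= r1 * eta by rewrite mulr_ge0// ltW.
move: main h3; rewrite !ler_norml => /andP[m1 m2].
set x := 8 * K * _ in m1 m2 *; set y := 8192 * K * _ => h3.
set q := (1 + _) * t in h4 m1 m2.
clear -m1 m2 h3 h4 h5 h6 h7 h8 h9 cu r1c r1e.
have {h4 h9} h4 : q + c * e ^+ 2 * u <= rho / 3 by lra.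
apply/andP; split; lra.
Qed.

End brownian_confinement.

(** * Bernstein approximation *)

Section bernstein.
Context {R : realType}.
Implicit Types (g h : nat -> R) (z : R).

(* Bernstein operators, computed by de Casteljau's recursion. *)
Fixpoint bernstein n g z : R :=
  if n is m.+1 then (1 - z) * bernstein m g z + z * bernstein m (fun k => g k.+1) z
  else g 0%N.

Lemma bernsteinD n g h z :
  bernstein n (fun k => g k + h k) z = bernstein n g z + bernstein n h z.
Proof. by elim: n g h => [//|n IH] g h /=; rewrite !IH; ring. Qed.

Lemma bernsteinZ n (c : R) g z : bernstein n (fun k => c * g k) z = c * bernstein n g z.
Proof. by elim: n g => [//|n IH] g /=; rewrite !IH; ring. Qed.

Lemma bernstein_cst n (c : R) z : bernstein n (fun=> c) z = c.
Proof. by elim: n => [//|n IH] /=; rewrite !IH; ring. Qed.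

Lemma le_bernstein n g h z : 0 <= z <= 1 -> (forall k, g k <= h k) ->
  bernstein n g z <= bernstein n h z.
Proof.
move=> /andP[z0 z1]; elim: n g h => [|n IH] g h gh /=; first exact: gh.
by rewrite lerD// ler_wpM2l ?subr_ge0// IH.
Qed.

(** [bernstein n g z] is the mean of [g] under the binomial law with parameters n and z, so this is
    variance plus squared bias. *)
Lemma bernstein_variance n (c : R) z :
  bernstein n (fun k => (k%:R - c) ^+ 2) z = n%:R * z * (1 - z) + (n%:R * z - c) ^+ 2.
Proof.
elim: n c => [|n IH] c /=; first by rewrite mulr0n !mul0r !add0r.
have -> : (fun k => (k.+1%:R - c) ^+ 2) = (fun k => (k%:R - (c - 1)) ^+ 2).
  by apply/funext => k; rewrite -(natr1 k); ring.
by rewrite !IH -(natr1 n); ring.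
Qed.

(* The bound [|u| <= t + u^2 / t] turns the variance into a first moment. *)
Lemma bernstein_lipschitz (f : R -> R) (L t z : R) n : (0 < n)%N -> 0 <= L -> 0 < t ->
  (forall x y, `|f x - f y| <= L * `|x - y|) -> 0 <= z <= 1 ->
  `|bernstein n (fun k => f (k%:R / n%:R)) z - f z| <= L * (t + 1 / (4 * t * n%:R)).
Proof.
move=> n0 L0 t0 fL z01; have n0' : 0 < n%:R :> R by rewrite ltr0n.
pose h k := L * t + L / (t * n%:R ^+ 2) * (k%:R - n%:R * z) ^+ 2.
have tn : 0 < t * n%:R ^+ 2 by rewrite mulr_gt0 ?exprn_gt0.
have hb k : `|f (k%:R / n%:R) - f z| <= h k.
  rewrite (le_trans (fL _ _))//.
  have -> : h k = L * (t + (k%:R / n%:R - z) ^+ 2 / t).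
    by rewrite /h; field; rewrite !gt_eqF.
  rewrite ler_wpM2l// -(real_normK (num_real (_ - z))).
  set u := `|_|; have u0 : 0 <= u by rewrite /u.
  have [ut|tu] := leP u t; first by rewrite (le_trans ut)// lerDl divr_ge0 ?sqr_ge0// ltW.
  by rewrite -[leLHS]add0r lerD ?(ltW t0)// ler_pdivlMr// expr2 ler_wpM2l// ltW.
have hB : bernstein n h z <= L * (t + 1 / (4 * t * n%:R)).
  rewrite /h bernsteinD bernstein_cst bernsteinZ bernstein_variance subrr expr0n addr0.
  have -> : L / (t * n%:R ^+ 2) * (n%:R * z * (1 - z)) = L * (z * (1 - z) * 4 / (4 * t * n%:R)).
    by field; rewrite !gt_eqF.
  rewrite -mulrDr ler_wpM2l// lerD2l ler_wpM2r ?invr_ge0 ?mulr_ge0 ?(ltW t0) ?(ltW n0')//.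
  by have := sqr_ge0 (2 * z - 1); nra.
rewrite (le_trans _ hB)// ler_norml; apply/andP; split.
- rewrite lerBrDr addrC -(bernstein_cst n (f z) z) -[- _]mulN1r -bernsteinZ -bernsteinD.
  apply: le_bernstein => // k; have := hb k; rewrite ler_norml => /andP[? _]; lra.
- rewrite lerBlDr -[X in _ + X](bernstein_cst n (f z) z) -bernsteinD.
  apply: le_bernstein => // k; have := hb k; rewrite ler_norml => /andP[_ ?]; lra.
Qed.

Lemma lipschitz_bernstein_approx (f : R -> R) (L e : R) : 0 < e -> 0 <= L ->
  (forall x y, `|f x - f y| <= L * `|x - y|) ->
  exists n g, forall z, 0 <= z <= 1 -> `|bernstein n g z - f z| <= e.
Proof.
move=> e0 L0 fL.
have L1 : 0 < L + 1 by rewrite ltr_wpDl.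
(* Each of the two terms of [bernstein_lipschitz] will be at most L t; dividing by L + 1 also covers
   L = 0. *)
have [t t0 tE] : exists2 t, 0 < t & (L + 1) * (t + t) = e.
  exists (e / (2 * (L + 1))); first by rewrite divr_gt0// mulr_gt0.
  by field; rewrite gt_eqF.
pose n := (Num.truncn (1 / (4 * t * t))).+1.
exists n, (fun k => f (k%:R / n%:R)) => z z01.
rewrite (le_trans (bernstein_lipschitz (ltn0Sn _) L0 t0 fL z01))//.
have n0 : 0 < n%:R :> R by rewrite ltr0n.
have hn : 1 / (4 * t * n%:R) <= t.
  have : 1 / (4 * t * t) < n%:R by exact: truncnS_gt.
  rewrite ltr_pdivrMr ?mulr_gt0// => h.
  by rewrite ler_pdivrMr ?mulr_gt0//; lra.
rewrite -tE.
apply: ler_pM => //; rewrite ?lerDl ?lerD2l//.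
by rewrite addr_ge0 ?(ltW t0)// divr_ge0// !mulr_ge0// ltW.
Qed.

End bernstein.

(** * A Lipschitz cutoff between two indicators *)

Section ramp.
Context {R : realType}.
Variables a' a : R.
Hypothesis a'a : a' < a.
Hypothesis a1 : a < 1.

(* [ramp z * (1 - z)] interpolates between the indicators of [z <= a'] and [z < a]. *)
Definition ramp (z : R) : R :=
  Num.max 0 (Num.min 1 ((a - z) / (a - a'))) / (1 - Num.min z a).

Let clamp (z : R) := Num.max 0 (Num.min 1 ((a - z) / (a - a'))).

Let aa0 : 0 < a - a'. Proof. by rewrite subr_gt0. Qed.

Let clamp01 z : 0 <= clamp z <= 1.
Proof. by rewrite /clamp le_max lexx/= ge_max ler01 ge_min lexx. Qed.

Let min_lipschitz (c x y : R) : `|Num.min x c - Num.min y c| <= `|x - y|.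
Proof.
wlog xy : x y / x <= y.
  by move=> H; have [/H//|/ltW /H] := leP x y; rewrite distrC (distrC y).
rewrite [`|x - y|]distrC (ger0_norm (_ : 0 <= y - x)) ?subr_ge0//.
by rewrite ler_norml; case: (leP x c) => ?; case: (leP y c) => ?; apply/andP; split; lra.
Qed.

Let clamp_lipschitz x y : `|clamp x - clamp y| <= (a - a')^-1 * `|x - y|.
Proof.
have maxl (u v : R) : `|Num.max 0 u - Num.max 0 v| <= `|u - v|.
  wlog uv : u v / u <= v.
    by move=> H; have [/H//|/ltW /H] := leP u v; rewrite distrC (distrC v).
  rewrite [`|u - v|]distrC (ger0_norm (_ : 0 <= v - u)) ?subr_ge0//.
  by rewrite ler_norml; case: (leP 0 u) => ?; case: (leP 0 v) => ?; apply/andP; split; lra.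
rewrite (le_trans (maxl _ _))// !(minC 1) (le_trans (min_lipschitz _ _ _))//.
rewrite -mulrBl (_ : a - x - (a - y) = y - x); last by ring.
by rewrite normrM distrC mulrC (@gtr0_norm _ (a - a')^-1) ?invr_gt0.
Qed.

Let a1' : 0 < 1 - a. Proof. by rewrite subr_gt0. Qed.

(** Truncating z at [a] keeps the denominator away from 0; beyond [a] the numerator vanishes, so the
    quotient is unaffected. *)
Let den_ge (z : R) : 1 - a <= 1 - Num.min z a.
Proof. by rewrite lerD2l lerN2 ge_min lexx orbT. Qed.

Let den_gt0 (z : R) : 0 < 1 - Num.min z a.
Proof. exact: lt_le_trans (den_ge z). Qed.

(** Product rule for differences: the slope of the clamp times the largest reciprocal, plus the
    slope of the reciprocal times a clamp at most 1. *)
Lemma ramp_lipschitz (x y : R) :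
  `|ramp x - ramp y| <= ((a - a')^-1 / (1 - a) + (1 - a)^-1 ^+ 2) * `|x - y|.
Proof.
have dx := den_gt0 x; have dy := den_gt0 y.
have -> : ramp x - ramp y = (clamp x - clamp y) / (1 - Num.min x a) +
    clamp y * ((Num.min x a - Num.min y a) / (1 - Num.min x a) / (1 - Num.min y a)).
  by rewrite /ramp -/(clamp x) -/(clamp y); field; rewrite !gt_eqF.
have inv z : (1 - Num.min z a)^-1 <= (1 - a)^-1.
  by rewrite lef_pV2 ?posrE//.
have inv0 z : 0 <= (1 - Num.min z a)^-1 by rewrite invr_ge0 ltW.
rewrite (le_trans (ler_normD _ _))// [leRHS]mulrDl lerD//.
- rewrite normrM (ger0_norm (inv0 x)) mulrAC ler_pM//.
- have /andP[c0 c1] := clamp01 y.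
  rewrite !normrM !(ger0_norm (inv0 _)) (ger0_norm c0) mulrC.
  rewrite -[leRHS]mulr1 ler_pM// ?mulr_ge0//.
  by rewrite expr2 -mulrA mulrC ler_pM ?mulr_ge0// ler_pM.
Qed.

(** The point z = 1 is y = 0, where the drift is concentrated: this value removes it from
    [levy_mean]. *)
Lemma ramp1 : ramp 1 = 0.
Proof.
rewrite /ramp (_ : Num.max _ _ = 0) ?mul0r//; apply/max_idPl.
by rewrite ge_min; apply/orP; right; rewrite pmulr_lle0 ?invr_gt0// subr_le0 ltW.
Qed.

Lemma ramp_ge0 z : 0 <= ramp z.
Proof. by rewrite divr_ge0 ?(ltW (den_gt0 z))//; case/andP : (clamp01 z). Qed.

Lemma ramp_le z : ramp z <= (1 - a)^-1.
Proof.
rewrite -[leRHS]mul1r ler_pM ?invr_ge0 ?(ltW (den_gt0 z))//.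
- by case/andP : (clamp01 z).
- by case/andP : (clamp01 z).
- by rewrite lef_pV2 ?posrE.
Qed.

Lemma ramp_mul_eq1 z : z <= a' -> ramp z * (1 - z) = 1.
Proof.
move=> za'; have za : z < a by exact: le_lt_trans a'a.
have -> : ramp z = (1 - z)^-1.
  rewrite /ramp (min_l (ltW za)) min_l; first by rewrite max_r ?mul1r.
  by rewrite ler_pdivlMr// mul1r lerD2l lerN2.
by rewrite mulVf// gt_eqF// subr_gt0 (lt_trans za).
Qed.

Lemma ramp_mul_le1 z : z <= 1 -> ramp z * (1 - z) <= 1.
Proof.
move=> z1; have [za|za] := ltP z a.
  rewrite /ramp (min_l (ltW za)) divfK ?gt_eqF ?subr_gt0 ?(lt_trans za)//.
  by case/andP : (clamp01 z).
suff -> : ramp z = 0 by rewrite mul0r.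
rewrite /ramp (_ : Num.max _ _ = 0) ?mul0r//; apply/max_idPl.
by rewrite ge_min; apply/orP; right; rewrite pmulr_lle0 ?invr_gt0// subr_le0.
Qed.

Lemma ramp_eq0 z : a <= z -> ramp z = 0.
Proof.
move=> za; rewrite /ramp (_ : Num.max _ _ = 0) ?mul0r//; apply/max_idPl.
by rewrite ge_min; apply/orP; right; rewrite pmulr_lle0 ?invr_gt0// subr_le0.
Qed.

Lemma measurable_ramp : measurable_fun setT ramp.
Proof.
apply: continuous_measurable_fun => x.
pose L := (a - a')^-1 / (1 - a) + (1 - a)^-1 ^+ 2.
have L0 : 0 < L by rewrite addr_gt0 ?exprn_gt0 ?divr_gt0 ?invr_gt0.
apply/cvgrPdist_le => e e0.
have eL : 0 < e / L by rewrite divr_gt0.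
near=> y.
rewrite (le_trans (ramp_lipschitz x y))// mulrC -ler_pdivlMr//.
Unshelve. all: by end_near. Qed.

End ramp.

(** * Small-time behaviour of a subordinator *)

Section subordinator_small_time.
Context d (Omega : measurableType d) (R : realType) (P : probability Omega R).
Variables (b : R) (nu : {measure set (measurableTypeR R) -> \bar R}).
Variable D : R -> {RV P >-> R}.
Hypothesis hD : subordinator b nu D.

Local Notation psi := (laplace_exponent b nu).
Let J : set (measurableTypeR R) := `]0%R, +oo[%classic.

Let mJ : measurable J. Proof. exact: measurable_itv. Qed.

Let b0 : 0 <= b := subordinator_drift hD.

Lemma subordinator_ge0 x w : 0 <= x -> 0 <= D x w.
Proof.
move=> x0; rewrite -(levy_start (subordinator_levy hD) w).
exact: (subordinator_nondecreasing hD).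
Qed.

Lemma integrable_le_norm_in (f g : measurableTypeR R -> R) :
  measurable_fun setT f -> nu.-integrable J (EFin \o g) ->
  (forall y, 0 < y -> `|f y| <= g y) -> nu.-integrable J (EFin \o f).
Proof.
move=> mf ig fg; apply: (le_integrable mJ _ _ ig).
  by apply/measurable_EFinP; exact: measurable_funTS.
move=> y; rewrite /J/= in_itv/= andbT => y0; rewrite lee_fin.
by rewrite (le_trans (fg y y0))// ler_norm.
Qed.

Let int_scale (c : R) (g : measurableTypeR R -> R) :
  nu.-integrable J (EFin \o g) -> nu.-integrable J (EFin \o (fun y => c * g y)).
Proof.
move=> ig; rewrite (_ : EFin \o _ = (fun x => c%:E * (EFin \o g) x)%E).
  exact: integrableZl.
by apply/funext => y /=; rewrite EFinM.
Qed.

Let int_min : nu.-integrable J (EFin \o (fun y => Num.min y 1)).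
Proof.
have mm : measurable_fun (setT : set (measurableTypeR R)) (fun y : R => Num.min y 1).
  by apply: measurable_minr => //; exact: measurable_id.
apply/integrableP; split; first by apply/measurable_EFinP; exact: measurable_funTS.
apply: le_lt_trans (levy_measure_integrable (subordinator_measure hD)).
rewrite le_eqVlt; apply/orP; left; apply/eqP; apply: eq_integral => y.
rewrite inE /J/= in_itv/= andbT => y0.
by rewrite ger0_norm// le_min (ltW y0) ler01.
Qed.

Let one_sub_exp_le (s y : R) : 0 <= s -> 0 < y ->
  0 <= 1 - expR (- (s * y)) <= (1 + s) * Num.min y 1.
Proof.
move=> s0 y0; have sy : 0 <= s * y by rewrite mulr_ge0// ltW.
apply/andP; split; first by rewrite subr_ge0 expR_le1 oppr_le0.
have := expR_ge1Dx (- (s * y)); have := expR_gt0 (- (s * y)).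
set E := expR _ => E0 E1.
by case: (leP y 1) => hy; nra.
Qed.

Let mexp (s : R) : measurable_fun (setT : set (measurableTypeR R))
  (fun y : R => expR (- (s * y))).
Proof.
by apply: measurableT_comp => //; apply: measurableT_comp.
Qed.

Let int_one_sub_exp (s : R) : 0 <= s ->
  nu.-integrable J (EFin \o (fun y => 1 - expR (- (s * y)))).
Proof.
move=> s0; apply: (integrable_le_norm_in _ (int_scale (1 + s) int_min)).
  by apply: measurable_funB => //; exact: mexp.
by move=> y y0; have /andP[h1 h2] := one_sub_exp_le s0 y0; rewrite ger0_norm.
Qed.

Definition admissible (f : R -> R) := measurable_fun setT f /\
  exists M, forall z, 0 <= z <= 1 -> `|f z| <= M.

(* Test functions are expressed in z = e^{-y}; the factor 1 - z makes them
   nu-integrable near 0. *)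
Let wt (f : R -> R) (y : R) := f (expR (- y)) * (1 - expR (- y)).

Let exp01 (y : R) : 0 <= y -> 0 <= expR (- y) <= 1.
Proof. by move=> y0; rewrite expR_ge0 expR_le1 oppr_le0. Qed.

Let mwt f : admissible f -> measurable_fun setT (wt f).
Proof.
move=> [mf _]; apply: measurable_funM.
  by apply: measurableT_comp => //; apply: measurableT_comp.
by apply: measurable_funB => //; apply: measurableT_comp.
Qed.

Let int_nu f : admissible f -> nu.-integrable J (EFin \o wt f).
Proof.
move=> af; have [_ [M fM]] := af.
have ig := int_scale M (int_one_sub_exp ler01).
apply: (integrable_le_norm_in (mwt af) ig) => y y0.
have /andP[e0 e1] := exp01 (ltW y0).
by rewrite mul1r normrM (@ger0_norm _ (1 - _)) ?subr_ge0// ler_wpM2r ?subr_ge0// fM// e0.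
Qed.

Let int_P f x : 0 <= x -> admissible f -> P.-integrable setT (EFin \o (wt f \o D x)).
Proof.
move=> x0 af; have [_ [M fM]] := af.
apply: (integrable_le_norm _ (integrable_cstR P M)).
  by apply: measurableT_comp => //; exact: mwt.
move=> w; have /andP[e0 e1] := exp01 (subordinator_ge0 w x0).
rewrite /= normrM (@ger0_norm _ (1 - _)) ?subr_ge0//.
rewrite -[leRHS]mulr1 ler_pM ?subr_ge0// ?fM ?e0// lerBlDr lerDl//.
Qed.

Definition small_time_mean (f : R -> R) (x : R) : R := x^-1 * \int[P]_w (wt f (D x w)).
(** As x tends to 0, the law of e^(-D x) weighted by (1 - z) / x converges to the image of (1 -
    e^-y) nu plus a mass [b] at z = 1. The drift lands there with weight [b] because 1 - e^-y is
    equivalent to y at 0. *)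
Definition levy_mean (f : R -> R) : R := b * f 1 + \int[nu]_(y in J) (wt f y).

Let converges f := admissible f /\ small_time_mean f x @[x --> 0^'+] --> levy_mean f.

Let admissible_lin f g c : admissible f -> admissible g ->
  admissible (fun z => f z + c * g z).
Proof.
move=> [mf [M fM]] [mg [N gN]]; split.
  by apply: measurable_funD => //; exact: measurable_funM.
exists (M + `|c| * N) => z z01; rewrite (le_trans (ler_normD _ _))//.
by rewrite lerD ?fM// normrM ler_wpM2l// gN.
Qed.

Let wt_lin f g c y : wt (fun z => f z + c * g z) y = wt f y + c * wt g y.
Proof. by rewrite /wt; ring. Qed.

Let small_time_mean_lin f g c x : 0 <= x -> admissible f -> admissible g ->
  small_time_mean (fun z => f z + c * g z) x =
  small_time_mean f x + c * small_time_mean g x.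
Proof.
move=> x0 af ag; rewrite /small_time_mean.
under eq_Rintegral do rewrite wt_lin.
have i1 := int_P x0 af; have i2 := int_P x0 ag.
rewrite (RintegralD measurableT i1 (integrable_scaleR c i2)) (RintegralZl _ measurableT i2).
by rewrite /=; ring.
Qed.

Let levy_mean_lin f g c : admissible f -> admissible g ->
  levy_mean (fun z => f z + c * g z) = levy_mean f + c * levy_mean g.
Proof.
move=> af ag; rewrite /levy_mean.
under eq_Rintegral do rewrite wt_lin.
have i1 := int_nu af; have i2 := int_nu ag.
rewrite (RintegralD mJ i1 (int_scale c i2)) (RintegralZl _ mJ i2); ring.
Qed.

Let converges_lin f g c : converges f -> converges g ->
  converges (fun z => f z + c * g z).
Proof.
move=> [af cf] [ag cg]; split; first exact: admissible_lin.
rewrite levy_mean_lin//.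
have h : small_time_mean f x + c * small_time_mean g x @[x --> 0^'+] -->
    levy_mean f + c * levy_mean g.
  by apply: cvgD => //; apply: cvgM => //; exact: cvg_cst.
apply: cvg_trans h; apply: near_eq_cvg; near=> x.
by rewrite small_time_mean_lin.
Unshelve. all: by end_near. Qed.

Let psi0 : psi 0 = 0.
Proof.
rewrite /laplace_exponent mulr0 add0r.
under eq_Rintegral do rewrite mul0r oppr0 expR0 subrr.
by rewrite Rintegral_cst// mul0r.
Qed.

Let moment_int x s : 0 <= x -> 0 <= s ->
  P.-integrable setT (EFin \o (fun w => expR (- (s * D x w)))).
Proof.
move=> x0 s0; apply: (integrable_le_norm _ (integrable_cstR P 1)).
  apply: measurableT_comp => //; apply: measurableT_comp => //.
  exact: measurable_funM.
by move=> w; rewrite ger0_norm ?expR_ge0// expR_le1 oppr_le0 mulr_ge0// subordinator_ge0.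
Qed.

(** The value s = 0 is included because the monomial z^0 leads to the exponents 0 and 1. *)
Lemma subordinator_laplace0 x s : 0 <= x -> 0 <= s ->
  \int[P]_w expR (- (s * D x w)) = expR (- (x * psi s)).
Proof.
move=> x0; rewrite le_eqVlt => /predU1P[<-|s0].
  rewrite psi0 mulr0 oppr0 expR0.
  by under eq_Rintegral do rewrite mul0r oppr0 expR0; rewrite Rintegral_cstT.
by have := subordinator_laplace hD x0 s0; rewrite unlock /Rintegral => ->.
Qed.

Let admissible_monomial j : admissible (fun z => z ^+ j).
Proof.
split; first exact: measurable_funX.
exists 1 => z /andP[z0 z1]; rewrite normrX exprn_ile1//.
by rewrite ger0_norm.
Qed.

(** First order expansion of both exponentials, each remainder lying between 0 and the square of its
    argument. *)
Let exp_diff_quotient (u v x : R) : 0 <= u -> 0 <= v -> 0 < x ->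
  `|(v - u) - x^-1 * (expR (- (x * u)) - expR (- (x * v)))| <= x * (u ^+ 2 + v ^+ 2).
Proof.
move=> u0 v0 x0.
have h (y : R) : 0 <= y -> 0 <= expR (- y) - (1 - y) <= y ^+ 2.
  move=> y0; rewrite subr_ge0 expR_ge1Dx/=.
  have := expR_ge1Dx y; have := expR_gt0 (- y).
  have : expR y * expR (- y) = 1 by rewrite expRxMexpNx_1.
  set p := expR y; set q := expR (- y) => pq q0 py.
  have : (1 + y) * q <= p * q by rewrite ler_pM2r.
  rewrite pq.
  have : 0 <= y ^+ 3 by rewrite exprn_ge0.
  rewrite exprS => y3 yq.
  have : (1 + y) * (q - (1 - y)) <= y ^+ 2 by lra.
  have : 0 <= q - (1 - y) by rewrite subr_ge0 expR_ge1Dx.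
  nra.
have /andP[u1 u2] := h (x * u) (mulr_ge0 (ltW x0) u0).
have /andP[v1 v2] := h (x * v) (mulr_ge0 (ltW x0) v0).
have -> : v - u - x^-1 * (expR (- (x * u)) - expR (- (x * v))) =
   x^-1 * ((expR (- (x * v)) - (1 - x * v)) - (expR (- (x * u)) - (1 - x * u))).
  by field; rewrite gt_eqF.
rewrite normrM gtr0_norm ?invr_gt0// ler_pdivrMl//.
have xu : 0 <= (x * u) ^+ 2 by exact: sqr_ge0.
have xv : 0 <= (x * v) ^+ 2 by exact: sqr_ge0.
have -> : x * (x * (u ^+ 2 + v ^+ 2)) = (x * u) ^+ 2 + (x * v) ^+ 2 by ring.
rewrite ler_norml; apply/andP; split; lra.
Qed.

Let psi_ge0 s : 0 <= s -> 0 <= psi s.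
Proof.
move=> s0; rewrite addr_ge0 ?mulr_ge0//; apply: Rintegral_ge0 => y.
rewrite /J/= in_itv/= andbT => y0.
by have /andP[] := one_sub_exp_le s0 y0.
Qed.

(** The weight 1 - z turns z^j into e^(-j y) - e^(-(j + 1) y), so the small-time mean is a
    difference quotient of two Laplace transforms, with limit psi (j + 1) - psi j. *)
Let converges_monomial j : converges (fun z => z ^+ j).
Proof.
split; first exact: admissible_monomial.
have wtE y : wt (fun z => z ^+ j) y = expR (- (j%:R * y)) - expR (- (j.+1%:R * y)).
  rewrite /wt -expRM_natl mulrBr mulr1 -expRD -(natr1 j).
  by congr (expR _ - expR _); ring.
have -> : levy_mean (fun z => z ^+ j) = psi j.+1%:R - psi j%:R.
  rewrite /levy_mean expr1n /laplace_exponent.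
  have -> : b * j.+1%:R = b * j%:R + b by rewrite -natr1; ring.
  rewrite opprD addrACA [_ - b * _]addrC addKr mulr1; congr (_ + _).
  rewrite -RintegralB//; [|exact: int_one_sub_exp|exact: int_one_sub_exp].
  by apply: eq_Rintegral => y _; rewrite wtE; ring.
have smE x : 0 <= x -> small_time_mean (fun z => z ^+ j) x =
    x^-1 * (expR (- (x * psi j%:R)) - expR (- (x * psi j.+1%:R))).
  move=> x0; rewrite /small_time_mean; congr (_ * _).
  under eq_Rintegral do rewrite wtE.
  by rewrite RintegralB// ?subordinator_laplace0//; exact: moment_int.
pose L := psi j%:R ^+ 2 + psi j.+1%:R ^+ 2 + 1.
have L0 : 0 < L by rewrite /L ltr_pwDr// addr_ge0// sqr_ge0.
apply/cvgrPdist_le => e e0; near=> x.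
have x0 : 0 < x by [].
rewrite (smE x (ltW x0)).
apply: (le_trans (exp_diff_quotient (psi_ge0 (ler0n _ j)) (psi_ge0 (ler0n _ j.+1)) x0)).
apply: (@le_trans _ _ (x * L)); first by rewrite ler_wpM2l ?(ltW x0)// /L lerDl.
rewrite -ler_pdivlMr//; near: x; apply: nbhs_right_le; exact: divr_gt0.
Unshelve. all: by end_near. Qed.

(* The factor z ^+ j makes the statement stable under de Casteljau's recursion. *)
Let converges_bernstein n g j : converges (fun z => z ^+ j * bernstein n g z).
Proof.
elim: n g j => [|n IH] g j /=.
  rewrite (_ : (fun _ => _) = (fun z => z ^+ j + (g 0%N - 1) * z ^+ j)).
    exact: converges_lin (converges_monomial j) (converges_monomial j).
  by apply/funext => z; ring.
rewrite (_ : (fun _ => _) = (fun z => (z ^+ j * bernstein n g z +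
    -1 * (z ^+ j.+1 * bernstein n g z)) +
    1 * (z ^+ j.+1 * bernstein n (fun k => g k.+1) z))).
  by apply: converges_lin => //; exact: converges_lin.
by apply/funext => z; rewrite exprS; ring.
Qed.

Let wt_le f g y : 0 <= y -> (forall z, 0 <= z <= 1 -> f z <= g z) -> wt f y <= wt g y.
Proof.
move=> y0 fg; have h := exp01 y0; rewrite ler_wpM2r ?fg//.
by rewrite subr_ge0; case/andP : h.
Qed.

Let small_time_mean_le f g x : 0 <= x -> admissible f -> admissible g ->
  (forall z, 0 <= z <= 1 -> f z <= g z) -> small_time_mean f x <= small_time_mean g x.
Proof.
move=> x0 af ag fg; rewrite ler_wpM2l ?invr_ge0//.
apply: le_Rintegral => //; [exact: int_P|exact: int_P|].
by move=> w _; apply: wt_le => //; exact: subordinator_ge0.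
Qed.

Let levy_mean_le f g : admissible f -> admissible g ->
  (forall z, 0 <= z <= 1 -> f z <= g z) -> levy_mean f <= levy_mean g.
Proof.
move=> af ag fg; rewrite lerD//.
  by rewrite ler_wpM2l// fg// ler01 lexx.
apply: le_Rintegral => //; [exact: int_nu|exact: int_nu|].
by move=> y; rewrite /J/= in_itv/= andbT => y0; apply: wt_le => //; exact: ltW.
Qed.

(** Both functionals are linear and monotone, so a uniform error t on [0, 1] costs t times their
    value at the constant 1; polynomials are settled by [converges_bernstein]. *)
Lemma small_time_mean_cvg (f : R -> R) (L : R) : measurable_fun setT f -> 0 <= L ->
  (forall x y, `|f x - f y| <= L * `|x - y|) ->
  small_time_mean f x @[x --> 0^'+] --> levy_mean f.
Proof.
move=> mf L0 fL.
have af : admissible f.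
  split => //; exists (`|f 0| + L) => z /andP[z0 z1].
  have -> : f z = f 0 + (f z - f 0) by ring.
  rewrite (le_trans (ler_normD _ _))// lerD2l (le_trans (fL _ _))//.
  by rewrite subr0 ger0_norm// ler_piMr.
have [a1 c1] := converges_monomial 0.
pose one (z : R) := z ^+ 0; rewrite -/one in a1 c1.
pose q := levy_mean one.
have q0 : 0 <= q.
  rewrite addr_ge0 ?mulr_ge0//.
  apply: Rintegral_ge0 => y; rewrite /J/= in_itv/= andbT => y0.
  rewrite mulr_ge0// subr_ge0; by have /andP[] := exp01 (ltW y0).
apply/cvgrPdist_le => e e0.
(* The approximation costs t q in the limit and at most t (q + 1) in the small-time mean near 0; the
   polynomial itself takes the other e / 2. *)
have [t t0 tE] : exists2 t, 0 < t & t * (2 * q + 1) = e / 2.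
  have q1 : 0 < 2 * q + 1 by rewrite ltr_wpDl// mulr_ge0.
  exists (e / 2 / (2 * q + 1)); first by rewrite !divr_gt0.
  by rewrite divfK// gt_eqF.
have [n [g hg]] := lipschitz_bernstein_approx t0 L0 fL.
have [ap cp] := converges_bernstein n g 0.
pose p z := z ^+ 0 * bernstein n g z; rewrite -/p in ap cp.
have pf z : 0 <= z <= 1 -> p z + - t * one z <= f z <= p z + t * one z.
  move=> /hg; rewrite /p /one expr0 mul1r !mulr1 ler_norml => /andP[? ?].
  by apply/andP; split; lra.
have up := admissible_lin t ap a1; have lo := admissible_lin (- t) ap a1.
have lev1 : levy_mean p - t * q <= levy_mean f.
  by rewrite -mulNr -levy_mean_lin//; apply: levy_mean_le => // z /pf /andP[].
have lev2 : levy_mean f <= levy_mean p + t * q.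
  by rewrite -levy_mean_lin//; apply: levy_mean_le => // z /pf /andP[].
have e20 : 0 < e / 2 by rewrite divr_gt0.
move/cvgrPdist_le : cp => /(_ _ e20) cp.
move/cvgrPdist_le : c1 => /(_ _ ltr01) c1.
near=> x.
have x0 : 0 <= x by apply: ltW.
have h1 : `|levy_mean p - small_time_mean p x| <= e / 2 by near: x.
have h2 : `|levy_mean one - small_time_mean one x| <= 1 by near: x.
have sm1 : small_time_mean p x - t * small_time_mean one x <= small_time_mean f x.
  by rewrite -mulNr -small_time_mean_lin//; apply: small_time_mean_le => // z /pf /andP[].
have sm2 : small_time_mean f x <= small_time_mean p x + t * small_time_mean one x.
  by rewrite -small_time_mean_lin//; apply: small_time_mean_le => // z /pf /andP[].
have sm3 : t * small_time_mean one x <= t * (q + 1).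
  rewrite ler_wpM2l ?(ltW t0)//; move: h2; rewrite ler_norml /q => /andP[? ?]; lra.
move: h1; rewrite !ler_norml => /andP[? ?]; apply/andP; split; lra.
Unshelve. all: by end_near. Qed.

Let tail_int (T : R) : 0 < T ->
  nu.-integrable J (EFin \o \1_(`]T, +oo[ : set (measurableTypeR R))).
Proof.
move=> T0; have m0 : 0 < Num.min T 1 by rewrite lt_min T0 ltr01.
apply: (integrable_le_norm_in _ (int_scale (Num.min T 1)^-1 int_min)).
  by apply: measurable_indic; exact: measurable_itv.
move=> y y0; rewrite indicE; have ym : 0 <= Num.min y 1 by rewrite le_min (ltW y0) ler01.
case: (boolP (y \in _)); last by rewrite normr0 mulr_ge0// invr_ge0 ltW.
rewrite inE/= in_itv/= andbT => Ty; rewrite normr1 ler_pdivlMl// mulr1.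
by rewrite le_min !ge_min (ltW Ty) lexx orbT.
Qed.

Let tail_Rintegral (T : R) (c : bool) : 0 < T ->
  \int[nu]_(y in J) \1_[set` Interval (BSide c T) +oo%O] y =
  fine (nu [set` Interval (BSide c T) +oo%O]).
Proof.
move=> T0; rewrite /Rintegral integral_indic//.
rewrite setIidl// => y; rewrite /J/= !in_itv/= !andbT.
by case: c => /= Ty; [exact: lt_le_trans T0 Ty|exact: lt_trans T0 Ty].
Qed.

Lemma levy_tail_fin (T : R) : 0 < T -> (nu `]T, +oo[%classic < +oo)%E.
Proof.
move=> T0; have /integrableP[_] := tail_int T0.
under eq_integral do rewrite /= ger0_norm//.
rewrite integral_indic//.
rewrite setIidl// => y; rewrite /J/= !in_itv/= !andbT => Ty; exact: lt_trans T0 Ty.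
Qed.


(** Only the jumps above [eta] are kept, where 1 - e^(-s y) is at least 1 - e^(-s eta). *)
Lemma laplace_exponent_ge (s eta : R) : 0 <= s -> 0 < eta ->
  (1 - expR (- (s * eta))) * fine (nu `]eta, +oo[%classic) <= psi s.
Proof.
move=> s0 eta0; rewrite -tail_Rintegral// -RintegralZl//; last exact: tail_int.
rewrite /laplace_exponent -[leLHS]add0r lerD ?mulr_ge0//.
apply: le_Rintegral => //; first exact: int_scale (tail_int eta0).
  exact: int_one_sub_exp.
move=> y; rewrite /J/= in_itv/= andbT => y0.
have /andP[h0 _] := one_sub_exp_le s0 y0.
rewrite indicE; case: (boolP (y \in _)) => [|_]; last by rewrite mulr0.
rewrite inE/= in_itv/= andbT => /ltW ey.
by rewrite mulr1 lerD2l lerN2 ler_expR lerN2 ler_wpM2l.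
Qed.

Variables T1 T2 : R.
Hypothesis T10 : 0 < T1.
Hypothesis T12 : T1 < T2.

(** The map y -> e^-y reverses the order, so [T2] gives the lower end of the ramp, and [wt r] lies
    between the indicators of [T2, oo[ and ]T1, oo[. *)
Let a' := expR (- T2).
Let a := expR (- T1).

Let a'a : a' < a. Proof. by rewrite ltr_expR ltrN2. Qed.

Let a1 : a < 1. Proof. by rewrite expR_lt1 oppr_lt0. Qed.

Let r := ramp a' a.

Let r_cvg : small_time_mean r x @[x --> 0^'+] --> levy_mean r.
Proof.
have m := measurable_ramp a'a a1.
have L0 : 0 <= (a - a')^-1 / (1 - a) + (1 - a)^-1 ^+ 2.
  by rewrite addr_ge0 ?sqr_ge0// divr_ge0 ?invr_ge0 ?subr_ge0 ?(ltW a'a) ?(ltW a1).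
exact: (small_time_mean_cvg m L0 (ramp_lipschitz a'a a1)).
Qed.

Let r_adm : admissible r.
Proof.
split; first exact: (measurable_ramp a'a a1).
exists (1 - a)^-1 => z _; rewrite ger0_norm; first exact: ramp_le.
exact: ramp_ge0.
Qed.

Let wt_r_le y : 0 <= y -> wt r y <= \1_(`]T1, +oo[%classic) y.
Proof.
move=> y0; rewrite indicE; case: (boolP (y \in _)) => [_|].
  by apply: ramp_mul_le1 => //; case/andP : (exp01 y0).
rewrite notin_setE/= in_itv/= andbT => /negP; rewrite -leNgt => yT.
by rewrite /wt /r ramp_eq0 ?mul0r// ler_expR lerN2.
Qed.

Let wt_r_ge y : 0 <= y -> \1_(`[T2, +oo[%classic) y <= wt r y.
Proof.
move=> y0; rewrite indicE; case: (boolP (y \in _)) => [|_].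
  rewrite inE/= in_itv/= andbT => yT.
  by rewrite /wt /r ramp_mul_eq1// ler_expR lerN2.
rewrite /wt mulr_ge0//; first exact: ramp_ge0.
by rewrite subr_ge0; case/andP : (exp01 y0).
Qed.

Let indic_int (c : bool) (T : R) : 0 < T ->
  nu.-integrable J (EFin \o \1_([set` Interval (BSide c T) +oo%O] : set (measurableTypeR R))).
Proof.
move=> T0; have T2' : 0 < T / 2 by rewrite divr_gt0.
apply: (integrable_le_norm_in _ (tail_int T2')).
  by apply: measurable_indic; exact: measurable_itv.
move=> y y0; rewrite !indicE ger0_norm// ler_nat.
case: (boolP (y \in [set` Interval (BSide c T) _])) => // yT.
rewrite (_ : y \in _ = true)//; apply/mem_set; move: yT.
rewrite inE/= !in_itv/= !andbT; case: c => /=; lra.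
Qed.

Let levy_mean_r : fine (nu `[T2, +oo[%classic) <= levy_mean r <= fine (nu `]T1, +oo[%classic).
Proof.
have T20 : 0 < T2 by exact: lt_trans T12.
have r1 : r 1 = 0 by exact: ramp1.
rewrite /levy_mean r1 mulr0 add0r -!tail_Rintegral//; apply/andP; split.
- apply: le_Rintegral => //; [exact: indic_int|exact: int_nu|].
  by move=> y; rewrite /J/= in_itv/= andbT => /ltW/wt_r_ge.
- apply: le_Rintegral => //; [exact: int_nu|exact: indic_int|].
  by move=> y; rewrite /J/= in_itv/= andbT => /ltW/wt_r_le.
Qed.

Let indicP (x : R) (A : set R) : measurable A ->
  \int[P]_w (\1_A (D x w)) = fine (P (D x @^-1` A)).
Proof.
move=> mA; have mDA : measurable (D x @^-1` A).
  by rewrite -[_ @^-1` _]setTI; exact: measurable_funPT.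
by rewrite /Rintegral -[in RHS](setIT (D x @^-1` A)) -integral_indic.
Qed.

Let indicP_int (x : R) (A : set R) : measurable A ->
  P.-integrable setT (EFin \o (\1_A \o D x : Omega -> R)).
Proof.
move=> mA; apply: (integrable_le_norm _ (integrable_cstR P 1)).
  by apply: measurableT_comp => //; exact: measurable_indic.
by move=> w; rewrite /= ger0_norm indicE// lern1 leq_b1.
Qed.

(** Half of a portmanteau argument: P(D x >= T2) is at most the mean of [wt r], whose limit after
    division by x is at most nu ]T1, oo[. *)
Lemma subordinator_tail_le (k : R) : 0 < k -> \forall x \near 0^'+,
  fine (P [set w | T2 <= D x w]) <= x * (fine (nu `]T1, +oo[%classic) + k).
Proof.
move=> k0; move/cvgrPdist_le : r_cvg => /(_ _ k0) c1.
near=> x; have x0 : 0 < x by [].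
have : `|levy_mean r - small_time_mean r x| <= k by near: x.
rewrite ler_norml => /andP[h1 h2].
have /andP[h3 h4] := levy_mean_r.
have mT : measurable (`[T2, +oo[%classic : set R) by exact: measurable_itv.
have -> : [set w | T2 <= D x w] = D x @^-1` `[T2, +oo[.
  by apply/seteqP; split => w; rewrite /= in_itv/= andbT.
rewrite -indicP// (@le_trans _ _ (x * small_time_mean r x))//.
  rewrite /small_time_mean mulrA divff ?mul1r ?gt_eqF//.
  apply: le_Rintegral => //; [exact: indicP_int|by apply: int_P => //; exact: ltW|].
  by move=> w _; apply: wt_r_ge; apply: subordinator_ge0; exact: ltW.
rewrite ler_pM2l//; lra.
Unshelve. all: by end_near. Qed.

Lemma subordinator_tail_ge (k : R) : 0 < k -> \forall x \near 0^'+,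
  x * (fine (nu `[T2, +oo[%classic) - k) <= fine (P [set w | T1 < D x w]).
Proof.
move=> k0; move/cvgrPdist_le : r_cvg => /(_ _ k0) c1.
near=> x; have x0 : 0 < x by [].
have : `|levy_mean r - small_time_mean r x| <= k by near: x.
rewrite ler_norml => /andP[h1 h2].
have /andP[h3 h4] := levy_mean_r.
have mT : measurable (`]T1, +oo[%classic : set R) by exact: measurable_itv.
have -> : [set w | T1 < D x w] = D x @^-1` `]T1, +oo[.
  by apply/seteqP; split => w; rewrite /= in_itv/= andbT.
rewrite -indicP// (@le_trans _ _ (x * small_time_mean r x))//.
  by rewrite ler_pM2l//; lra.
rewrite /small_time_mean mulrA divff ?mul1r ?gt_eqF//.
apply: le_Rintegral => //; [by apply: int_P => //; exact: ltW|exact: indicP_int|].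
by move=> w _; apply: wt_r_le; apply: subordinator_ge0; exact: ltW.
Unshelve. all: by end_near. Qed.

End subordinator_small_time.

(** * Strict increase and divergence of the paths of a subordinator *)

Section subordinator_paths.
Context d (Omega : measurableType d) (R : realType) (P : probability Omega R).
Variables (b : R) (nu : {measure set (measurableTypeR R) -> \bar R}).
Variable D : R -> {RV P >-> R}.
Hypothesis hD : subordinator b nu D.
Hypothesis hnu : nu `]0%R, +oo[%classic = +oo%E.

Local Notation psi := (laplace_exponent b nu).

Lemma levy_tail_unbounded (M : R) : exists2 eta, 0 < eta & M <= fine (nu `]eta, +oo[%classic).
Proof.
pose F (n : nat) : set (measurableTypeR R) := `](n.+1%:R^-1)%R, +oo[%classic.
have FU : \bigcup_n F n = `]0%R, +oo[%classic.
  apply/seteqP; split=> [y [n _]|y]; rewrite /F/= !in_itv/= !andbT => y0.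
    by rewrite (lt_trans _ y0).
  exists (Num.truncn y^-1) => //=; rewrite in_itv/= andbT.
  by rewrite -[ltRHS]invrK ltf_pV2 ?posrE ?invr_gt0// truncnS_gt.
have : nu \o F @ \oo --> nu (\bigcup_n F n).
  apply: nondecreasing_cvg_mu.
  - by move=> n; exact: measurable_itv.
  - by rewrite FU; exact: measurable_itv.
  - move=> m n mn; apply/subsetPset => y; rewrite /F/= !in_itv/= !andbT.
    by apply: le_lt_trans; rewrite lef_pV2 ?posrE// ler_nat.
rewrite FU hnu => /cvgey_ge /(_ M) [n _ /(_ n (leqnn n)) /= hn].
have n0 : 0 < n.+1%:R^-1 :> R by [].
exists n.+1%:R^-1 => //; rewrite -lee_fin fineK//.
by rewrite ge0_fin_numE// (levy_tail_fin hD).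
Qed.

Lemma laplace_exponent_unbounded (M : R) : exists2 s, 0 < s & M <= psi s.
Proof.
have q0 : 0 < 1 - expR (- 1) :> R by rewrite subr_gt0 expR_lt1 oppr_lt0.
have [eta eta0 hM] := levy_tail_unbounded (M / (1 - expR (- 1))).
(* At s = 1 / eta the factor 1 - e^(-s eta) is the constant 1 - e^-1. *)
exists eta^-1; first by rewrite invr_gt0.
have h := laplace_exponent_ge hD (_ : 0 <= eta^-1) eta0.
rewrite mulVf ?gt_eqF// in h; rewrite (le_trans _ (h _)) ?invr_ge0 ?(ltW eta0)//.
by rewrite mulrC -ler_pdivrMr.
Qed.

Lemma laplace_exponent1_gt0 : 0 < psi 1.
Proof.
have [eta eta0 hM] := levy_tail_unbounded 1.
apply: lt_le_trans (laplace_exponent_ge hD ler01 eta0).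
rewrite mulr_gt0 ?(lt_le_trans _ hM)// subr_gt0 expR_lt1 oppr_lt0.
by rewrite mul1r.
Qed.

Let mD x (A : set R) : measurable A -> measurable (D x @^-1` A).
Proof. by move=> mA; rewrite -[_ @^-1` _]setTI; exact: measurable_funPT. Qed.

(** Markov's inequality for e^(-s D x). *)
Lemma subordinator_le_prob x s M : 0 <= x -> 0 < s ->
  (P [set w | (D x w <= M)%R] <= (expR (s * M - x * psi s))%:E)%E.
Proof.
move=> x0 s0; have -> : [set w | D x w <= M] = D x @^-1` `]-oo, M].
  by apply/seteqP; split => w; rewrite /= in_itv.
have mA : measurable (D x @^-1` `]-oo, M]) by apply: mD; exact: measurable_itv.
rewrite -[X in P X]setIT -integral_indic//.
apply: (@le_trans _ _ (\int[P]_w (expR (s * M) * expR (- (s * D x w)))%:E)%E).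
  apply: ge0_le_integral => //.
  - by apply/measurable_EFinP; exact: measurable_indic.
  - apply/measurable_EFinP; apply: measurable_funM => //.
    apply: measurableT_comp => //; apply: measurableT_comp => //.
    exact: measurable_funM.
  - move=> w _; rewrite lee_fin indicE -expRD; case: (boolP (w \in _)) => [|_]; last exact: expR_ge0.
    rewrite inE/= in_itv/= => DM; rewrite -[leLHS]expR0 ler_expR.
    by rewrite -mulrBr mulr_ge0 ?subr_ge0// ltW.
under eq_integral do rewrite EFinM.
have mexp : measurable_fun setT (fun w => (expR (- (s * D x w)))%:E).
  apply/measurable_EFinP; apply: measurableT_comp => //; apply: measurableT_comp => //.
  exact: measurable_funM.
rewrite (ge0_integralZl P measurableT mexp); last 2 first.
- by move=> w _; rewrite lee_fin expR_ge0.
- by rewrite lee_fin expR_ge0.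
have := subordinator_laplace hD x0 s0; rewrite unlock => ->.
by rewrite -EFinM -expRD.
Qed.

(** The infinite Levy measure enters here: [psi] is unbounded, so the choice of s makes e^(-h psi s)
    arbitrarily small. *)
Lemma subordinator_zero_prob h : 0 < h -> P [set w | (D h w <= 0)%R] = 0%E.
Proof.
move=> h0; apply/eqP; rewrite eq_le measure_ge0 andbT.
apply/lee_addgt0Pr => e e0; rewrite add0e.
have [s s0 hs] := laplace_exponent_unbounded (e^-1 / h).
apply: (le_trans (subordinator_le_prob 0 (ltW h0) s0)).
rewrite lee_fin mulr0 add0r.
have : e^-1 <= h * psi s by rewrite mulrC -ler_pdivrMr.
set y := h * psi s => ey.
have y0 : 0 < y by rewrite (lt_le_trans _ ey)// invr_gt0.
rewrite expRN -[leRHS]invrK lef_pV2 ?posrE ?expR_gt0 ?invr_gt0//.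
by rewrite (le_trans ey)// (le_trans _ (expR_ge1Dx y))// lerDr.
Qed.

Lemma subordinator_bounded_prob M :
  P.-negligible [set w | forall n : nat, D n%:R w <= M].
Proof.
have p0 := laplace_exponent1_gt0.
pose A := \bigcap_(n : nat) (D n%:R @^-1` `]-oo, M]).
have mA : measurable A.
  by apply: bigcapT_measurable => n; by apply: mD; exact: measurable_itv.
exists A; split => //; last first.
  by move=> w h n _; rewrite /= in_itv/=; exact: h.
apply/eqP; rewrite eq_le measure_ge0 andbT.
apply/lee_addgt0Pr => e e0; rewrite add0e.
pose n := (Num.truncn ((M + e^-1) / psi 1)).+1.
apply: (@le_trans _ _ (P [set w | D n%:R w <= M])).
  apply: le_measure; rewrite ?inE//.
    rewrite (_ : [set _ | _] = D n%:R @^-1` `]-oo, M]); first by apply: mD; exact: measurable_itv.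
    by apply/seteqP; split => w; rewrite /= in_itv.
  by move=> w /(_ n I); rewrite /= in_itv.
apply: (le_trans (subordinator_le_prob M (ler0n _ n) ltr01)).
rewrite lee_fin mul1r.
have : (M + e^-1) / psi 1 < n%:R by exact: truncnS_gt.
rewrite ltr_pdivrMr// => hn.
have : e^-1 <= n%:R * psi 1 - M by lra.
rewrite -[M - _]opprB; set y := _ - M => ey.
have y0 : 0 < y by rewrite (lt_le_trans _ ey)// invr_gt0.
rewrite expRN -[leRHS]invrK lef_pV2 ?posrE ?expR_gt0 ?invr_gt0//.
by rewrite (le_trans ey)// (le_trans _ (expR_ge1Dx y))// lerDr.
Qed.

(** Strict increase makes [E] invert [D] along the path; unboundedness keeps the set defining [E]
    nonempty, so that its infimum is genuine. *)
Definition regular_path (w : Omega) : Prop :=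
  (forall u v, 0 <= u -> u < v -> D u w < D v w) /\
  (forall M, exists n : nat, M < D n%:R w).

(** Strict increase reduces to countably many events, one per cell [i / (n + 1), (i + 1) / (n + 1)].
    By stationarity each increment has the law of D (1 / (n + 1)), almost surely positive;
    monotonicity carries this to arbitrary u < v. *)
Lemma regular_path_ae : P.-negligible (~` regular_path).
Proof.
pose N1 (n i : nat) := [set w | D (i.+1%:R / n.+1%:R) w <= D (i%:R / n.+1%:R) w].
pose N2 (n : nat) := [set w | forall m : nat, D m%:R w <= n%:R].
have nN1 n i : P.-negligible (N1 n i).
  have mN : measurable (N1 n i).
    rewrite (_ : N1 n i = (fun w => D (i.+1%:R / n.+1%:R) w - D (i%:R / n.+1%:R) w) @^-1` `]-oo, 0]).
      rewrite -[_ @^-1` _]setTI; apply: (measurable_funB (measurable_funP _) (measurable_funP _)) => //.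
    by apply/seteqP; split => w; rewrite /N1/= in_itv/= subr_le0.
  apply/negligibleP => //.
  have m0 : measurable (`]-oo, 0] : set (measurableTypeR R)) by exact: measurable_itv.
  have h0 : 0 < n.+1%:R^-1 :> R by [].
  have i0 : 0 <= i%:R / n.+1%:R :> R by rewrite divr_ge0.
  have h := levy_stationary (subordinator_levy hD) i0 (ltW h0) m0.
  have E1 : i.+1%:R / n.+1%:R = i%:R / n.+1%:R + n.+1%:R^-1 :> R.
    by rewrite -[i.+1%:R]natr1 mulrDl mul1r.
  rewrite (_ : N1 n i = (fun w => D (i%:R / n.+1%:R + n.+1%:R^-1) w - D (i%:R / n.+1%:R) w) @^-1` `]-oo, 0]); last first.
    by apply/seteqP; split => w; rewrite /N1 E1/= in_itv/= subr_le0.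
  rewrite [LHS]h.
  rewrite (_ : _ @^-1` _ = [set w | D n.+1%:R^-1 w <= 0]).
    exact: subordinator_zero_prob.
  by apply/seteqP; split => w; rewrite /= in_itv.
have nN2 n : P.-negligible (N2 n) by exact: subordinator_bounded_prob.
have := negligibleU (negligible_bigcup (fun n => negligible_bigcup (nN1 n))) (negligible_bigcup nN2).
apply: negligibleS => w; apply: contra_notP.
move=> /not_orP[h1 h2]; split.
- move=> u v u0 uv.
  (* Cells shorter than half of v - u, so that one of them fits between u and v. *)
  pose n := Num.truncn (2 / (v - u)).
  pose i := (Num.truncn (u * n.+1%:R)).+1.
  have vu : 0 < v - u by rewrite subr_gt0.
  have n0 : 0 < n.+1%:R :> R by [].
  have hn : 2 < (v - u) * n.+1%:R.
    by rewrite mulrC -ltr_pdivrMr// truncnS_gt.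
  have un0 : 0 <= u * n.+1%:R by rewrite mulr_ge0.
  have i1 : u <= i%:R / n.+1%:R.
    by rewrite ler_pdivlMr// ltW// truncnS_gt //.
  have i2 : i.+1%:R / n.+1%:R <= v.
    have : (Num.truncn (u * n.+1%:R))%:R <= u * n.+1%:R by rewrite Num.Theory.truncn_le.
    rewrite ler_pdivrMr// /i -natr1 -[_.+1%:R]natr1; lra.
  have h3 : D (i%:R / n.+1%:R) w < D (i.+1%:R / n.+1%:R) w.
    rewrite ltNge; apply/negP => h; apply: h1; exists n => //; exists i => //.
  apply: le_lt_trans (lt_le_trans h3 _).
    exact: (subordinator_nondecreasing hD).
  by apply: (subordinator_nondecreasing hD) => //; rewrite divr_ge0.
- move=> M; apply: contrapT => h; apply: h2; exists (Num.truncn `|M|).+1 => // m.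
  have : D m%:R w <= M by rewrite leNgt; apply/negP => h'; apply: h; exists m.
  move/le_trans; apply; rewrite (le_trans (ler_norm M))// ltW// truncnS_gt //.
Qed.

End subordinator_paths.

(** * Paths of the inverse process *)

Section inverse_process_paths.
Context d (Omega : measurableType d) (R : realType) (P : probability Omega R).
Variables (b : R) (nu : {measure set (measurableTypeR R) -> \bar R}).
Variable D : R -> {RV P >-> R}.
Hypothesis hD : subordinator b nu D.
Hypothesis hnu : nu `]0%R, +oo[%classic = +oo%E.

Local Notation E := (inverse_process D).

Let above t w : set R := [set u | 0 < u /\ t < D u w].

Let above_lbound t w : lbound (above t w) 0.
Proof. by move=> u [u0 _]; exact: ltW. Qed.

Let above_has_lbound t w : has_lbound (above t w).
Proof. by exists 0; exact: above_lbound. Qed.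

Lemma inverse_process_ge0 t w : 0 <= E t w.
Proof.
rewrite /inverse_process -/(above t w).
have [->|/set0P n0] := eqVneq (above t w) set0; first by rewrite inf0.
exact: lb_le_inf.
Qed.

Lemma inverse_process_le t w u : 0 < u -> t < D u w -> E t w <= u.
Proof. by move=> u0 tu; apply: ge_inf => //; exact: above_has_lbound. Qed.

Lemma inverse_process_lt t w a : above t w !=set0 -> E t w < a ->
  exists u, [/\ 0 < u, u < a & t < D u w].
Proof.
move=> n0 Ea; have ea : 0 < a - E t w by rewrite subr_gt0.
have [u [u0 tu] ua] := inf_adherent ea (conj n0 (above_has_lbound t w)).
by exists u; split => //; rewrite addrCA subrr addr0 in ua.
Qed.

Let D0 w : D 0 w = 0 := levy_start (subordinator_levy hD) w.
Let D_mono w s t : 0 <= s -> s <= t -> D s w <= D t w :=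
  @subordinator_nondecreasing _ _ _ _ _ _ _ hD w s t.

(** If D u > t then E s <= u for all s < D u; if D never exceeds t, then E is inf set0 = 0 from t
    on. Holding on every path, this serves the measurability of the small ball event. *)
Lemma inverse_process_right_continuous t w (e : R) : 0 < e ->
  exists2 t', t < t' & forall s, t <= s -> s < t' -> `|E s w - E t w| < e.
Proof.
move=> e0; have [at0|/set0P n0] := eqVneq (above t w) set0.
  exists (t + 1); first by rewrite ltrDl.
  move=> s ts _; suff as0 : above s w = set0.
    by rewrite /inverse_process -/(above s w) -/(above t w) as0 at0 subrr normr0.
  apply/seteqP; split => // u [u0 su].
  by have : set0 u by rewrite -at0; split => //; exact: le_lt_trans su.
have hE : E t w < E t w + e by rewrite ltrDl.
have [u [u0 ue tu]] := inverse_process_lt n0 hE.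
exists (D u w) => // s ts su.
have h1 : E s w <= u by exact: inverse_process_le.
have h2 : E t w <= E s w.
  apply: lb_le_inf; first by exists u.
  by move=> v [v0 sv]; apply: inverse_process_le => //; exact: le_lt_trans sv.
rewrite ger0_norm ?subr_ge0//; lra.
Qed.

Let measurable_D_gt t x : measurable [set w | t < D x w].
Proof.
rewrite (_ : [set _ | _] = D x @^-1` `]t, +oo[).
  by rewrite -[_ @^-1` _]setTI; apply: measurable_funPT => //; exact: measurable_itv.
by apply/seteqP; split => w; rewrite /= in_itv/= andbT.
Qed.

Let measurable_D_le t x : measurable [set w | D x w <= t].
Proof.
rewrite (_ : [set _ | _] = ~` [set w | t < D x w]); first exact: measurableC.
by apply/seteqP; split => w /=; rewrite leNgt => /negP.
Qed.

Lemma measurable_inverse_process t : 0 <= t -> measurable_fun setT (E t).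
Proof.
move=> t0 mT; apply: (measurability _ (RGenInftyO.measurableE R)) => //.
move=> _ [_ [a ->] <-]; rewrite setTI.
have [a0|a0] := leP a 0.
  rewrite (_ : _ @^-1` _ = set0)//; apply/seteqP; split => // w /=.
  by rewrite in_itv/= => h; have := inverse_process_ge0 t w; rewrite leNgt (lt_le_trans h a0).
(* Paths that never exceed t have E = inf set0 = 0 < a; they form the last intersection, taken over
   integers by monotonicity. *)
rewrite (_ : _ @^-1` _ = (\bigcup_(q : rat)
    (if 0 < (ratr q : R) < a then [set w | t < D (ratr q) w] else set0)) `|`
    \bigcap_(n : nat) [set w | D n%:R w <= t]).
  apply: measurableU.
    by apply: bigcupT_measurable_rat => q; case: ifP => _; [exact: measurable_D_gt|exact: measurable0].
  by apply: bigcapT_measurable => n; exact: measurable_D_le.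
apply/seteqP; split => w /=; rewrite in_itv/=.
- move=> Ea; have [at0|/set0P n0] := eqVneq (above t w) set0.
    right=> n _ /=; rewrite leNgt; apply/negP => tn.
    have : set0 (n%:R : R); last by [].
    rewrite -at0; split => //; rewrite lt_neqAle ler0n andbT.
    by apply/negP => /eqP n0; move: tn; rewrite -n0 D0 ltNge t0.
  have [u [u0 ua tu]] := inverse_process_lt n0 Ea.
  have [q] := rat_in_itvoo ua; rewrite in_itv/= => /andP[uq qa].
  left; exists q => //; rewrite qa (lt_trans u0 uq)/=.
  by rewrite (lt_le_trans tu)// D_mono// ltW.
- case=> [[q _]|h].
    case: ifP => // /andP[q0 qa] tq; apply: le_lt_trans qa.
    exact: inverse_process_le.
  suff at0 : above t w = set0 by rewrite /inverse_process -/(above t w) at0 inf0.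
  apply/seteqP; split => // u [u0 tu].
  have := h (Num.truncn u).+1 I => /=; rewrite leNgt (lt_le_trans tu)// D_mono ?(ltW u0)//.
  by rewrite ltW// truncnS_gt.
Qed.

Section regular.
Variable w : Omega.
Hypothesis reg : regular_path D w.

Let above_neq0 t : 0 <= t -> above t w !=set0.
Proof.
move=> t0; have [n tn] := reg.2 t; exists n%:R; split => //.
rewrite lt_neqAle ler0n andbT; apply/negP => /eqP n0.
by move: tn; rewrite -n0 D0 ltNge t0.
Qed.

Lemma inverse_process_mono s t : 0 <= s -> s <= t -> E s w <= E t w.
Proof.
move=> s0 st; apply: lb_le_inf; first by apply: above_neq0; exact: le_trans st.
by move=> v [v0 tv]; apply: inverse_process_le => //; exact: le_lt_trans tv.
Qed.

Lemma inverse_processK u : 0 <= u -> E (D u w) w = u.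
Proof.
move=> u0; have du0 : 0 <= D u w by rewrite -(D0 w) D_mono.
apply/eqP; rewrite eq_le; apply/andP; split.
- apply/ler_addgt0Pr => e e0; apply: inverse_process_le; first by rewrite ltr_wpDl.
  by apply: reg.1 => //; rewrite ltrDl.
- apply: lb_le_inf; first exact: above_neq0.
  move=> v [v0 uv]; rewrite leNgt; apply/negP => vu.
  by move: uv; rewrite ltNge D_mono// ltW.
Qed.

(** The level u is reached at time D u, which is at most T since D u > T would force E T <= u. *)
Lemma inverse_process_range T u : 0 <= T -> 0 <= u -> u <= E T w ->
  exists2 t, 0 <= t <= T & E t w = u.
Proof.
move=> T0 u0; rewrite le_eqVlt => /predU1P[->|uE].
  by exists T => //; rewrite T0 lexx.
exists (D u w); last exact: inverse_processK.
rewrite -{1}(D0 w) D_mono//= leNgt; apply/negP => TD.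
have [u00|u00] := eqVneq u 0; first by move: TD; rewrite u00 D0 ltNge T0.
have := inverse_process_le (_ : 0 < u) TD.
by rewrite lt_neqAle eq_sym u00 u0 leNgt uE => /(_ isT).
Qed.

End regular.

Variable W : R -> {RV P >-> R}.
Hypothesis hW : standard_brownian_motion W.

Lemma brownian_continuous_at w u (e : R) : 0 <= u -> 0 < e ->
  exists2 dl, 0 < dl & forall v, 0 <= v -> `|v - u| < dl -> `|W v w - W u w| < e.
Proof.
move=> u0 e0.
have /subspace_continuousP /(_ u) := @brownian_continuous _ _ _ _ _ hW w.
rewrite /= in_itv/= u0 => /(_ isT) /cvgrPdist_lt /(_ e e0).
rewrite near_withinE => /nbhs_ballP[dl /= dl0 h].
exists dl => // v v0 vu; rewrite distrC; apply: h; last by rewrite /= in_itv/= v0.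
by rewrite /ball/= distrC.
Qed.

Let dyadic (m : nat) (y : R) : R := (Num.truncn (y * 2 ^+ m))%:R * 2^-1 ^+ m.

Let dyadic_le m y : 0 <= y -> dyadic m y <= y.
Proof.
move=> y0; rewrite /dyadic exprVn ler_pdivrMr ?exprn_gt0//.
by rewrite Num.Theory.truncn_le// mulr_ge0// exprn_ge0.
Qed.

Let dyadic_gt m y : y - 2^-1 ^+ m < dyadic m y.
Proof.
have p : 0 < 2 ^+ m :> R by rewrite exprn_gt0.
rewrite /dyadic exprVn ltrBlDr -[X in _ + X]mul1r -mulrDl natr1.
by rewrite ltr_pdivlMr// truncnS_gt.
Qed.

Let half_exp_small (e : R) : 0 < e -> exists m, forall n, (m <= n)%N -> 2^-1 ^+ n < e :> R.
Proof.
move=> e0; exists (Num.truncn e^-1).+1 => n mn.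
rewrite exprVn -[ltRHS]invrK ltf_pV2 ?posrE ?invr_gt0 ?exprn_gt0//.
rewrite (lt_trans (truncnS_gt _))// -natrX ltr_nat.
by rewrite (leq_ltn_trans mn)// ltn_expl.
Qed.

(** Rounding [Y] down to a dyadic mesh leaves countably many values, hence a measurable composition;
    continuity of the paths of [W] gives the limit. *)
Lemma measurable_brownian_at (Y : Omega -> R) : measurable_fun setT Y ->
  (forall w, 0 <= Y w) -> measurable_fun setT (fun w => W (Y w) w).
Proof.
move=> mY Y0.
apply: (@measurable_fun_cvg _ _ _ _ (fun m w => W (dyadic m (Y w)) w)).
- move=> m _ B mB; rewrite setTI.
  rewrite (_ : _ @^-1` _ = \bigcup_(j : nat)
    ((Y @^-1` `[(j%:R / 2 ^+ m)%R, (j.+1%:R / 2 ^+ m)%R[) `&`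
      W (j%:R * 2^-1 ^+ m) @^-1` B)).
    apply: bigcupT_measurable => j; apply: measurableI.
      by rewrite -[_ @^-1` _]setTI; apply: mY => //; exact: measurable_itv.
    by rewrite -[_ @^-1` _]setTI; exact: measurable_funPT.
  have p : 0 < 2 ^+ m :> R by rewrite exprn_gt0.
  have trE j w : (Num.truncn (Y w * 2 ^+ m) == j) =
      (j%:R / 2 ^+ m <= Y w < j.+1%:R / 2 ^+ m).
    rewrite ler_pdivrMr// ltr_pdivlMr// -Num.Theory.truncn_eq//.
    by rewrite mulr_ge0// ltW.
  apply/seteqP; split=> [w /= h|w [j _ []]] /=.
    exists (Num.truncn (Y w * 2 ^+ m)) => //; split => //=.
    by rewrite in_itv/= -trE.
  by rewrite in_itv/= -trE => /eqP <-.
- move=> w _; apply/cvgrPdist_lt => e e0.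
  have [dl dl0 h] := brownian_continuous_at w (Y0 w) e0.
  have [m hm] := half_exp_small dl0.
  exists m => // n /= mn; rewrite distrC; apply: h.
    by rewrite /dyadic mulr_ge0// exprn_ge0.
  have := hm _ mn; have := dyadic_le n (Y0 w); have := dyadic_gt n (Y w).
  by move=> h1 h2 h3; rewrite ler0_norm ?subr_le0//; lra.
Qed.

Definition small_ball (T e : R) : set Omega :=
  [set w | forall t, 0 <= t <= T -> `|time_change W E t w| <= e].

Lemma small_ballE T e : small_ball T e =
  [set w | (ereal_sup [set `|time_change W E t w|%:E | t in `[0%R, T]] <= e%:E)%E].
Proof.
apply/seteqP; split=> w /=.
- move=> h; apply: ge_ereal_sup => x [t /=]; rewrite in_itv/= => tT <-.
  by rewrite lee_fin; exact: h.
- move=> h t tT; rewrite -lee_fin; apply: le_trans h.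
  by apply: ereal_sup_ubound; exists t => //=; rewrite in_itv.
Qed.

Lemma measurable_small_ball T e : 0 <= T -> measurable (small_ball T e).
Proof.
move=> T0.
have mX t : 0 <= t -> measurable [set w | `|time_change W E t w| <= e].
  move=> t0; rewrite (_ : [set _ | _] = (fun w => W (E t w) w) @^-1` `[(- e)%R, e]).
    rewrite -[_ @^-1` _]setTI; apply: measurable_brownian_at => //.
    + exact: measurable_inverse_process.
    + exact: inverse_process_ge0.
  by apply/seteqP; split => w; rewrite /= in_itv/= -ler_norml.
(* Rational times suffice by right-continuity of the time-changed path; T is listed apart, as it has
   no points of the interval to its right. *)
rewrite (_ : small_ball T e = [set w | `|time_change W E T w| <= e] `&`
  \bigcap_(q : rat) (if 0 <= (ratr q : R) <= T
      then [set w | `|time_change W E (ratr q) w| <= e] else setT)).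
  apply: measurableI; first exact: mX.
  have -> : \bigcap_(q : rat) (if 0 <= (ratr q : R) <= T
      then [set w | `|time_change W E (ratr q) w| <= e] else setT) =
      ~` (\bigcup_(q : rat) (~` (if 0 <= (ratr q : R) <= T
      then [set w | `|time_change W E (ratr q) w| <= e] else setT))).
    by rewrite setC_bigcup; apply: eq_bigcapr => q _; rewrite setCK.
  apply: measurableC; apply: bigcupT_measurable_rat => q; apply: measurableC.
  by case: ifP => [/andP[q0 _]|_]; [exact: mX|exact: measurableT].
apply/seteqP; split=> [w h|w [hT hq] t /andP[t0]] /=.
- split; first by apply: h; rewrite T0 lexx.
  by move=> q _; case: ifP => // qT; exact: h.
- rewrite le_eqVlt => /predU1P[->//|tT].
  rewrite leNgt; apply/negP => et.
  set a := `|_| in et; have ea : 0 < a - e by rewrite subr_gt0.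
  have [dl dl0 hW'] := brownian_continuous_at w (inverse_process_ge0 t w) ea.
  have [t' tt' hE] := inverse_process_right_continuous t w dl0.
  have tm : t < Num.min t' T by rewrite lt_min tt' tT.
  have [q] := rat_in_itvoo tm; rewrite in_itv/= lt_min => /andP[tq /andP[qt' qT]].
  have := hq q I; rewrite (le_trans t0 (ltW tq)) (ltW qT)/=.
  have := hW' _ (inverse_process_ge0 (ratr q) w) (hE _ (ltW tq) qt').
  rewrite /time_change; set x := W (E (ratr q) w) w; set y := W (E t w) w => h1 h2.
  have : a <= `|x| + `|x - y|.
    rewrite (_ : a = `|x - (x - y)|); first exact: ler_normB.
    by rewrite opprB addrC subrK.
  lra.
Qed.

(** Every mesh time up to E T is a value of [E] on [0, T]. Conversely E t is rounded down to the
    mesh, which keeps it below E T, and continuity of [W] concludes. *)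
Lemma small_ball_confined T (Y : {mfun Omega >-> R}) e w :
    0 <= T -> Y =1 E T -> regular_path D w ->
  small_ball T e w <->
  forall m, confined_until (sampled W (2^-1 ^+ m)) Y (2^-1 ^+ m) e w.
Proof.
move=> T0 YE reg; split.
- move=> h m j; rewrite YE /sampled => jE; have j0 : 0 <= j%:R * 2^-1 ^+ m :> R by rewrite mulr_ge0// exprn_ge0.
  have [t tT <-] := inverse_process_range reg T0 j0 jE.
  exact: h.
- move=> h t /andP[t0 tT]; rewrite /time_change.
  have u0 := inverse_process_ge0 t w.
  have uT := inverse_process_mono reg t0 tT.
  set u := E t w in u0 uT *; rewrite leNgt; apply/negP => eu.
  have ea : 0 < `|W u w| - e by rewrite subr_gt0.
  have [dl dl0 hc] := brownian_continuous_at w u0 ea.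
  have [m hm] := half_exp_small dl0.
  have h1 := dyadic_le m u0; have h2 := dyadic_gt m u; have h3 := hm m (leqnn m).
  have := h m (Num.truncn (u * 2 ^+ m)); rewrite YE => /(_ (le_trans h1 uT)); rewrite -/(dyadic m u) => h4.
  have v0 : 0 <= dyadic m u by rewrite /dyadic mulr_ge0// exprn_ge0.
  have := hc (dyadic m u) v0.
  rewrite ler0_norm ?subr_le0// => /(_ ltac:(lra)).
  set x := W (dyadic m u) w in h4 *; set y := W u w => h5.
  have : `|y| <= `|x| + `|x - y|.
    rewrite (_ : `|y| = `|x - (x - y)|); first exact: ler_normB.
    by rewrite opprB addrC subrK.
  rewrite -/y in eu h5; lra.
Qed.

End inverse_process_paths.

Lemma near_right0P (R : realType) (Q : set R) :
  (\forall x \near 0^'+, Q x) <->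
  exists2 x0, 0 < x0 & forall x, 0 < x -> x < x0 -> Q x.
Proof.
rewrite near_withinE; split.
- move=> /nbhs_ballP[x0 /= x00 h]; exists x0 => // x xp xx0; apply: h => //.
  by rewrite /ball/= sub0r normrN gtr0_norm.
- move=> [x0 x00 h]; apply/nbhs_ballP; exists x0 => //= x.
  by rewrite /ball/= sub0r normrN => xx0 xp; apply: h => //; rewrite gtr0_norm in xx0.
Qed.

(** * Small-time tail at a level where the Levy measure has no mass *)

Section tail_at_level.
Context d (Omega : measurableType d) (R : realType) (P : probability Omega R).
Variables (b : R) (nu : {measure set (measurableTypeR R) -> \bar R}).
Variable D : R -> {RV P >-> R}.
Hypothesis hD : subordinator b nu D.
Variable T : R.
Hypothesis T0 : 0 < T.
Hypothesis nuT : nu [set T] = 0%E.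

Let c := fine (nu `]T, +oo[%classic).

Let closed_tail : nu `[T, +oo[%classic = nu `]T, +oo[%classic.
Proof.
rewrite -(@setU1itv _ _ _ _ false)// measureU//; last first.
  by apply/seteqP; split => x //= -[->]; rewrite in_itv/= ltxx.
by rewrite [X in (X + _)%E]nuT add0e.
Qed.

(** The tails at levels increasing to T converge to the closed tail nu [T, oo[, which equals the
    open one because nu {T} = 0. *)
Lemma levy_tail_left (k : R) : 0 < k ->
  exists T1, [/\ 0 < T1, T1 < T & fine (nu `]T1, +oo[%classic) <= c + k].
Proof.
(* The denominator starts at 2, so the levels stay positive and their tails finite. *)
move=> k0; pose F (n : nat) : set (measurableTypeR R) := `](T - T / n.+2%:R), +oo[%classic.
have pos (n : nat) : 0 < T - T / n.+2%:R.
  rewrite subr_gt0 ltr_pdivrMr// -[ltLHS]mulr1 ltr_pM2l// ltr1n//.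
have capF : \bigcap_n F n = `[T, +oo[%classic.
  apply/seteqP; split=> x /=; rewrite /F/= in_itv/= andbT.
  - move=> h; rewrite leNgt; apply/negP => xT.
    have tx : 0 < T - x by rewrite subr_gt0.
    have := h (Num.truncn (T / (T - x))) I; rewrite /= in_itv/= andbT.
    apply/negP; rewrite -leNgt lerBrDr -lerBrDl.
    rewrite ler_pdivrMr// mulrC -ler_pdivrMr// (le_trans (ltW (truncnS_gt _)))//.
    by rewrite ler_nat.
  - by move=> Tx n _ /=; rewrite in_itv/= andbT (lt_le_trans _ Tx)// gtrBl divr_gt0.
have Fcvg : (nu \o F) n @[n --> \oo] --> nu `]T, +oo[%classic.
  rewrite -closed_tail -capF; apply: nonincreasing_cvg_mu.
  - exact: levy_tail_fin hD _ (pos 0%N).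
  - by move=> n; exact: measurable_itv.
  - by rewrite capF; exact: measurable_itv.
  - move=> m n mn; apply/subsetPset => x; rewrite /F/= !in_itv/= !andbT.
    apply: le_lt_trans; rewrite lerD2l lerN2 ler_pM2l// lef_pV2 ?posrE//.
    by rewrite ler_nat !ltnS.
have fin_tail (u : R) : 0 < u -> nu `]u, +oo[%classic \is a fin_num.
  by move=> u0; rewrite ge0_fin_numE//; exact: levy_tail_fin hD _ u0.
have fF n : nu (F n) \is a fin_num by exact: fin_tail.
have /cvgrPdist_le/(_ _ k0) [n _ h] : fine (nu (F n)) @[n --> \oo] --> c.
  by apply: fine_cvg; rewrite /c fineK ?fin_tail.
exists (T - T / n.+2%:R); split => //; first by rewrite gtrBl divr_gt0.
have := h n (leqnn n); rewrite ler_distlC => /andP[_]; exact.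
Qed.

Lemma levy_tail_right (k : R) : 0 < k ->
  exists2 T2, T < T2 & c - k <= fine (nu `[T2, +oo[%classic).
Proof.
move=> k0; pose F (n : nat) : set (measurableTypeR R) := `[(T + n.+1%:R^-1), +oo[%classic.
have cupF : \bigcup_n F n = `]T, +oo[%classic.
  apply/seteqP; split=> [x [n _]|x] /=; rewrite /F/= !in_itv/= !andbT.
  - by apply: lt_le_trans; rewrite ltrDl.
  - move=> Tx; have tx : 0 < x - T by rewrite subr_gt0.
    exists (Num.truncn (x - T)^-1) => //=; rewrite in_itv/= andbT -lerBrDl.
    by rewrite -[leRHS]invrK lef_pV2 ?posrE ?invr_gt0// ltW// truncnS_gt.
have Fcvg : (nu \o F) n @[n --> \oo] --> nu `]T, +oo[%classic.
  rewrite -cupF; apply: nondecreasing_cvg_mu.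
  - by move=> n; exact: measurable_itv.
  - by rewrite cupF; exact: measurable_itv.
  - move=> m n mn; apply/subsetPset => x; rewrite /F/= !in_itv/= !andbT.
    by apply: le_trans; rewrite lerD2l lef_pV2 ?posrE// ler_nat ltnS.
have fT : nu `]T, +oo[%classic \is a fin_num.
  by rewrite ge0_fin_numE//; exact: levy_tail_fin hD _ T0.
have fF n : nu (F n) \is a fin_num.
  rewrite ge0_fin_numE//; apply: le_lt_trans (levy_tail_fin hD T0).
  apply: le_measure; rewrite ?inE; [exact: measurable_itv|exact: measurable_itv|].
  by rewrite -cupF; exact: bigcup_sup.
have /cvgrPdist_le/(_ _ k0) [n _ h] : fine (nu (F n)) @[n --> \oo] --> c.
  by apply: fine_cvg; rewrite /c fineK.
exists (T + n.+1%:R^-1); first by rewrite ltrDl.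
have := h n (leqnn n); rewrite ler_distlC => /andP[+ _]; exact.
Qed.

Let measurable_D_gt t x : measurable [set w | t < D x w].
Proof.
rewrite (_ : [set _ | _] = D x @^-1` `]t, +oo[).
  by rewrite -[_ @^-1` _]setTI; apply: measurable_funPT => //; exact: measurable_itv.
by apply/seteqP; split => w; rewrite /= in_itv/= andbT.
Qed.

Let measurable_D_ge t x : measurable [set w | t <= D x w].
Proof.
rewrite (_ : [set _ | _] = D x @^-1` `[t, +oo[).
  by rewrite -[_ @^-1` _]setTI; apply: measurable_funPT => //; exact: measurable_itv.
by apply/seteqP; split => w; rewrite /= in_itv/= andbT.
Qed.

Lemma subordinator_tail (k : R) : 0 < k -> exists2 x0, 0 < x0 &
  forall x, 0 < x -> x < x0 -> `|fine (P [set w | T < D x w]) - c * x| <= k * x.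
Proof.
move=> k0; have k20 : 0 < k / 2 by rewrite divr_gt0.
have [T1 [T10 T1T c1]] := levy_tail_left k20.
have [T2 TT2 c2] := levy_tail_right k20.
have /near_right0P[x1 x10 h1] := subordinator_tail_le hD T10 T1T k20.
have /near_right0P[x2 x20 h2] := subordinator_tail_ge hD T0 TT2 k20.
exists (Num.min x1 x2); first by rewrite lt_min x10.
move=> x xp; rewrite lt_min => /andP[/(h1 x xp) {}h1 /(h2 x xp) {}h2].
have h3 : fine (P [set w | T < D x w]) <= fine (P [set w | T <= D x w]).
  apply: fine_le; rewrite ?fin_num_measure//.
  by apply: le_measure; rewrite ?inE// => w /=; exact: ltW.
have h4 : x * (fine (nu `]T1, +oo[%classic) + k / 2) <= x * (c + k / 2 + k / 2).
  by rewrite ler_pM2l// lerD2r.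
have h5 : x * (c - k / 2 - k / 2) <= x * (fine (nu `[T2, +oo[%classic) - k / 2).
  by rewrite ler_pM2l// lerB.
rewrite ler_norml; apply/andP; split; lra.
Qed.

(** Beyond x0 the quadratic term takes over: the probability is at most 1 <= (x / x0)^2, and c x <=
    (c / x0) x^2. A bound at every x can then be averaged over the exit time. *)
Lemma subordinator_tail_quadratic (k : R) : 0 < k -> exists2 K, 0 <= K &
  forall x, 0 < x -> `|fine (P [set w | T < D x w]) - c * x| <= k * x + K * x ^+ 2.
Proof.
move=> k0; have [x0 x00 h] := subordinator_tail k0.
have c0 : 0 <= c by rewrite /c fine_ge0.
exists (x0^-1 ^+ 2 + c / x0); first by rewrite addr_ge0// ?exprn_ge0// ?divr_ge0// ?invr_ge0 ltW.
move=> x xp; have [xx0|x0x] := ltP x x0.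
  apply: le_trans (h _ xp xx0) _; rewrite lerDl mulr_ge0// ?exprn_ge0// ?(ltW xp)//.
  by rewrite addr_ge0// ?exprn_ge0// ?divr_ge0// ?invr_ge0 ltW.
have p0 : 0 <= fine (P [set w | T < D x w]) by rewrite fine_ge0.
have p1 : fine (P [set w | T < D x w]) <= 1.
  by rewrite -lee_fin fineK ?fin_num_measure// probability_le1.
have y1 : 1 <= x / x0 by rewrite ler_pdivlMr// mul1r.
have y2 : 1 <= (x / x0) ^+ 2 by rewrite expr_ge1// (le_trans ler01).
have y3 : c * x <= c / x0 * x ^+ 2.
  rewrite (_ : c / x0 * x ^+ 2 = c * x * (x / x0)); last by ring.
  by rewrite ler_peMr// mulr_ge0// ltW.
have kx : 0 <= k * x by rewrite mulr_ge0// ltW.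
rewrite ler_norml mulrDl -exprMn [x0^-1 * x]mulrC.
have cx : 0 <= c * x by rewrite mulr_ge0// ltW.
apply/andP; split; lra.
Qed.

End tail_at_level.

(** * The small ball probability *)

Lemma le_measure_negligible d (T : measurableType d) (R : realType)
    (mu : {measure set T -> \bar R}) (A B N : set T) :
  measurable A -> measurable B -> mu.-negligible N -> A `<=` B `|` N ->
  (mu A <= mu B)%E.
Proof.
move=> mA mB [M [mM M0 NM]] AB.
apply: (@le_trans _ _ (mu (B `|` M))).
  apply: le_measure; rewrite ?inE//; first exact: measurableU.
  by move=> x /AB [Bx|/NM]; [left|right].
by rewrite (le_trans (measureU2 _ _ _))// [X in (_ + X)%E]M0 adde0.
Qed.

Section small_ball.
Context d (Omega : measurableType d) (R : realType) (P : probability Omega R).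
Variables (b : R) (nu : {measure set (measurableTypeR R) -> \bar R}).
Variables D W : R -> {RV P >-> R}.
Hypothesis hD : subordinator b nu D.
Hypothesis hnu : nu `]0%R, +oo[%classic = +oo%E.
Hypothesis hW : standard_brownian_motion W.
Hypothesis hEW : independent_processes P (inverse_process D) W.
Variable T : R.
Hypothesis T0 : 0 < T.
Hypothesis nuT : nu [set T] = 0%E.

Let c := fine (nu `]T, +oo[%classic).
Let E := inverse_process D T.

Let mE : measurable_fun setT E.
Proof. by apply: (measurable_inverse_process hD); exact: ltW. Qed.

Let measurable_E_lt r : measurable [set w | (E w < r)%R].
Proof.
rewrite (_ : [set _ | _] = E @^-1` `]-oo, r[).
  by rewrite -[_ @^-1` _]setTI; apply: mE => //; exact: measurable_itv.
by apply/seteqP; split => w; rewrite /= in_itv.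
Qed.

Let measurable_D_gt x : measurable [set w | T < D x w].
Proof.
rewrite (_ : [set _ | _] = D x @^-1` `]T, +oo[).
  by rewrite -[_ @^-1` _]setTI; apply: measurable_funPT => //; exact: measurable_itv.
by apply/seteqP; split => w; rewrite /= in_itv/= andbT.
Qed.

(** D r' > T only gives E <= r', whence the gap between r' and r. *)
Let prob_E_lt_ge r r' : 0 < r' -> r' < r ->
  fine (P [set w | T < D r' w]) <= fine (P [set w | E w < r]).
Proof.
move=> r'0 r'r; apply: fine_le; rewrite ?fin_num_measure//.
apply: le_measure; rewrite ?inE// => w /= Tw.
by apply: le_lt_trans r'r; exact: inverse_process_le.
Qed.

(** The inclusion can fail on a path that never exceeds T, where E = 0 by convention; such paths are
    among the negligible irregular ones. *)
Let prob_E_lt_le r : 0 < r ->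
  fine (P [set w | E w < r]) <= fine (P [set w | T < D r w]).
Proof.
move=> r0; apply: fine_le; rewrite ?fin_num_measure//.
apply: (le_measure_negligible _ _ (regular_path_ae hD hnu)) => // w /= Ew.
have [reg|] := pselect (regular_path D w); [left|by right].
have n0 : [set u | 0 < u /\ T < D u w] !=set0.
  have [n Tn] := reg.2 T; exists n%:R; split => //.
  rewrite lt_neqAle ler0n andbT; apply/negP => /eqP n0.
  by move: Tn; rewrite -n0 (levy_start (subordinator_levy hD)) ltNge ltW.
have [u [u0 ur Tu]] := inverse_process_lt n0 Ew.
by rewrite /= (lt_trans Tu)// reg.1// ltW.
Qed.

Lemma inverse_process_small_time (k : R) : 0 < k -> exists2 K, 0 <= K &
  forall r, 0 < r -> `|fine (P [set w | E w < r]) - c * r| <= k * r + K * r ^+ 2.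
Proof.
move=> k0; have k20 : 0 < k / 2 by rewrite divr_gt0.
have [K K0] := subordinator_tail_quadratic hD T0 nuT k20; rewrite -/c => h.
have c0 : 0 <= c by rewrite /c fine_ge0.
exists K => // r r0; have Kr : 0 <= K * r ^+ 2 by rewrite mulr_ge0// exprn_ge0// ltW.
have ck : 0 < c + k by rewrite ltr_wpDl.
(* Evaluating the tail at r' = (1 - dl) r instead of r loses c dl r, at most k r / 2. *)
pose dl := k / 2 / (c + k).
have dl0 : 0 < dl by rewrite divr_gt0.
have dl1 : dl < 1 by rewrite ltr_pdivrMr//; lra.
have cdl : c * dl <= k / 2.
  rewrite /dl mulrCA ler_piMr ?(ltW k20)// ler_pdivrMr// mul1r; lra.
pose r' := r * (1 - dl).
have r'0 : 0 < r' by rewrite mulr_gt0// subr_gt0.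
have r'r : r' < r by rewrite /r' gtr_pMr//; lra.
have := h _ r'0; rewrite ler_norml => /andP[h1 _].
have := h _ r0; rewrite ler_norml => /andP[_ h2].
have h3 := prob_E_lt_ge r'0 r'r; have h4 := prob_E_lt_le r0.
have cr : c * r - k / 2 * r <= c * r'.
  rewrite (_ : c * r' = c * r - c * dl * r); last by rewrite /r'; ring.
  by rewrite lerB// ler_pM2r.
have r2 : K * r' ^+ 2 <= K * r ^+ 2.
  by rewrite ler_wpM2l// ler_pXn2r ?nnegrE// ltW.
have kr : k / 2 * r' <= k / 2 * r by rewrite ler_pM2l// ltW.
have kr0 : 0 <= k / 2 * r by rewrite mulr_ge0// ltW.
rewrite ler_norml; apply/andP; split; lra.
Qed.

Let ET : {mfun Omega >-> R} := HB.pack E (isMeasurableFun.Build _ _ _ _ _ mE).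

Let indep dl e n r : 0 < dl ->
  (P ([set w | (ET w < r)%R] `&` confined (sampled W dl) e n) =
   P [set w | (ET w < r)%R] * P (confined (sampled W dl) e n))%E.
Proof.
move=> dl0; apply: hEW.
- rewrite /process_sigma_algebra; apply: sub_sigma_algebra; exists T; first by rewrite /= in_itv/= andbT ltW.
  exists `]-oo, r[%classic; first exact: measurable_itv.
  by rewrite setTI; apply/seteqP; split => w; rewrite /= in_itv.
- rewrite confinedE /process_sigma_algebra.
  apply: (@bigcap_measurableType _ (g_sigma_algebraType (\bigcup_(t in `[0, +oo[)
        preimage_set_system [set: Omega] (W t)
          (@measurable _ (measurableTypeR R))))).
  move=> j _; apply: sub_sigma_algebra; exists (j%:R * dl).
    by rewrite /= in_itv/= andbT mulr_ge0// ltW.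
  by exists `[- e, e]%classic; [exact: measurable_itv|rewrite setTI].
Qed.

Let B e m := confined_until (sampled W (2^-1 ^+ m)) ET (2^-1 ^+ m) e.

Let mB e m : measurable (B e m).
Proof. exact: measurable_confined_until. Qed.

(** Dyadic meshes are nested: j 2^-m = (2 j) 2^-(m + 1). *)
Let B_decreasing e : {homo B e : n m / (n <= m)%N >-> (m <= n)%O}.
Proof.
apply: homo_leq => [A|A1 A2 A3 h1 h2|m]; [by []|exact: le_trans h2 h1|].
apply/subsetPset => w h j; rewrite /sampled => jE.
have e2 : j%:R * 2^-1 ^+ m = j.*2%:R * 2^-1 ^+ m.+1 :> R.
  by rewrite -muln2 natrM exprS -mulrA mulVKf.
by rewrite e2; apply: h; rewrite -e2.
Qed.

Let small_ball_cvg e : P (B e m) @[m --> \oo] --> P (small_ball D W T e).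
Proof.
have mS : measurable (small_ball D W T e).
  by apply: (measurable_small_ball hD hW); exact: ltW.
have mI : measurable (\bigcap_m B e m) by exact: bigcapT_measurable.
have confE w : regular_path D w -> small_ball D W T e w <-> forall m, B e m w.
  by apply: (small_ball_confined hD hW) => //; exact: ltW.
have -> : P (small_ball D W T e) = P (\bigcap_m B e m).
  apply/eqP; rewrite eq_le; apply/andP; split;
    apply: (le_measure_negligible _ _ (regular_path_ae hD hnu)) => // w h;
    (have [reg|] := pselect (regular_path D w); [left|by right]).
  - by move=> m _; exact: (confE w reg).1 h m.
  - by apply: (confE w reg).2 => m; exact: h.
apply: nonincreasing_cvg_mu => //.
by rewrite (le_lt_trans (probability_le1 _ _))// ltry.
Qed.

(** For each slack [rho] the mesh bound holds for all large m; the limit in m yields the exact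
    event, and [rho] is arbitrary. The constant K is uniform in e. *)
Lemma small_ball_estimate (k : R) : 0 < k -> exists2 K, 0 <= K &
  forall e, 0 < e -> `|fine (P (small_ball D W T e)) - c * e ^+ 2| <=
    k * e ^+ 2 + K * e ^+ 4.
Proof.
move=> k0; have [K K0 hK] := inverse_process_small_time k0.
exists (8192 * K) => [|e e0]; [lra|apply/ler_addgt0Pr => rho rho0].
have c0 : 0 <= c by rewrite /c fine_ge0.
have [dl0 dl00 h] := brownian_confined_until_estimate hW c0 (ltW k0) K0 e0 rho0
  (fun dl n r => @indep dl e n r) hK.
have cv : `|fine (P (B e m)) - c * e ^+ 2| @[m --> \oo] -->
    `|fine (P (small_ball D W T e)) - c * e ^+ 2|.
  apply: cvg_norm; apply: cvgB; last exact: cvg_cst.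
  have mS : measurable (small_ball D W T e).
    by apply: (measurable_small_ball hD hW); exact: ltW.
  by apply: fine_cvg; rewrite fineK ?fin_num_measure//; exact: small_ball_cvg.
rewrite -(cvg_lim _ cv)//; apply: limr_le; first by apply/cvg_ex; eexists; exact: cv.
have : 2^-1 ^+ m @[m --> \oo] --> (0 : R).
  by apply: cvg_expr; rewrite gtr0_norm ?invr_gt0// invf_lt1// ltr1n.
move=> /cvgrPdist_le /(_ _ dl00); apply: filterS => m.
rewrite sub0r normrN gtr0_norm ?exprn_gt0// => hm.
by apply: h => //; rewrite exprn_gt0.
Qed.

End small_ball.

Theorem theorem1 (d : measure_display) (Omega : measurableType d)
    (R : realType) (P : probability Omega R)
    (b : R) (nu : {measure set (measurableTypeR R) -> \bar R})
    (D W : R -> {RV P >-> R})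
    (hD : subordinator b nu D)
    (hnu : nu `]0%R, +oo[%classic = +oo%E)
    (hW : standard_brownian_motion W)
    (hEW : independent_processes P (inverse_process D) W)
    (T : R) (hT : 0 < T) (hnuT : nu [set T] = 0%E) :
  let p := small_ball_probability P (time_change W (inverse_process D)) T in
  ((0 < nu `]T, +oo[%classic)%E ->
    equiv_at_right0 p
      (fun e => 32 / pi ^+ 3 * fine (nu `]T, +oo[%classic)
         * (\big[+%R/0]_(1 <= k <oo) ((-1) ^+ k.-1 / (2 * k%:R - 1) ^+ 3 : R))
         * e ^+ 2))
  /\
  (nu `]T, +oo[%classic = 0%E -> p =o_ (0^'+) (fun e => e ^+ 2)).
Proof.
move=> p; set c := fine (nu `]T, +oo[%classic).
(* One estimate for both cases: divided by c e^2 it is the equivalence when c > 0, and it is the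
   little-o statement when c = 0. *)
have near_p k : 0 < k -> \forall e \near 0^'+, `|p e - c * e ^+ 2| <= k * e ^+ 2.
  move=> k0; have k20 : 0 < k / 2 by rewrite divr_gt0.
  have [K K0 h] := small_ball_estimate hD hnu hW hEW hT hnuT k20.
  apply/near_right0P.
  have q0 : 0 < 1 + K by rewrite ltr_pwDl.
  (* Below these thresholds K e^2 <= K e <= k / 2; the denominator 1 + K stays positive when K =
     0. *)
  exists (Num.min 1 (k / 2 / (1 + K))); first by rewrite lt_min ltr01 divr_gt0.
  move=> e e0; rewrite lt_min => /andP[e1]; rewrite ltr_pdivlMr// => eK.
  rewrite {1}/p /small_ball_probability -small_ballE.
  apply: le_trans (h e e0) _; rewrite [leRHS](splitr (k * _)) lerD//; first by lra.
  rewrite (_ : K * e ^+ 4 = K * e ^+ 2 * e ^+ 2); last by ring.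
  rewrite [leRHS]mulrAC ler_pM2r ?exprn_gt0//.
  have : K * e ^+ 2 <= K * e.
    by rewrite ler_wpM2l// expr2 ler_piMr// ltW.
  lra.
split.
- move=> nu0; have c0 : 0 < c.
    by rewrite /c fine_gt0// nu0 (levy_tail_fin hD).
  rewrite /equiv_at_right0 sum_alternating_odd_cubes.
  have -> : (fun e => p e / (32 / pi ^+ 3 * c * (pi ^+ 3 / 32) * e ^+ 2)) =
      (fun e => p e / (c * e ^+ 2)).
    apply/funext => e; congr (_ / (_ * _)).
    have : pi ^+ 3 != 0 :> R by rewrite gt_eqF// exprn_gt0// pi_gt0.
    by set q := pi ^+ 3 => q0; field.
  apply/cvgrPdist_le => k k0.
  have := near_p _ (mulr_gt0 c0 k0) => /near_right0P[x0 x00 h].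
  apply/near_right0P; exists x0 => // e e0 ex.
  have ce : 0 < c * e ^+ 2 by rewrite mulr_gt0// exprn_gt0.
  rewrite distrC -[X in _ - X](divff (lt0r_neq0 ce)) -mulrBl normrM.
  rewrite normfV (gtr0_norm ce) ler_pdivrMr//.
  by rewrite mulrA [k * c]mulrC; exact: h.
- move=> nu0; have c0 : c = 0 by rewrite /c nu0.
  apply/eqoP => k k0; have := near_p _ k0; apply: filterS => e.
  by rewrite c0 mul0r subr0 [`|e ^+ 2|]ger0_norm// sqr_ge0.
Qed.
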